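(* The piecewise constant interpolations $(r_\tau,\sigma_\tau)_{\tau>0}$ produced by the splitting scheme satisfy $\sup_{t\in[0,T]}\|r_\tau(t)\|_{L^\infty}\le C$, $\sup_{t\in[0,T]}\|\sigma_\tau(t)\|_{L^\infty}\le C$, $\sup_{t\in[0,T]}|r_\tau(t)|_{BV}\le C$, $\sup_{t\in[0,T]}|\sigma_\tau(t)|_{BV}\le C$, for a constant $C<\infty$ independent of $\tau$ (depending on $T$, the data and $F_i,G_i$). Consequently (Corollary), $(\rho_\tau)_{\tau>0}$ and $(\eta_\tau)_{\tau>0}$ are bounded in $BV(\Omega)\cap L^\infty(\Omega)$ uniformly in $t\in[0,T]$ and $\tau$.
   Context: Setting. $\Omega\subset\mathbb R$ is a bounded open interval and $T>0$. $BV(\Omega)$ is the space of functions $f:\bar\Omega\to\mathbb R$ with finite total variation $|f|_{BV}:=\sup_P\sum_{i=1}^{|P|-1}|f(x_{i+1})-f(x_i)|$, the supremum over finite partitions $P=\{x_1<\dots<x_{|P|}\}\subset\Omega$. A function $\chi:[0,\infty)\to\mathbb R$ is an internal energy density: $\chi\in C^0([0,\infty))\cap C^2((0,\infty))$, $\chi''>0$ on $(0,\infty)$, $\lim_{h\downarrow0}\chi'(h)=0$, and the integrals $\kappa(x):=\int_1^x\frac{\chi''(s)}{s}\,ds$ and $K(\sigma):=\int_0^\sigma\kappa(x)\,dx$ exist. Put $\mathcal K(\sigma):=\int_\Omega K(\sigma)\,dx$ and $\mathcal E(\rho,\eta):=\int_\Omega\chi(\rho+\eta)\,dx$. The functions $F_1,F_2,G_1,G_2:[0,\infty)^2\to\mathbb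 R$ are bounded and Lipschitz, with $G_1(0,\eta)\ge0$ for all $\eta\ge0$ and $G_2(\rho,0)\ge0$ for all $\rho\ge0$. For $\sigma\ge0$, $r\in[0,1]$ set $\tilde F_i(\sigma,r)=F_i(r\sigma,(1-r)\sigma)$, $\tilde G_i(\sigma,r)=G_i(r\sigma,(1-r)\sigma)$, $A_1=\tilde F_1+\tilde G_2$, $A_2=\tilde G_1+\tilde F_2$, $A_3=\tilde F_1-\tilde F_2$, $\Sigma(\sigma,r)=\sigma(rA_1+(1-r)A_2)$, $R(\sigma,r)=r(1-r)A_3+(1-r)^2\tilde G_1-r^2\tilde G_2$. Initial data: $\rho_0,\eta_0\in BV(\Omega)\cap L^\infty(\Omega)$ nonnegative, $\sigma_0=\rho_0+\eta_0$, and $r_0\in BV(\Omega)$ with $0\le r_0\le1$ and $r_0=\rho_0/\sigma_0$ on $\{\sigma_0>0\}$. For $m>0$, $\mathcal P^m(\Omega)$ is the set of nonnegative Borel measures on $\Omega$ of total mass $m$; $W_p$ ($p=1,2$) is the $p$-Wasserstein distance between measures of equal mass, $W_p^p(\mu,\nu)=\inf_\gamma\int|x-y|^p\,d\gamma$ over couplings $\gamma$ of $\mu,\nu$. Splitting scheme. Fix $\tau\in(0,1)$ and $N\in\mathbb N$ with $N\tau=T$; set $r^0=r_0$, $\sigma^0=\sigma_0$. For $n=0,\dots,N-1$: (Reaction step) for each $x\in\Omega$ solve $\dot\sigma=\Sigma(\sigma,r)$, $\dot r=R(\sigma,r)$ on $[0,\tau]$ with $\sigma(0)=\sigma^n(x)$,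 $r(0)=r^n(x)$, and set $\sigma^{n+1/2}(x)=\sigma(\tau)$, $r^{n+1/2}(x)=r(\tau)$, $\rho^{n+1/2}=r^{n+1/2}\sigma^{n+1/2}$, $\eta^{n+1/2}=(1-r^{n+1/2})\sigma^{n+1/2}$, $U^{n+1/2}=(\rho^{n+1/2},\eta^{n+1/2})$. (Diffusion step) with $m_1=\int_\Omega\rho^{n+1/2}$, $m_2=\int_\Omega\eta^{n+1/2}$, let $U^{n+1}=(\rho^{n+1},\eta^{n+1})$ be a minimiser over $(\rho,\eta)\in\mathcal P^{m_1}(\Omega)\times\mathcal P^{m_2}(\Omega)$ of $\frac1{2\tau}\big[W_2^2(\rho,\rho^{n+1/2})+W_2^2(\eta,\eta^{n+1/2})\big]+\mathcal E(\rho,\eta)$; set $\sigma^{n+1}=\rho^{n+1}+\eta^{n+1}$ and $r^{n+1}=r^{n+1/2}\circ\mathcal T$, where $\mathcal T$ is the nondecreasing optimal transport map pushing $\sigma^{n+1}$ forward to $\sigma^{n+1/2}$. Also $\rho^n=r^n\sigma^n$, $\eta^n=(1-r^n)\sigma^n$, $U^n=(\rho^n,\eta^n)$. Piecewise constant interpolation: for $t\in[n\tau,(n+1)\tau)$, $r_\tau(t)=r^n$, $\sigma_\tau(t)=\sigma^n$, $\rho_\tau(t)=r^n\sigma^n$, $\eta_\tau(t)=(1-r^n)\sigma^n$, $U_\tau=(\rho_\tau,\eta_\tau)$. *)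

(* Defs.v *)
From HB Require Import structures.
From mathcomp Require Import all_boot all_order all_algebra.
From mathcomp Require Import all_classical all_reals all_analysis.
Import Order.TTheory GRing.Theory Num.Theory.
Import numFieldNormedType.Exports.

Set Implicit Arguments.
Unset Strict Implicit.
Unset Printing Implicit Defensive.

Local Open Scope classical_set_scope.
Local Open Scope ring_scope.

(* Omega = ]a, b[ ; functions on Omega-bar are represented as R -> R
   (values outside Omega are irrelevant). *)

Section SplittingDefs.
Context {R : realType}.
Local Notation mu := (@lebesgue_measure R).

Definition tv (a b : R) (f : R -> R) : \bar R :=
  ereal_sup [set v | exists (n : nat) (x : nat -> R),
    (forall i, (i <= n)%N -> a < x i < b) /\
    (forall i, (i < n)%N -> x i < x i.+1) /\
    v = (\sum_(i < n) `|f (x i.+1) - f (x i)|)%:E].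

Definition adm_density (a b : R) (m : \bar R) (f : R -> R) : Prop :=
  measurable_fun `]a, b[ f /\ (forall x, a < x < b -> 0 <= f x) /\
  (\int[mu]_(x in `]a, b[) (f x)%:E = m)%E.

Definition coupling (a b : R) (f g : R -> R)
    (gam : {measure set (R * R)%type -> \bar R}) : Prop :=
  forall A : set R, measurable A ->
    gam (A `*` setT) = (\int[mu]_(x in A `&` `]a, b[) (f x)%:E)%E /\
    gam (setT `*` A) = (\int[mu]_(x in A `&` `]a, b[) (g x)%:E)%E.

Definition W2sq (a b : R) (f g : R -> R) : \bar R :=
  ereal_inf [set v | exists gam : {measure set (R * R)%type -> \bar R},
    coupling a b f g gam /\ v = (\int[gam]_z (((z.1 - z.2) ^+ 2)%:E))%E].

Definition energy (a b : R) (chi : R -> R) (f g : R -> R) : \bar R :=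
  (\int[mu]_(x in `]a, b[) (chi (f x + g x))%:E)%E.

Definition jko (a b tau : R) (chi : R -> R) (fh gh f g : R -> R) : \bar R :=
  ((W2sq a b f fh + W2sq a b g gh) * ((2 * tau)^-1)%:E + energy a b chi f g)%E.

Definition kappa (chi : R -> R) (x : R) : R :=
  if 1 <= x then Rintegral mu `[1, x] (fun s => derive1n 2 chi s / s)
  else - Rintegral mu `[x, 1] (fun s => derive1n 2 chi s / s).

Definition bounded_nonneg2 (F : R -> R -> R) : Prop :=
  exists M : R, forall x y, 0 <= x -> 0 <= y -> `|F x y| <= M.

Definition lipschitz_nonneg2 (F : R -> R -> R) : Prop :=
  exists L : R, forall x y x' y', 0 <= x -> 0 <= y -> 0 <= x' -> 0 <= y' ->
    `|F x y - F x' y'| <= L * (`|x - x'| + `|y - y'|).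

Definition tildeF (F : R -> R -> R) (s r : R) : R := F (r * s) ((1 - r) * s).

Definition SigmaF (F1 F2 G1 G2 : R -> R -> R) (s r : R) : R :=
  s * (r * (tildeF F1 s r + tildeF G2 s r) + (1 - r) * (tildeF G1 s r + tildeF F2 s r)).

Definition RF (F1 F2 G1 G2 : R -> R -> R) (s r : R) : R :=
  r * (1 - r) * (tildeF F1 s r - tildeF F2 s r)
  + (1 - r) ^+ 2 * tildeF G1 s r - r ^+ 2 * tildeF G2 s r.

(* (s1,r1) is the value at time tau of the solution of
   s' = Sig(s,r), r' = Rr(s,r), (s,r)(0) = (s0,r0), staying in the domain
   [0,oo) x [0,1] where the system is defined. *)
Definition reaction_step (Sig Rr : R -> R -> R) (tau s0 r0 s1 r1 : R) : Prop :=
  exists s q : R -> R,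
    s 0 = s0 /\ q 0 = r0 /\ s tau = s1 /\ q tau = r1 /\
    {within `[0, tau], continuous s} /\ {within `[0, tau], continuous q} /\
    (forall t, 0 < t < tau ->
        is_derive t 1 s (Sig (s t) (q t)) /\ is_derive t 1 q (Rr (s t) (q t))) /\
    (forall t, 0 <= t <= tau -> 0 <= s t /\ 0 <= q t <= 1).

Definition right_continuous_on (a b : R) (f : R -> R) : Prop :=
  forall x, a < x < b -> f y @[y --> x^'+] --> f x.

(* One run of the splitting scheme with step tau and N steps.
   r n, sig n : r^n, sigma^n ;  rh n, sh n : r^{n+1/2}, sigma^{n+1/2} ;
   rhoD n, etaD n : the minimiser (rho^{n+1}, eta^{n+1}) of the diffusion step
   (densities, right-continuous representatives) ;
   Tm n : the nondecreasing transport map pushing sigma^{n+1} to sigma^{n+1/2}. *)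
Definition scheme_run (a b : R) (chi : R -> R) (F1 F2 G1 G2 : R -> R -> R)
    (r0 sig0 : R -> R) (tau : R) (N : nat)
    (r sig rh sh rhoD etaD Tm : nat -> R -> R) : Prop :=
  (forall x, r 0%N x = r0 x) /\ (forall x, sig 0%N x = sig0 x) /\
  forall n, (n < N)%N ->
    (forall x, a < x < b ->
       reaction_step (SigmaF F1 F2 G1 G2) (RF F1 F2 G1 G2) tau
         (sig n x) (r n x) (sh n x) (rh n x)) /\
    (let rhoh := fun x => rh n x * sh n x in
     let etah := fun x => (1 - rh n x) * sh n x in
     let m1 := (\int[mu]_(x in `]a, b[) (rhoh x)%:E)%E in
     let m2 := (\int[mu]_(x in `]a, b[) (etah x)%:E)%E in
     adm_density a b m1 (rhoD n) /\ adm_density a b m2 (etaD n) /\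
     (forall f g, adm_density a b m1 f -> adm_density a b m2 g ->
        (jko a b tau chi rhoh etah (rhoD n) (etaD n)
           <= jko a b tau chi rhoh etah f g)%E) /\
     right_continuous_on a b (rhoD n) /\ right_continuous_on a b (etaD n)) /\
    (forall x, sig n.+1 x = rhoD n x + etaD n x) /\
    (forall x y, a < x -> x <= y -> y < b -> Tm n x <= Tm n y) /\
    (forall x, a < x < b -> a < Tm n x < b) /\
    (forall B : set R, measurable B ->
       (\int[mu]_(x in `]a, b[ `&` (Tm n @^-1` B)) (sig n.+1 x)%:E)%E
       = (\int[mu]_(x in `]a, b[ `&` B) (sh n x)%:E)%E) /\
    (forall x, a < x < b -> r n.+1 x = rh n (Tm n x)).

End SplittingDefs.

(* Main.v *)
Require Import Defs.
From HB Require Import structures.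
From mathcomp Require Import all_boot all_order all_algebra.
From mathcomp Require Import all_classical all_reals all_analysis measurable_realfun.
From mathcomp Require Import ring lra.
Import Order.TTheory GRing.Theory Num.Theory.
Import numFieldNormedType.Exports.
Local Open Scope classical_set_scope.
Local Open Scope ring_scope.
Set Implicit Arguments.
Unset Strict Implicit.
Unset Printing Implicit Defensive.

(* One step consists of a reaction flow, controlled by Gronwall's inequality
   and Lipschitz dependence on the data, and of a diffusion step, which does
   not increase the supremum and the total variation of sigma.

   For the diffusion step let T be the monotone map pushing the minimiser sigma
   to h = sigma^{n+1/2}.  Kantorovich duality with the convex primitive of T
   shows that the two transport costs of the minimiser add up to at least
   int (x - T x)^2 sigma.  Moving a small amount of mass from a neighbourhood of
   x to one of y, split between the species in the ratio r^{n+1/2} o T, and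
   using minimality gives, with v = chi'(sigma) and sigma(x) > 0,
     v(x) <= v(y) + ((y - T x)^2 - (x - T x)^2) / (2 tau).
   Hence v is Lipschitz, and T x - x has the sign of the slope of v at suitable
   points: T is contracting around a local maximum of sigma and expanding around
   a local minimum.  As T transports sigma to h, the function h is at least as
   large as sigma somewhere near the image of a local maximum, and at least as
   small near the image of a local minimum. *)

(** * Total variation *)

(* Partitions of [tv] are strictly increasing; allowing repetitions here makes
   this bound stable under composition with monotone maps. *)
Definition var_le {R : realType} (a b : R) (f : R -> R) (V : R) :=
  forall (n : nat) (x : nat -> R), (forall i, (i <= n)%N -> a < x i < b) ->
    (forall i, (i < n)%N -> x i <= x i.+1) ->
    \sum_(i < n) `|f (x i.+1) - f (x i)| <= V.

Lemma distinct_values_subseq {R : realType} (a b : R) (f : R -> R) n (x : nat -> R) :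
  (forall i, (i <= n)%N -> a < x i < b) ->
  (forall i, (i < n)%N -> x i <= x i.+1) ->
  exists m (y : nat -> R), [/\ forall i, (i <= m)%N -> a < y i < b,
    forall i, (i < m)%N -> y i < y i.+1 /\ f (y i) != f (y i.+1),
    y m <= x n, f (y m) = f (x n) &
    \sum_(i < n) `|f (x i.+1) - f (x i)| = \sum_(i < m) `|f (y i.+1) - f (y i)|].
Proof.
elim: n => [|n IH] xab xle.
  by exists 0%N, x; split => //; rewrite !big_ord0.
have [||m [y [yab yd ylast fy E]]] := IH.
- by move=> i ile; apply: xab; rewrite ltnW.
- by move=> i ilt; apply: xle; rewrite ltnW.
have yx : y m <= x n.+1 by apply: le_trans ylast (xle _ _).
rewrite big_ord_recr /= E -fy.
have [fe|fne] := eqVneq (f (y m)) (f (x n.+1)).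
  by exists m, y; split => //; rewrite fe subrr normr0 addr0.
exists m.+1, (fun i => if (i <= m)%N then y i else x n.+1); split => //=.
- by move=> i _; case: leqP => [/yab//|_]; exact: xab.
- move=> i; rewrite ltnS => im; rewrite im; case: (ltnP i m) => [/yd//|mi].
  have -> : i = m by apply/eqP; rewrite eqn_leq im.
  split => //; rewrite lt_neqAle yx andbT.
  by apply: contraNneq fne => ->.
- by rewrite ltnn.
- by rewrite ltnn.
- rewrite big_ord_recr /= leqnn ltnn; congr (_ + _); apply: eq_bigr => i _.
  by rewrite ltn_ord (ltnW (ltn_ord i)).
Qed.

Lemma tv_leP {R : realType} (a b : R) (f : R -> R) V :
  (tv a b f <= V%:E)%E <-> var_le a b f V.
Proof.
split=> [tvV n x xab xle|fV].
  have [m [y [yab yd _ _ ->]]] := distinct_values_subseq f xab xle.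
  rewrite -lee_fin; apply: le_trans tvV; apply: ereal_sup_ubound.
  by exists m, y; split=> //; split => // i /yd[].
apply: ge_ereal_sup => _ [n [x [xab [xlt ->]]]]; rewrite lee_fin.
by apply: fV => // i /xlt/ltW.
Qed.

Lemma tv_fin_var_le {R : realType} (a b : R) (f : R -> R) :
  (tv a b f < +oo)%E -> exists V, var_le a b f V.
Proof.
case E : (tv a b f) => [V| |] // _.
  by exists V; apply/tv_leP; rewrite E.
by exists 0; apply/tv_leP; rewrite E leNye.
Qed.

Lemma var_leW {R : realType} (a b : R) (f : R -> R) (V W : R) :
  V <= W -> var_le a b f V -> var_le a b f W.
Proof. by move=> VW fV n x xab xle; apply: le_trans VW; exact: fV. Qed.

Lemma var_le_ge0 {R : realType} (a b : R) (f : R -> R) (V : R) :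
  a < b -> var_le a b f V -> 0 <= V.
Proof.
move=> ab /(_ 0%N (fun=> (a + b) / 2)); rewrite big_ord0; apply => // i _.
by apply/andP; split; lra.
Qed.

Lemma var_leD {R : realType} (a b : R) (f g : R -> R) (V W : R) :
  var_le a b f V -> var_le a b g W -> var_le a b (fun x => f x + g x) (V + W).
Proof.
move=> fV gW n x xab xle; apply: le_trans (lerD (fV n x xab xle) (gW n x xab xle)).
rewrite -big_split /=; apply: ler_sum => i _; apply: le_trans (ler_normD _ _).
by rewrite le_eqVlt (_ : _ - _ = f (x i.+1) - f (x i) + (g (x i.+1) - g (x i))) ?eqxx//; ring.
Qed.

Lemma var_le_subl {R : realType} (a b c : R) (f : R -> R) (V : R) :
  var_le a b f V -> var_le a b (fun x => c - f x) V.
Proof.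
move=> fV n x xab xle; apply: le_trans (fV n x xab xle); apply: ler_sum => i _.
by rewrite opprB addrC addrA subrK distrC.
Qed.

Lemma var_le_incr {R : realType} (a b : R) (f g h : R -> R) (k l V W : R) :
  0 <= k -> 0 <= l -> var_le a b f V -> var_le a b g W ->
  (forall x y, a < x < b -> a < y < b ->
     `|h y - h x| <= k * `|f y - f x| + l * `|g y - g x|) ->
  var_le a b h (k * V + l * W).
Proof.
move=> k0 l0 fV gW hfg n x xab xle.
apply: le_trans (lerD (ler_wpM2l k0 (fV n x xab xle)) (ler_wpM2l l0 (gW n x xab xle))).
rewrite !mulr_sumr -big_split /=; apply: ler_sum => i _.
by apply: hfg; apply: xab => //; exact: ltnW.
Qed.

Lemma var_leM {R : realType} (a b : R) (f g : R -> R) (V W M K : R) :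
  0 <= M -> 0 <= K -> var_le a b f V -> var_le a b g W ->
  (forall x, a < x < b -> `|f x| <= M) -> (forall x, a < x < b -> `|g x| <= K) ->
  var_le a b (fun x => f x * g x) (K * V + M * W).
Proof.
move=> M0 K0 fV gW fM gK; apply: (var_le_incr K0 M0 fV gW) => x y xab yab.
rewrite (_ : _ - _ = (f y - f x) * g y + f x * (g y - g x)); last by ring.
apply: le_trans (ler_normD _ _) _; rewrite !normrM mulrC.
by apply: lerD; apply: ler_wpM2r => //; [exact: gK|exact: fM].
Qed.

Lemma var_le_comp_homo {R : realType} (a b : R) (f T : R -> R) (V : R) :
  (forall x, a < x < b -> a < T x < b) ->
  (forall x y, a < x -> x <= y -> y < b -> T x <= T y) ->
  var_le a b f V -> var_le a b (f \o T) V.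
Proof.
move=> Tab Tle fV n x xab xle; apply: (fV n (T \o x)) => [i /xab/Tab//|i ilt /=].
by apply: Tle (xle _ ilt) _; [case/andP: (xab i (ltnW ilt))|case/andP: (xab i.+1 ilt)].
Qed.

Lemma eq_var_le {R : realType} (a b : R) (f g : R -> R) (V : R) :
  (forall x, a < x < b -> f x = g x) -> var_le a b f V -> var_le a b g V.
Proof.
move=> fg fV n x xab xle; rewrite (le_trans _ (fV n x xab xle))//; apply: ler_sum => i _.
by rewrite !fg ?xab// ltnW.
Qed.

Lemma nondecreasing_itv_measurable {R : realType} (a b : R) (f : R -> R) :
  (forall x y, a < x -> x <= y -> y < b -> f x <= f y) -> measurable_fun `]a, b[ f.
Proof.
move=> fnd; apply: (measurability (@RGenCInfty.G R)) => [|/= _ [_] [r] -> <-].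
  exact: RGenCInfty.measurableE.
apply: is_interval_measurable => s t/=.
rewrite !in_itv/= !andbT => -[/andP[as_ sb] fs] [/andP[at_ tb] ft] u /andP[su ut].
have au : a < u by exact: lt_le_trans su.
have ub : u < b by exact: le_lt_trans tb.
by rewrite !in_itv/= au ub andbT; split => //; rewrite (le_trans fs)// fnd.
Qed.

(* The variation function [F] of [f] makes both [F] and [F - f] nondecreasing. *)
Lemma var_le_measurable {R : realType} (a b : R) (f : R -> R) (V : R) :
  var_le a b f V -> measurable_fun `]a, b[ f.
Proof.
move=> fV.
pose S y := [set v | exists n (x : nat -> R), [/\ forall i, (i <= n)%N -> a < x i < b,
  forall i, (i < n)%N -> x i <= x i.+1, x n = y & v = \sum_(i < n) `|f (x i.+1) - f (x i)|]].
pose F y := sup (S y).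
have S0 y : a < y < b -> S y !=set0.
  by move=> yab; exists 0, 0%N, (fun=> y); split => //; rewrite big_ord0.
have Sub y : a < y < b -> has_ubound (S y).
  by move=> _; exists V => _ [n [x [xab xle _ ->]]]; exact: fV.
have key y z : a < y -> y <= z -> z < b -> F y + `|f z - f y| <= F z.
  move=> ay yz zb; have yab : a < y < b by rewrite ay (le_lt_trans yz).
  rewrite -lerBrDr; apply: ge_sup; first exact: S0.
  move=> _ [n [x [xab xle xn ->]]]; rewrite lerBrDr.
  apply: ub_le_sup; first by apply: Sub; rewrite (lt_le_trans ay).
  exists n.+1, (fun i => if (i <= n)%N then x i else z); split.
  - by move=> i _; case: leqP => [/xab//|_]; rewrite (lt_le_trans ay).
  - move=> i; rewrite ltnS => im; rewrite im; case: (ltnP i n) => [/xle//|ni].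
    by have -> : i = n by [apply/eqP; rewrite eqn_leq im]; rewrite xn.
  - by rewrite ltnn.
  - rewrite big_ord_recr /= leqnn ltnn xn; congr (_ + _); apply: eq_bigr => i _.
    by rewrite ltn_ord (ltnW (ltn_ord i)).
have mF : measurable_fun `]a, b[ F.
  apply: nondecreasing_itv_measurable => y z ay yz zb.
  by have := key y z ay yz zb; apply: le_trans; rewrite lerDl.
have mG : measurable_fun `]a, b[ (fun x => F x - f x).
  apply: nondecreasing_itv_measurable => y z ay yz zb.
  have := key y z ay yz zb; have := ler_norm (f z - f y); lra.
rewrite (_ : f = F \- (fun x => F x - f x)); last by apply/funext => x /=; ring.
exact: measurable_funB.
Qed.

(** * The reaction step *)

Lemma gronwall {R : realType} (u du : R -> R) (K tau : R) : 0 <= tau ->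
  {within `[0, tau], continuous u} ->
  (forall t : R, 0 < t < tau -> is_derive t 1 u (du t)) ->
  (forall t : R, 0 < t < tau -> du t <= K * u t) ->
  u tau <= expR (K * tau) * u 0.
Proof.
rewrite le_eqVlt => /predU1P[<-|tau0] uc ud duK.
  by rewrite mulr0 expR0 mul1r.
pose e (t : R) : R := expR (- K * t).
have de (t : R) : is_derive t 1 e (- K * e t).
  have dl : is_derive t 1 ((- K) \*: (@id R)) (- K *: 1) by exact: is_deriveZ.
  have := is_derive1_comp (is_derive_expR (- K * t)) dl.
  by rewrite scaler1 mulrC.
have cont_e : continuous e.
  by move=> t; apply: differentiable_continuous; apply/derivable1_diffP; case: (de t).
have [t tI||c cI] := @MVT _ (u * e) (fun t => u t *: (- K * e t) + e t *: du t) 0 tau tau0.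
- by move: tI; rewrite in_itv /= => /ud ?; exact: is_deriveM.
- move=> x; apply: cvgM; first exact: uc.
  exact: (continuous_subspaceT cont_e).
rewrite in_itv /= in cI => mvt.
have {}mvt : u tau * e tau - u 0 * e 0 = (u c * (- K * e c) + e c * du c) * (tau - 0) by [].
have : u tau * e tau <= u 0 * e 0.
  rewrite -subr_le0 mvt subr0.
  have -> : u c * (- K * e c) + e c * du c = e c * (du c - K * u c) by ring.
  rewrite -mulrA pmulr_rle0 ?expR_gt0// pmulr_lle0// subr_le0.
  exact: duK.
rewrite /e mulr0 expR0 mulr1 mulNr expRN => H.
rewrite mulrC -ler_pdivrMr ?expR_gt0//.
Qed.

Definition box_lip {R : realType} (S K : R) (f : R -> R -> R) :=
  forall s q s' q' : R, 0 <= s <= S -> 0 <= q <= 1 -> 0 <= s' <= S -> 0 <= q' <= 1 ->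
    `|f s q| <= K /\ `|f s q - f s' q'| <= K * (`|s - s'| + `|q - q'|).

Lemma box_lipW {R : realType} (S K L : R) f : K <= L -> box_lip S K f -> box_lip S L f.
Proof.
move=> KL fK s q s' q' sS q1 s'S q'1; have [fb fl] := fK _ _ _ _ sS q1 s'S q'1.
split; first exact: le_trans KL.
by apply: le_trans fl _; apply: ler_wpM2r.
Qed.

Lemma box_lipD {R : realType} (S K L : R) f g :
  box_lip S K f -> box_lip S L g -> box_lip S (K + L) (fun s q => f s q + g s q).
Proof.
move=> fK gL s q s' q' sS q1 s'S q'1; have [fb fl] := fK _ _ _ _ sS q1 s'S q'1.
have [gb gl] := gL _ _ _ _ sS q1 s'S q'1.
split; first by apply: le_trans (ler_normD _ _) _; exact: lerD.
rewrite mulrDl opprD addrACA.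
by apply: le_trans (ler_normD _ _) _; exact: lerD.
Qed.

Lemma box_lipN {R : realType} (S K : R) f :
  box_lip S K f -> box_lip S K (fun s q => - f s q).
Proof.
move=> fK s q s' q' sS q1 s'S q'1; have [fb fl] := fK _ _ _ _ sS q1 s'S q'1.
by rewrite normrN -opprD normrN.
Qed.

Lemma box_lipM {R : realType} (S K L : R) f g : 0 <= K -> 0 <= L ->
  box_lip S K f -> box_lip S L g ->
  box_lip S (K * L + K * L) (fun s q => f s q * g s q).
Proof.
move=> K0 L0 fK gL s q s' q' sS q1 s'S q'1.
have [fb fl] := fK _ _ _ _ sS q1 s'S q'1; have [gb gl] := gL _ _ _ _ sS q1 s'S q'1.
have [gb' _] := gL _ _ _ _ s'S q'1 s'S q'1.
split.
  rewrite normrM (le_trans (ler_pM _ _ fb gb))// lerDl mulr_ge0//.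
rewrite (_ : _ - _ = f s q * (g s q - g s' q') + (f s q - f s' q') * g s' q'); last by ring.
apply: le_trans (ler_normD _ _) _; rewrite !normrM.
rewrite mulrDl; apply: lerD; first by rewrite -mulrA ler_pM.
by rewrite -[K * L * _]mulrA [L * _]mulrC mulrA ler_pM.
Qed.

Lemma box_lip_fst {R : realType} (S : R) : 0 <= S -> box_lip S (S + 1) (fun s q => s).
Proof.
move=> S0 s q s' q' /andP[s0 sS] _ _ _; split; first by rewrite ger0_norm//; lra.
have := normr_ge0 (s - s'); have := normr_ge0 (q - q'); nra.
Qed.

Lemma box_lip_snd {R : realType} (S : R) : box_lip S 1 (fun s q => q).
Proof.
move=> s q s' q' _ /andP[q0 q1] _ _; split; first by rewrite ger0_norm.
by rewrite mul1r lerDr.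
Qed.

Lemma box_lip_sndC {R : realType} (S : R) : box_lip S 1 (fun s q => 1 - q).
Proof.
move=> s q s' q' _ /andP[q0 q1] _ _; split; first by rewrite ger0_norm; lra.
by rewrite mul1r (_ : 1 - q - (1 - q') = - (q - q')) ?normrN ?lerDr//; ring.
Qed.

Lemma box_lip_tildeF {R : realType} (S : R) F : 0 <= S ->
  bounded_nonneg2 F -> lipschitz_nonneg2 F ->
  exists2 K, 0 <= K & box_lip S K (tildeF F).
Proof.
move=> S0 [M FM] [L FL].
have M0 : 0 <= M by apply: le_trans (FM 0 0 _ _).
pose L' : R := `|L|; have L0 : 0 <= L' by exact: normr_ge0.
exists (M + L' * (2 + 2 * S)); first by rewrite addr_ge0// mulr_ge0//; lra.
move=> s q s' q' /andP[s0 sS] /andP[q0 q1] /andP[s'0 s'S] /andP[q'0 q'1].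
have p0 (u v : R) : 0 <= u -> 0 <= v -> v <= 1 -> 0 <= v * u /\ 0 <= (1 - v) * u.
  by move=> *; split; apply: mulr_ge0; lra.
have [? ?] := p0 _ _ s0 q0 q1; have [? ?] := p0 _ _ s'0 q'0 q'1.
split.
  by apply: le_trans (FM _ _ _ _) _ => //; rewrite lerDl mulr_ge0//; lra.
apply: le_trans (FL _ _ _ _ _ _ _ _) _ => //.
have ns := normr_ge0 (s - s'); have nq := normr_ge0 (q - q').
have d1 : `|q * s - q' * s'| <= `|s - s'| + S * `|q - q'|.
  rewrite (_ : _ - _ = q * (s - s') + (q - q') * s'); last by ring.
  apply: le_trans (ler_normD _ _) _; rewrite !normrM [`|s'|]ger0_norm// [`|q|]ger0_norm//; nra.
have d2 : `|(1 - q) * s - (1 - q') * s'| <= `|s - s'| + S * `|q - q'|.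
  rewrite (_ : _ - _ = (1 - q) * (s - s') + (- (q - q')) * s'); last by ring.
  apply: le_trans (ler_normD _ _) _; rewrite !normrM normrN [`|s'|]ger0_norm//.
  rewrite [`|1 - q|]ger0_norm; nra.
apply: (@le_trans _ _ (L' * (`|q * s - q' * s'| + `|(1 - q) * s - (1 - q') * s'|))).
  by apply: ler_wpM2r; [exact: addr_ge0|exact: ler_norm].
rewrite [X in _ <= X]mulrDl -[X in X <= _]add0r; apply: lerD; first by rewrite mulr_ge0// addr_ge0.
rewrite -mulrA; apply: ler_wpM2l => //.
nra.
Qed.

Lemma box_lip_reaction {R : realType} (S : R) (F1 F2 G1 G2 : R -> R -> R) : 0 <= S ->
  bounded_nonneg2 F1 -> bounded_nonneg2 F2 -> bounded_nonneg2 G1 -> bounded_nonneg2 G2 ->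
  lipschitz_nonneg2 F1 -> lipschitz_nonneg2 F2 ->
  lipschitz_nonneg2 G1 -> lipschitz_nonneg2 G2 ->
  exists2 K, 0 <= K & box_lip S K (SigmaF F1 F2 G1 G2) /\ box_lip S K (RF F1 F2 G1 G2).
Proof.
move=> S0 bF1 bF2 bG1 bG2 lF1 lF2 lG1 lG2.
have [K1 K10 F1K] := box_lip_tildeF S0 bF1 lF1.
have [K2 K20 F2K] := box_lip_tildeF S0 bF2 lF2.
have [K3 K30 G1K] := box_lip_tildeF S0 bG1 lG1.
have [K4 K40 G2K] := box_lip_tildeF S0 bG2 lG2.
have nM (x y : R) : 0 <= x -> 0 <= y -> 0 <= x * y + x * y.
  by move=> *; rewrite addr_ge0// mulr_ge0.
have fstS := box_lip_fst S0; have sndS := @box_lip_snd R S; have sndC := @box_lip_sndC R S.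
have S1 : 0 <= S + 1 by lra.
have p14 := addr_ge0 K10 K40; have p32 := addr_ge0 K30 K20; have p12 := addr_ge0 K10 K20.
have q0 := nM _ _ (@ler01 R) (@ler01 R).
have lA := box_lipD (box_lipM ler01 p14 sndS (box_lipD F1K G2K))
  (box_lipM ler01 p32 sndC (box_lipD G1K F2K)).
have a0 := addr_ge0 (nM _ _ ler01 p14) (nM _ _ ler01 p32).
have hA := box_lipM S1 a0 fstS lA; have A0 := nM _ _ S1 a0.
have l1 := box_lipM q0 p12 (box_lipM ler01 ler01 sndS sndC) (box_lipD F1K (box_lipN F2K)).
have l2 := box_lipM q0 K30 (box_lipM ler01 ler01 sndC sndC) G1K.
have l3 := box_lipM q0 K40 (box_lipM ler01 ler01 sndS sndS) G2K.
have hB := box_lipD (box_lipD l1 l2) (box_lipN l3).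
have B0 := addr_ge0 (addr_ge0 (nM _ _ q0 p12) (nM _ _ q0 K30)) (nM _ _ q0 K40).
eexists; first exact: (addr_ge0 A0 B0).
split; first by apply: box_lipW hA; rewrite lerDl.
by apply: box_lipW hB; rewrite lerDr.
Qed.

Lemma reaction_step_bound {R : realType} (F1 F2 G1 G2 : R -> R -> R) M tau s0 r0 s1 r1 :
  (forall x y, 0 <= x -> 0 <= y ->
    [/\ `|F1 x y| <= M, `|F2 x y| <= M, `|G1 x y| <= M & `|G2 x y| <= M]) ->
  0 <= tau ->
  reaction_step (SigmaF F1 F2 G1 G2) (RF F1 F2 G1 G2) tau s0 r0 s1 r1 ->
  [/\ 0 <= s1, 0 <= r1 <= 1 & s1 <= expR (2 * M * tau) * s0].
Proof.
move=> FM tau0 [s [q [<- [_ [<- [<- [sc [qc [sd sdom]]]]]]]]].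
have [s1' q1'] : 0 <= s tau /\ 0 <= q tau <= 1 by apply: sdom; rewrite tau0 lexx.
split => //.
apply: (gronwall tau0 sc (du := fun t => SigmaF F1 F2 G1 G2 (s t) (q t))).
  by move=> t /sd[].
move=> t tI; have [st /andP[qt0 qt1]] : 0 <= s t /\ 0 <= q t <= 1.
  by apply: sdom; case/andP: tI => /ltW-> /ltW->.
rewrite mulrC /SigmaF; apply: ler_wpM2l => //.
have [] := FM (q t * s t) ((1 - q t) * s t).
- by rewrite mulr_ge0.
- by rewrite mulr_ge0//; lra.
rewrite -/(tildeF F1 _ _) -/(tildeF F2 _ _) -/(tildeF G1 _ _) -/(tildeF G2 _ _).
rewrite !ler_norml => /andP[_ H1] /andP[_ H2] /andP[_ H3] /andP[_ H4].
nra.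
Qed.

Lemma reaction_step_lip {R : realType} (Sig Rr : R -> R -> R) (S K tau : R)
    (s0 r0 s1 r1 s0' r0' s1' r1' : R) :
  0 <= K -> box_lip S K Sig -> box_lip S K Rr -> 0 < tau < 1 ->
  (forall t s1 r1 : R, 0 <= t <= tau -> reaction_step Sig Rr t s0 r0 s1 r1 -> s1 <= S) ->
  (forall t s1 r1 : R, 0 <= t <= tau -> reaction_step Sig Rr t s0' r0' s1 r1 -> s1 <= S) ->
  reaction_step Sig Rr tau s0 r0 s1 r1 -> reaction_step Sig Rr tau s0' r0' s1' r1' ->
  let d : R := `|s0 - s0'| + `|r0 - r0'| in let C : R := 2 * K * expR (4 * K) in
  `|s1 - s1'| <= `|s0 - s0'| + C * tau * d /\ `|r1 - r1'| <= `|r0 - r0'| + C * tau * d.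
Proof.
move=> K0 SigK RrK /andP[tau0 tau1] bS bS'.
move=> [s [q [? [? [? [? [sc [qc [sd sdom]]]]]]]]].
move=> [s' [q' [? [? [? [? [sc' [qc' [sd' sdom']]]]]]]]] d C; subst.
have sub (t : R) (f : R -> R) : t <= tau -> {within `[0, tau], continuous f} ->
    {within `[0, t], continuous f}.
  by move=> tt; apply: continuous_subspaceW => u; rewrite /= !in_itv /= => /andP[-> /le_trans->].
have sS (t : R) : 0 <= t <= tau -> 0 <= s t <= S /\ 0 <= q t <= 1.
  move=> /[dup] tI /andP[t0 tt]; have [-> ->] := sdom t tI; split => //=.
  apply: (bS t (s t) (q t) tI); exists s, q; do 4 split => //.
  split; first exact: sub sc.
  split; first exact: sub qc.
  split; first by move=> u /andP[u0 ut]; apply: sd; rewrite u0 (lt_le_trans ut).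
  by move=> u /andP[u0 ut]; apply: sdom; rewrite u0 (le_trans ut).
have sS' (t : R) : 0 <= t <= tau -> 0 <= s' t <= S /\ 0 <= q' t <= 1.
  move=> /[dup] tI /andP[t0 tt]; have [-> ->] := sdom' t tI; split => //=.
  apply: (bS' t (s' t) (q' t) tI); exists s', q'; do 4 split => //.
  split; first exact: sub sc'.
  split; first exact: sub qc'.
  split; first by move=> u /andP[u0 ut]; apply: sd'; rewrite u0 (lt_le_trans ut).
  by move=> u /andP[u0 ut]; apply: sdom'; rewrite u0 (le_trans ut).
pose e (t : R) := s t - s' t; pose g (t : R) := q t - q' t.
pose de (t : R) := Sig (s t) (q t) - Sig (s' t) (q' t).
pose dg (t : R) := Rr (s t) (q t) - Rr (s' t) (q' t).
have dP (t : R) : 0 <= t <= tau ->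
    `|de t| <= K * (`|e t| + `|g t|) /\ `|dg t| <= K * (`|e t| + `|g t|).
  move=> tI; have [? ?] := sS t tI; have [? ?] := sS' t tI.
  by split; [case: (SigK (s t) (q t) (s' t) (q' t))|case: (RrK (s t) (q t) (s' t) (q' t))].
have ed (t : R) : 0 < t < tau -> is_derive t 1 e (de t).
  by move=> tI; have [? _] := sd t tI; have [? _] := sd' t tI; exact: is_deriveB.
have gd (t : R) : 0 < t < tau -> is_derive t 1 g (dg t).
  by move=> tI; have [_ ?] := sd t tI; have [_ ?] := sd' t tI; exact: is_deriveB.
have ec : {within `[0, tau], continuous e}.
  by move=> x; apply: cvgB; [exact: sc|exact: sc'].
have gc : {within `[0, tau], continuous g}.
  by move=> x; apply: cvgB; [exact: qc|exact: qc'].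
pose u (t : R) := e t * e t + g t * g t.
have ule (t : R) : 0 <= t <= tau -> `|e t| + `|g t| <= 2 * expR (4 * K) * d.
  move=> /andP[t0 tt].
  have ug : u t <= expR (4 * K * t) * u 0.
    apply: (gronwall t0 (du := fun t => (e t *: de t + e t *: de t) + (g t *: dg t + g t *: dg t))).
    - apply: sub => // x; apply: cvgD; apply: cvgM; by [exact: ec|exact: gc].
    - move=> x /andP[x0 xt]; have xI : 0 < x < tau by rewrite x0 (lt_le_trans xt).
      have := ed x xI; have := gd x xI => ? ?.
      by apply: is_deriveD; exact: is_deriveM.
    - move=> x /andP[x0 xt].
      have [] := dP x; first by rewrite (ltW x0)/= (le_trans (ltW xt)).
      rewrite /u /GRing.scale /= => dex dgx.
      have e1 : e x * de x <= `|e x| * (K * (`|e x| + `|g x|)).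
        by apply: le_trans (ler_norm _) _; rewrite normrM ler_wpM2l.
      have g1 : g x * dg x <= `|g x| * (K * (`|e x| + `|g x|)).
        by apply: le_trans (ler_norm _) _; rewrite normrM ler_wpM2l.
      have e0 : `|e x| * `|e x| = e x * e x by rewrite -expr2 real_normK ?num_real.
      have g0 : `|g x| * `|g x| = g x * g x by rewrite -expr2 real_normK ?num_real.
      rewrite -e0 -g0.
      apply: le_trans (lerD (lerD e1 e1) (lerD g1 g1)) _.
      have := sqr_ge0 (`|e x| - `|g x|); nra.
  have E1 : 1 <= expR (4 * K) by rewrite -expR0 ler_expR mulr_ge0.
  have Et : expR (4 * K * t) <= expR (4 * K).
    by rewrite ler_expR ler_piMr ?mulr_ge0//; lra.
  have u0 : u 0 <= d ^+ 2.
    have e0 : `|e 0| * `|e 0| = e 0 * e 0 by rewrite -expr2 real_normK ?num_real.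
    have g0 : `|g 0| * `|g 0| = g 0 * g 0 by rewrite -expr2 real_normK ?num_real.
    have := mulr_ge0 (normr_ge0 (e 0)) (normr_ge0 (g 0)).
    rewrite /u /d -/(e 0) -/(g 0); nra.
  have u00 : 0 <= u 0 by rewrite /u addr_ge0// -expr2 sqr_ge0.
  have d0 : 0 <= d by rewrite addr_ge0.
  rewrite -(@ler_pXn2r _ 2%N) ?nnegrE ?addr_ge0 ?mulr_ge0 ?expR_ge0//.
  have e0 : `|e t| * `|e t| = e t * e t by rewrite -expr2 real_normK ?num_real.
  have g0 : `|g t| * `|g t| = g t * g t by rewrite -expr2 real_normK ?num_real.
  have h1 : (`|e t| + `|g t|) ^+ 2 <= 2 * u t.
    have := sqr_ge0 (`|e t| - `|g t|); rewrite /u; nra.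
  have h2 : expR (4 * K * t) * u 0 <= expR (4 * K) * d ^+ 2 by rewrite ler_pM ?expR_ge0.
  have h3 : expR (4 * K) * d ^+ 2 <= expR (4 * K) ^+ 2 * d ^+ 2.
    by rewrite ler_wpM2r ?sqr_ge0// expr2 ler_peMr// expR_ge0.
  rewrite !exprMn; have := sqr_ge0 (expR (4 * K) * d); rewrite exprMn; lra.
have final (f df : R -> R) : (forall t : R, 0 < t < tau -> is_derive t 1 f (df t)) ->
    {within `[0, tau], continuous f} ->
    (forall t : R, 0 <= t <= tau -> `|df t| <= K * (`|e t| + `|g t|)) ->
    `|f tau| <= `|f 0| + C * tau * d.
  move=> fd fc dfK; have fd' x : x \in `]0, tau[ -> is_derive x 1 f (df x) by rewrite in_itv => /fd.
  have [c cI mvt] := MVT tau0 fd' fc.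
  rewrite (_ : f tau = f 0 + df c * tau); last by rewrite subr0 in mvt; rewrite -mvt; ring.
  apply: le_trans (ler_normD _ _) _; rewrite lerD2l normrM (gtr0_norm tau0).
  rewrite mulrAC; apply: ler_wpM2r; first exact: ltW.
  have cI' : 0 <= c <= tau by move: cI; rewrite in_itv /= => /andP[/ltW-> /ltW->].
  apply: le_trans (dfK c cI') _; apply: le_trans (ler_wpM2l K0 (ule c cI')) _.
  by rewrite /C (_ : K * _ = 2 * K * expR (4 * K) * d) //; ring.
by split; [apply: (final e de)|apply: (final g dg)] => // t /dP[].
Qed.

(** * The internal energy density *)

Definition dchi {R : realType} (chi : R -> R) (s : R) : R :=
  if 0 < s then derive1 chi s else 0.

Section InternalEnergy.
Context {R : realType} (chi : R -> R).
Hypothesis chi_cont : {within `[0, +oo[, continuous chi}.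
Hypothesis chi_C2 : forall x, 0 < x -> derivable chi x 1 /\ derivable (derive1 chi) x 1 /\
  {for x, continuous (derive1n 2 chi)}.
Hypothesis chi_convex : forall x, 0 < x -> 0 < derive1n 2 chi x.
Hypothesis chi_lim0 : derive1 chi h @[h --> 0^'+] --> 0.

Let derive_chi_cont (x : R) : 0 < x -> {for x, continuous (derive1 chi)}.
Proof.
by move=> /chi_C2[_ [/derivable1_diffP/differentiable_continuous + _]]; exact.
Qed.

Let derive_chi_lt (x y : R) : 0 < x -> x < y -> derive1 chi x < derive1 chi y.
Proof.
move=> x0 xy.
have fd z : z \in `]x, y[ -> is_derive z 1 (derive1 chi) (derive1n 2 chi z).
  rewrite in_itv /= => /andP[xz _]; have [_ [dz _]] := chi_C2 (lt_trans x0 xz).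
  exact: (DeriveDef dz (esym (derive1E _ _))).
have fc : {within `[x, y], continuous (derive1 chi)}.
  apply: continuous_in_subspaceT => z; rewrite inE /= in_itv /= => /andP[xz _].
  exact: derive_chi_cont (lt_le_trans x0 xz).
have [c cI mvt] := MVT xy fd fc.
rewrite -subr_gt0 mvt mulr_gt0 ?subr_gt0//; apply: chi_convex.
by move: cI; rewrite in_itv /= => /andP[xc _]; exact: lt_trans xc.
Qed.

Let derive_chi_ge0 (z : R) : 0 < z -> 0 <= derive1 chi z.
Proof.
move=> z0; rewrite leNgt; apply/negP => dz.
have nz : 0 < - derive1 chi z by rewrite oppr_gt0.
have [u] : exists u : R, [/\ `|derive1 chi u| < - derive1 chi z, 0 < u & u < z].
  apply: (@filter_ex _ (0 : R)^'+); near=> u; split; near: u.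
  - exact: (cvgr0_norm_lt _ chi_lim0).
  - exact: nbhs_right_gt.
  - exact: nbhs_right_lt.
move=> [du u0 uz]; have := derive_chi_lt u0 uz.
by move: du; rewrite ltr_norml opprK => /andP[/lt_trans h _] /h; rewrite ltxx.
Unshelve. all: by end_near. Qed.

Lemma dchi0 : dchi chi 0 = 0. Proof. by rewrite /dchi ltxx. Qed.

Lemma dchi_lt (x y : R) : 0 <= x -> x < y -> dchi chi x < dchi chi y.
Proof.
rewrite /dchi le_eqVlt => /predU1P[<- y0|x0 xy]; last first.
  by rewrite x0 (lt_trans x0 xy) derive_chi_lt.
rewrite ltxx y0 (@le_lt_trans _ _ (derive1 chi (y / 2)))//.
  by rewrite derive_chi_ge0// divr_gt0.
by apply: derive_chi_lt; lra.
Qed.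

Lemma dchi_le (x y : R) : 0 <= x -> x <= y -> dchi chi x <= dchi chi y.
Proof.
by move=> x0; rewrite le_eqVlt => /predU1P[->//|xy]; rewrite ltW// dchi_lt.
Qed.

Lemma dchi_ge0 (x : R) : 0 <= dchi chi x.
Proof. by rewrite /dchi; case: ifPn => // /derive_chi_ge0. Qed.

Lemma chi_subgradient (s t : R) : 0 <= s -> s <= t ->
  dchi chi s * (t - s) <= chi t - chi s <= dchi chi t * (t - s).
Proof.
move=> s0; rewrite le_eqVlt => /predU1P[->|st]; first by rewrite !subrr !mulr0 lexx.
have fd z : z \in `]s, t[ -> is_derive z 1 chi (derive1 chi z).
  rewrite in_itv /= => /andP[sz _]; have [dz _] := chi_C2 (le_lt_trans s0 sz).
  exact: (DeriveDef dz (esym (derive1E _ _))).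
have fc : {within `[s, t], continuous chi}.
  apply: continuous_subspaceW chi_cont => z; rewrite /= !in_itv /= andbT => /andP[+ _].
  exact: le_trans.
have [c cI ->] := MVT st fd fc.
move: cI; rewrite in_itv /= => /andP[sc ct]; have c0 := le_lt_trans s0 sc.
have -> : derive1 chi c = dchi chi c by rewrite /dchi c0.
by rewrite !ler_pM2r ?subr_gt0// !dchi_le// ltW.
Qed.

Lemma dchi_approx_left (s e : R) : 0 < s -> 0 < e ->
  exists s1, [/\ 0 < s1, s1 < s & dchi chi s - e < dchi chi s1].
Proof.
move=> s0 e0; have := derive_chi_cont s0 => /cvgrPdist_lt/(_ e e0) H0.
have H : \forall u \near s^'-, `|derive1 chi s - derive1 chi u| < e by exact: (cvg_within _ H0).
have [u [du u0 us]] : exists u : R, [/\ `|derive1 chi s - derive1 chi u| < e, 0 < u & u < s].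
  apply: (@filter_ex _ (s : R)^'-); near=> u; split; near: u => //.
  - exact: nbhs_left_gt.
  - exact: nbhs_left_lt.
exists u; split => //; rewrite /dchi s0 u0.
by move: du; rewrite ltr_norml => /andP[_]; lra.
Unshelve. all: by end_near. Qed.

Lemma dchi_approx_right (s e : R) : 0 <= s -> 0 < e ->
  exists2 s2, s < s2 & dchi chi s2 < dchi chi s + e.
Proof.
move=> s0 e0.
have H : \forall u \near s^'+, `|dchi chi s - derive1 chi u| < e.
  move: s0; rewrite le_eqVlt => /predU1P[<-|s0].
    rewrite dchi0; near=> u; rewrite sub0r normrN; near: u.
    exact: (cvgr0_norm_lt _ chi_lim0).
  rewrite /dchi s0.
  by have := derive_chi_cont s0 => /cvgrPdist_lt/(_ e e0) H; exact: (cvg_within _ H).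
have [u [du us]] : exists u : R, `|dchi chi s - derive1 chi u| < e /\ s < u.
  apply: (@filter_ex _ (s : R)^'+); near=> u; split; near: u => //.
  exact: nbhs_right_gt.
exists u => //; rewrite {1}/dchi (le_lt_trans s0 us).
by move: du; rewrite ltr_norml => /andP[+ _]; lra.
Unshelve. all: by end_near. Qed.

Lemma chi_ge (s : R) : 0 <= s -> chi 0 <= chi s.
Proof.
move=> s0; have /andP[+ _] := chi_subgradient (lexx 0) s0.
by rewrite dchi0 mul0r subr_ge0.
Qed.

Lemma chi_le (s t : R) : 0 <= s -> s <= t -> chi s <= chi t.
Proof.
move=> s0 st; have /andP[+ _] := chi_subgradient s0 st.
have := mulr_ge0 (dchi_ge0 s) (_ : 0 <= t - s); rewrite subr_ge0 => /(_ st); lra.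
Qed.

Lemma chi_measurable (d : measure_display) (T : measurableType d) (D : set T) (f : T -> R) :
  measurable D -> measurable_fun D f -> (forall x, D x -> 0 <= f x) ->
  measurable_fun D (chi \o f).
Proof.
move=> mD mf f0; have mchi : measurable_fun (`[0, +oo[%classic : set R) chi.
  by apply: subspace_continuous_measurable_fun => //; exact: measurable_itv.
apply: (measurable_comp _ _ mchi mf); first exact: measurable_itv.
by move=> _ [x /f0 fx <-]; rewrite /= in_itv /= andbT.
Qed.

End InternalEnergy.

(** * Image measures of densities *)

Section DensityImage.
Context (d d' : measure_display) (X : measurableType d) (Y : measurableType d')
  (R : realType) (mu : {measure set X -> \bar R}).
Variables (D : set X) (f : X -> R) (g : X -> Y).
Hypothesis mD : measurable D.
Hypothesis mf : measurable_fun D f.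
Hypothesis f0 : forall x, D x -> 0 <= f x.
Hypothesis mg : measurable_fun D g.

Let mf' (E : set X) : E `<=` D -> measurable E -> measurable_fun E (EFin \o f).
Proof. by move=> ED mE; apply/measurable_EFinP; exact: measurable_funS mf. Qed.

Import HBNNSimple.
Local Open Scope ereal_scope.

Lemma density_image_measure : exists nu : {measure set Y -> \bar R},
  forall A, nu A = \int[mu]_(x in D `&` g @^-1` A) (f x)%:E.
Proof.
pose F (A : set Y) := \int[mu]_(x in D `&` g @^-1` A) (f x)%:E.
have F0 : F set0 = 0 by rewrite /F preimage_set0 setI0 integral_set0.
have Fge0 A : 0 <= F A by apply: integral_ge0 => x [/f0 ? _]; rewrite lee_fin.
have Fsigma : semi_sigma_additive F.
  move=> /= A mA tA mUA; rewrite /F preimage_bigcup setI_bigcupr.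
  have mgA k : measurable (D `&` g @^-1` A k) by exact: mg.
  rewrite ge0_integral_bigcup//.
  - apply/cvg_ex => /=; eexists; apply: is_cvg_ereal_nneg_natsum => k _.
    exact: Fge0.
  - apply: mf'; last exact: bigcup_measurable.
    by move=> x [k _ []].
  - by move=> x [k _ [/f0 ? _]]; rewrite lee_fin.
  - apply/trivIsetP => i j _ _ ij; move/trivIsetP: tA => /(_ i j I I ij) AB.
    by rewrite setIACA setIid -preimage_setI AB preimage_set0 setI0.
pose mix := isMeasure.Build _ _ _ F F0 Fge0 Fsigma.
pose nu : {measure set Y -> \bar R} := HB.pack F mix.
by exists nu.
Qed.

Lemma ge0_integral_density_image (nu : {measure set Y -> \bar R}) (phi : Y -> \bar R) :
  (forall A, measurable A -> nu A = \int[mu]_(x in D `&` g @^-1` A) (f x)%:E) ->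
  measurable_fun setT phi -> (forall y, 0 <= phi y) ->
  \int[nu]_y phi y = \int[mu]_(x in D) (phi (g x) * (f x)%:E).
Proof.
move=> nuE mphi phi0.
have mgc (d2 : measure_display) (Z : measurableType d2) (h : Y -> Z) :
    measurable_fun setT h -> measurable_fun D (h \o g).
  by move=> mh; exact: measurableT_comp mh mg.
have indicE (A : set Y) : measurable A ->
    \int[nu]_y (\1_A y)%:E = \int[mu]_(x in D) ((\1_A (g x))%:E * (f x)%:E).
  move=> mA; rewrite integral_indic// setIT nuE// integral_mkcondr.
  apply: eq_integral => x _; rewrite epatch_indic /= muleC; congr (_ * _).
have sfunE (h : {nnsfun Y >-> R}) :
    \int[nu]_y (h y)%:E = \int[mu]_(x in D) ((h (g x))%:E * (f x)%:E).
  under [LHS]eq_integral do rewrite fimfunE -fsumEFin//.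
  rewrite [LHS]ge0_integral_fsum//; last 2 first.
  - by move=> r; exact/measurable_EFinP/measurableT_comp.
  - by move=> n x _; rewrite EFinM nnfun_muleindic_ge0.
  have mterm r : measurable_fun D (fun x => (\1_(h @^-1` [set r]) (g x))%:E * (f x)%:E).
    apply: emeasurable_funM; last exact/measurable_EFinP.
    by apply/measurable_EFinP; apply: mgc; exact: measurable_indic.
  transitivity (\sum_(r \in range h)
      \int[mu]_(x in D) ((r * \1_(h @^-1` [set r]) (g x))%:E * (f x)%:E)).
    apply: eq_fsbigr => r /set_mem[y _ <-]; rewrite integralZl_indic_nnsfun// indicE//.
    rewrite -ge0_integralZl//.
    - by apply: eq_integral => x _; rewrite EFinM muleA.
    - by move=> x /f0 fx; rewrite mule_ge0// lee_fin.
    - by rewrite lee_fin.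
  have mt (k : R) : measurable_fun D (fun x => (k * \1_(h @^-1` [set k]) (g x))%:E * (f x)%:E).
    under eq_fun do rewrite EFinM -muleA.
    by apply: emeasurable_funM => //; exact: measurable_cst.
  have t0 (k : R) x : D x -> 0 <= (k * \1_(h @^-1` [set k]) (g x))%:E * (f x)%:E.
    move=> /f0 fx; rewrite mule_ge0 ?lee_fin// -lee_fin EFinM.
    exact: nnfun_muleindic_ge0.
  rewrite -(ge0_integral_fsum mu mD mt t0)//.
  apply: eq_integral => x _; rewrite -ge0_mule_fsuml; last first.
    by move=> r; rewrite EFinM nnfun_muleindic_ge0.
  by rewrite [in RHS]fimfunE -fsumEFin.
pose h_ := nnsfun_approx measurableT mphi.
have nd_h (y : Y) : {homo (fun n => (h_ n y)%:E) : n m / (n <= m)%N >-> n <= m}.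
  by move=> n m nm; rewrite lee_fin; exact/lefP/nd_nnsfun_approx.
transitivity (limn (fun n => \int[nu]_y (h_ n y)%:E)).
  rewrite -monotone_convergence//=.
  - apply: eq_integral => y _; apply/esym/cvg_lim => //=.
    exact: cvg_nnsfun_approx.
  - by move=> n; exact/measurable_EFinP.
  - by move=> n x _; rewrite lee_fin.
under eq_fun do rewrite sfunE.
rewrite -monotone_convergence//=.
- apply: eq_integral => x /set_mem/f0 fx; apply/cvg_lim => //=.
  apply: cvgeZr => //; exact: cvg_nnsfun_approx.
- move=> n; apply: emeasurable_funM; last exact/measurable_EFinP.
  by apply/measurable_EFinP; apply: mgc.
- by move=> n x /f0 fx; rewrite mule_ge0 ?lee_fin.
- move=> x /f0 fx n m nm; rewrite lee_wpmul2r ?lee_fin//.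
  exact/lefP/nd_nnsfun_approx.
Qed.

End DensityImage.

Lemma ge0_integral_shift {R : realType} (t : R) (f : R -> \bar R) :
  measurable_fun setT f -> (forall x, 0 <= f x)%E ->
  (\int[@lebesgue_measure R]_x f (x + t)%R = \int[@lebesgue_measure R]_x f x)%E.
Proof.
move=> mf f0; pose phi : measurableTypeR R -> measurableTypeR R := fun x => (x : R) + t.
have mphi : measurable_fun setT phi.
  by apply: measurable_funD => //; exact: measurable_cst.
transitivity (\int[@lebesgue_measure R]_(x in phi @^-1` setT) (f \o phi) x)%E.
  by rewrite preimage_setT.
rewrite -ge0_integral_pushforward//; apply: eq_measure_integral => A mA _.
apply: esym; apply: lebesgue_measure_unique mA => _ [[x y]] _ <-.
have E : phi @^-1` `]x, y] = `]x - t, y - t]%classic.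
  by apply/seteqP; split => z /=; rewrite /phi !in_itv /= ltrBlDr lerBrDr.
transitivity (@lebesgue_measure R (phi @^-1` `]x, y])); last by [].
rewrite E.
rewrite !lebesgue_measure_itv /= !lte_fin ltrD2r.
by case: ifP => // _; rewrite -!EFinB; congr (_%:E); ring.
Qed.

(** * Quadratic transport cost of a monotone map *)

Section MonotoneMap.
Context {R : realType}.
Local Notation mu := (@lebesgue_measure R).
Variables (a b : R) (T : R -> R).
Hypothesis ab : a < b.
Hypothesis Tnd : forall x y, a < x -> x <= y -> y < b -> T x <= T y.
Hypothesis Tab : forall x, a < x < b -> a < T x < b.

Local Notation Om := (`]a, b[%classic : set R).

Let mT : measurable_fun Om T. Proof. exact: nondecreasing_itv_measurable. Qed.

(* The primitive of a monotone map is convex, hence has [T] as a subgradient. *)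
Lemma monotone_map_primitive : exists Th : R -> R,
  (forall x, a < x < b -> 0 <= Th x <= (b - a) ^+ 2) /\
  (forall x z, a < x -> x <= z -> z < b ->
     (T x - a) * (z - x) <= Th z - Th x <= (T z - a) * (z - x)).
Proof.
pose I (x : R) := (\int[mu]_(u in `]a, x]) (T u - a)%:E)%E.
have sub (x z : R) : a <= x -> z < b -> `]x, z]%classic `<=` Om.
  move=> ax zb u /=; rewrite !in_itv /= => /andP[xu uz].
  by rewrite (le_lt_trans ax xu) (le_lt_trans uz zb).
have mI (x z : R) : a <= x -> z < b -> measurable_fun `]x, z] (fun u => (T u - a)%:E).
  move=> ax zb; apply/measurable_EFinP; apply: measurable_funB => //.
  by apply: measurable_funS mT => //; exact: sub.
have incr (x z : R) : a <= x -> x <= z -> z < b ->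
    (\int[mu]_(u in `]x, z]) (T u - a)%:E <= ((T z - a) * (z - x))%:E)%E.
  move=> ax xz zb; rewrite EFinM.
  have -> : ((z - x)%:E = mu `]x, z])%E.
    rewrite lebesgue_measure_itv /= lte_fin; case: ltP => // zx.
    by have -> : x = z by [apply/eqP; rewrite eq_le xz zx]; rewrite subrr.
  rewrite -integral_cst//; apply: ge0_le_integral => //.
  - by move=> u /(sub _ _ ax zb); rewrite /= in_itv /= => /Tab/andP[/ltW ? _]; rewrite lee_fin subr_ge0.
  - exact: mI.
  - move=> u uI; have := sub _ _ ax zb u uI; move: uI; rewrite /= !in_itv /=.
    by move=> /andP[_ uz] /andP[au _]; rewrite lee_fin lerB// Tnd.
have decr (x z : R) : a < x -> x <= z -> z < b ->
    (((T x - a) * (z - x))%:E <= \int[mu]_(u in `]x, z]) (T u - a)%:E)%E.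
  move=> ax xz zb; rewrite EFinM.
  have -> : ((z - x)%:E = mu `]x, z])%E.
    rewrite lebesgue_measure_itv /= lte_fin; case: ltP => // zx.
    by have -> : x = z by [apply/eqP; rewrite eq_le xz zx]; rewrite subrr.
  have xI : a < x < b by rewrite ax (le_lt_trans xz).
  rewrite -integral_cst//; apply: ge0_le_integral => //.
  - by move=> u _; rewrite lee_fin subr_ge0; case/andP: (Tab xI) => /ltW.
  - exact: mI (ltW ax) zb.
  - move=> u; rewrite /= in_itv /= => /andP[xu uz]; rewrite lee_fin lerB// Tnd//.
      exact: ltW.
    exact: le_lt_trans zb.
have I0 (x z : R) : a <= x -> z < b -> (0 <= \int[mu]_(u in `]x, z]) (T u - a)%:E)%E.
  move=> ax zb; apply: integral_ge0 => u /(sub _ _ ax zb).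
  by rewrite /= in_itv /= => /Tab/andP[/ltW ? _]; rewrite lee_fin subr_ge0.
have fin (x z : R) : a <= x -> x <= z -> z < b ->
    (\int[mu]_(u in `]x, z]) (T u - a)%:E)%E \is a fin_num.
  move=> ax xz zb; rewrite ge0_fin_numE ?I0//.
  by apply: le_lt_trans (incr _ _ ax xz zb) _; rewrite ltry.
exists (fun x => fine (I x)); split.
  move=> x /andP[ax xb]; rewrite fine_ge0 ?I0//=.
  rewrite -lee_fin fineK; last by apply: fin => //; exact: ltW.
  apply: le_trans (incr _ _ (lexx a) (ltW ax) xb) _; rewrite lee_fin expr2.
  have /andP[? ?] : a < T x < b by apply: Tab; rewrite ax.
  by apply: ler_pM; lra.
move=> x z ax xz zb.
have xb := le_lt_trans xz zb.
have E : (I z = I x + \int[mu]_(u in `]x, z]) (T u - a)%:E)%E.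
  have U : `]a, z]%classic = `]a, x] `|` `]x, z].
    by apply: itv_bndbnd_setU; rewrite bnd_simp // ltW.
  rewrite /I U ge0_integral_setU//.
  - by rewrite -U; exact: mI.
  - move=> u; rewrite -U => /(sub _ _ (lexx a) zb).
    by rewrite /= in_itv /= => /Tab/andP[/ltW ? _]; rewrite lee_fin subr_ge0.
  - apply/disj_setPS => u [] /=; rewrite !in_itv /= => /andP[_ ux] /andP[xu _].
    by have := le_lt_trans ux xu; rewrite ltxx.
have -> : fine (I z) - fine (I x) = fine (\int[mu]_(u in `]x, z]) (T u - a)%:E)%E.
  rewrite E fineD; first by ring.
    by apply: fin => //; exact: ltW.
  by apply: fin => //; exact: ltW.
by rewrite -!lee_fin fineK ?decr ?incr ?fin// ltW.
Qed.

Lemma dual_potentials : exists (Phi Psi : R -> R) (K : R),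
  [/\ measurable_fun setT Phi /\ measurable_fun setT Psi,
      forall x : R, 0 <= Phi x /\ 0 <= Psi x,
      forall x y : R, Phi x + Psi y <= (x - y) ^+ 2 + 2 * K,
      forall x : R, a < x < b -> Phi x + Psi (T x) = (x - T x) ^+ 2 + 2 * K & 0 <= K].
Proof.
have ab' := ab; have [Th [Thb Thincr]] := monotone_map_primitive.
pose S (y : R) := [set v | exists2 x : R, a < x < b & v = (x - a) * (y - a) - Th x].
pose Ths (y : R) := sup (S y).
pose m : R := (a + b) / 2; have mI : a < m < b by rewrite /m; apply/andP; split; lra.
have S0 (y : R) : S y !=set0 by exists ((m - a) * (y - a) - Th m), m.
have Sub (y : R) : has_ubound (S y).
  exists ((b - a) * `|y - a|) => _ [x /andP[ax xb] ->].
  have /andP[t0 _] : 0 <= Th x <= (b - a) ^+ 2 by rewrite Thb// ax.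
  have : (x - a) * (y - a) <= (b - a) * `|y - a|.
    apply: le_trans (ler_norm _) _; rewrite normrM ler_wpM2r// ger0_norm; lra.
  lra.
have Ths_ge (x y : R) : a < x < b -> (x - a) * (y - a) - Th x <= Ths y.
  by move=> xI; apply: ub_le_sup => //; exists x.
have Thsb (y : R) : a < y < b -> - (b - a) ^+ 2 <= Ths y <= (b - a) ^+ 2.
  move=> /andP[ay yb]; apply/andP; split.
    have := Ths_ge m y mI; have /andP[? ?] := Thb m mI.
    have /andP[am _] := mI.
    have : 0 <= (m - a) * (y - a) by rewrite mulr_ge0 ?subr_ge0 ?ltW.
    lra.
  apply: ge_sup => // _ [x /[dup] xI /andP[ax xb] ->]; have /andP[? ?] := Thb x xI.
  by have : (x - a) * (y - a) <= (b - a) * (b - a) by [apply: ler_pM; lra]; rewrite expr2; lra.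
have ThsT (x : R) : a < x < b -> Ths (T x) = (x - a) * (T x - a) - Th x.
  move=> /[dup] xI /andP[ax xb]; apply/eqP; rewrite eq_le Ths_ge// andbT.
  apply: ge_sup => // _ [z /andP[az zb] ->].
  have [xz|/ltW zx] := leP x z.
    by have /andP[+ _] := Thincr x z ax xz zb; lra.
  by have /andP[_ +] := Thincr z x az zx xb; lra.
pose K : R := 3 * (b - a) ^+ 2; have K0 : 0 <= K by rewrite mulr_ge0// sqr_ge0.
pose Phi := (fun x => (x - a) ^+ 2 - 2 * Th x + K) \_ Om.
pose Psi := (fun y => (y - a) ^+ 2 - 2 * Ths y + K) \_ Om.
have mSq : measurable_fun Om (fun x : R => (x - a) ^+ 2).
  by apply: measurable_funX; apply: measurable_funB.
have mTh : measurable_fun Om Th.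
  apply: nondecreasing_itv_measurable => x y ax xy yb.
  have xI : a < x < b by rewrite ax (le_lt_trans xy).
  have /andP[+ _] := Thincr x y ax xy yb; have /andP[Tx _] := Tab xI.
  have : 0 <= (T x - a) * (y - x) by rewrite mulr_ge0 ?subr_ge0// ltW.
  lra.
have mThs : measurable_fun Om Ths.
  apply: nondecreasing_itv_measurable => x y ax xy yb.
  apply: ge_sup => // _ [z /[dup] zI /andP[az zb] ->]; apply: le_trans (Ths_ge z y zI).
  by rewrite lerB// ler_pM; lra.
have PhiE (x : R) : a < x < b -> Phi x = (x - a) ^+ 2 - 2 * Th x + K.
  by move=> xI; rewrite /Phi patchE mem_set //= in_itv.
have PsiE (x : R) : a < x < b -> Psi x = (x - a) ^+ 2 - 2 * Ths x + K.
  by move=> xI; rewrite /Psi patchE mem_set //= in_itv.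
have PhiN (x : R) : ~~ (a < x < b) -> Phi x = 0.
  by move=> xI; rewrite /Phi patchE memNset //= in_itv /=; exact/negP.
have PsiN (x : R) : ~~ (a < x < b) -> Psi x = 0.
  by move=> xI; rewrite /Psi patchE memNset //= in_itv /=; exact/negP.
have sqb (x : R) : a < x < b -> 0 <= (x - a) ^+ 2 <= (b - a) ^+ 2.
  by move=> /andP[ax xb]; rewrite sqr_ge0 ler_pXn2r ?nnegrE//; lra.
have Phib (x : R) : 0 <= Phi x <= 2 * K.
  have [xI|xI] := boolP (a < x < b); last by rewrite PhiN// lexx mulr_ge0.
  rewrite PhiE//; have /andP[? ?] := sqb x xI; have /andP[? ?] := Thb x xI.
  by rewrite /K; apply/andP; split; lra.
have Psib (x : R) : 0 <= Psi x <= 2 * K.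
  have [xI|xI] := boolP (a < x < b); last by rewrite PsiN// lexx mulr_ge0.
  rewrite PsiE//; have /andP[? ?] := sqb x xI; have /andP[? ?] := Thsb x xI.
  by rewrite /K; apply/andP; split; lra.
exists Phi, Psi, K; split => //.
- have mpot (f : R -> R) : measurable_fun Om f ->
      measurable_fun Om (fun x => (x - a) ^+ 2 - 2 * f x + K).
    move=> mf; apply: measurable_funD; last exact: measurable_cst.
    by apply: measurable_funB => //; apply: measurable_funM => //; exact: measurable_cst.
  have mOm : measurable Om by exact: measurable_itv.
  by split; apply/(measurable_restrictT _ mOm); exact: mpot.
- by move=> x; case/andP: (Phib x) => -> _; case/andP: (Psib x) => -> _.
- move=> x y; have sq := sqr_ge0 (x - y).
  have /andP[? ?] := Phib x; have /andP[? ?] := Psib y.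
  have [xI|xI] := boolP (a < x < b); last by rewrite PhiN// add0r; lra.
  have [yI|yI] := boolP (a < y < b); last by rewrite PsiN// addr0; lra.
  rewrite PhiE// PsiE//; have := Ths_ge x y xI.
  by rewrite (_ : (x - y) ^+ 2 = (x - a) ^+ 2 + (y - a) ^+ 2 - 2 * ((x - a) * (y - a))); [lra|ring].
- move=> x xI; rewrite PhiE// PsiE ?Tab// ThsT//; ring.
Qed.

End MonotoneMap.

Section TransportCost.
Context {R : realType}.
Local Notation mu := (@lebesgue_measure R).
Variables (a b : R).
Local Notation Om := (`]a, b[%classic : set R).
Let mOm : measurable Om. Proof. exact: measurable_itv. Qed.
Let mu0 (x : R) : Om x = (a < x < b). Proof. by rewrite /= in_itv. Qed.

Lemma measurable_fun_pair_in (f g : R -> R) : measurable_fun Om f -> measurable_fun Om g ->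
  measurable_fun Om (fun x => (f x, g x)).
Proof.
move=> /(measurable_restrictT _ mOm) mf /(measurable_restrictT _ mOm) mg.
apply: (@eq_measurable_fun _ _ _ _ _ (fun x => ((f \_ Om) x, (g \_ Om) x))).
  by move=> x xI; rewrite !patchE xI.
exact: measurable_funTS (measurable_fun_pair mf mg).
Qed.

Lemma ge0_integral_marginal (d : measure_display) (Z : measurableType d)
    (gam : {measure set Z -> \bar R}) (pi : Z -> R) (f : R -> R) (phi : R -> \bar R) :
  measurable_fun setT pi -> measurable_fun Om f -> (forall x, a < x < b -> 0 <= f x) ->
  (forall A, measurable A ->
    gam (pi @^-1` A) = (\int[mu]_(x in A `&` Om) (f x)%:E)%E) ->
  measurable_fun setT phi -> (forall y, 0 <= phi y)%E ->
  (\int[gam]_z phi (pi z) = \int[mu]_(x in Om) (phi x * (f x)%:E))%E.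
Proof.
move=> mpi mf f0 gamE mphi phi0.
have [nu nuE] := @density_image_measure _ _ Z R R gam setT (fun=> 1) pi measurableT
  (measurable_cst _) (fun _ _ => ler01) mpi.
have nuA (A : set R) : measurable A -> nu A = (\int[mu]_(x in Om `&` id @^-1` A) (f x)%:E)%E.
  move=> mA; rewrite nuE setTI integral_cst ?mul1e ?gamE 1?setIC//.
  by rewrite -[X in measurable X]setTI; exact: mpi.
have f0' x : Om x -> 0 <= f x by rewrite mu0; exact: f0.
have mid : measurable_fun Om (@id R) by exact: measurable_id.
rewrite -(@ge0_integral_density_image _ _ _ R R mu Om f id mOm mf f0' mid nu phi nuA mphi phi0).
rewrite (@ge0_integral_density_image _ _ Z R R gam setT (fun=> 1) pi measurableT
  (measurable_cst _) (fun _ _ => ler01) mpi nu phi)//.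
by apply: eq_integral => z _; rewrite mule1.
Qed.

Lemma W2sq_ge_dual (f g Phi Psi : R -> R) (K : R) :
  measurable_fun Om f -> (forall x, a < x < b -> 0 <= f x) ->
  measurable_fun Om g -> (forall x, a < x < b -> 0 <= g x) ->
  (\int[mu]_(x in Om) (f x)%:E < +oo)%E ->
  measurable_fun setT Phi -> measurable_fun setT Psi ->
  (forall x, 0 <= Phi x /\ 0 <= Psi x) -> 0 <= K ->
  (forall x y, Phi x + Psi y <= (x - y) ^+ 2 + 2 * K) ->
  (\int[mu]_(x in Om) ((Phi x)%:E * (f x)%:E) + \int[mu]_(x in Om) ((Psi x)%:E * (g x)%:E)
   <= W2sq a b f g + (2 * K)%:E * \int[mu]_(x in Om) (f x)%:E)%E.
Proof.
move=> mf f0 mg g0 ffin mPhi mPsi P0 K0 dual.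
have fge0 : (0 <= \int[mu]_(x in Om) (f x)%:E)%E.
  by apply: integral_ge0 => x; rewrite mu0 => /f0; rewrite lee_fin.
have mfin : ((2 * K)%:E * \int[mu]_(x in Om) (f x)%:E)%E \is a fin_num.
  by rewrite fin_numM// ge0_fin_numE.
rewrite -leeBlDr//; apply: le_ereal_inf_tmp => _ [gam [cpl ->]]; rewrite leeBlDr//.
have m1 : measurable_fun setT (fun z : R * R => (Phi z.1)%:E).
  by apply/measurable_EFinP; exact: measurableT_comp mPhi measurable_fst.
have m2 : measurable_fun setT (fun z : R * R => (Psi z.2)%:E).
  by apply/measurable_EFinP; exact: measurableT_comp mPsi measurable_snd.
have msq : measurable_fun setT (fun z : R * R => ((z.1 - z.2) ^+ 2)%:E).
  apply/measurable_EFinP; apply: measurable_funX.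
  by apply: measurable_funB; [exact: measurable_fst|exact: measurable_snd].
have E1 : (\int[gam]_z (Phi z.1)%:E = \int[mu]_(x in Om) ((Phi x)%:E * (f x)%:E))%E.
  apply: (ge0_integral_marginal (phi := EFin \o Phi) measurable_fst mf f0).
  - move=> A mA; have [<- _] := cpl A mA.
    by congr (gam _); apply/seteqP; split => z //= [].
  - exact/measurable_EFinP.
  - by move=> y; rewrite lee_fin (P0 y).1.
have E2 : (\int[gam]_z (Psi z.2)%:E = \int[mu]_(x in Om) ((Psi x)%:E * (g x)%:E))%E.
  apply: (ge0_integral_marginal (phi := EFin \o Psi) measurable_snd mg g0).
  - move=> A mA; have [_ <-] := cpl A mA.
    by congr (gam _); apply/seteqP; split => z //= [].
  - exact/measurable_EFinP.
  - by move=> y; rewrite lee_fin (P0 y).2.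
have mass : gam setT = (\int[mu]_(x in Om) (f x)%:E)%E.
  by have [+ _] := cpl setT measurableT; rewrite setXTT setTI.
rewrite -E1 -E2 -mass -(integral_cst gam measurableT) -!ge0_integralD//.
- apply: ge0_le_integral => //.
  + by move=> z _; rewrite adde_ge0 ?lee_fin ?(P0 _).1 ?(P0 _).2.
  + exact: emeasurable_funD.
  + exact: emeasurable_funD.
  + by move=> z _; rewrite -!EFinD lee_fin; exact: dual.
- by move=> z _; rewrite lee_fin sqr_ge0.
- by move=> z _; rewrite lee_fin mulr_ge0.
- by move=> z _; rewrite lee_fin (P0 _).1.
- by move=> z _; rewrite lee_fin (P0 _).2.
Qed.

Lemma W2sq_diag_le0 (f : R -> R) : measurable_fun Om f ->
  (forall x, a < x < b -> 0 <= f x) -> (W2sq a b f f <= 0)%E.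
Proof.
move=> mf f0; have f0' x : Om x -> 0 <= f x by rewrite mu0; exact: f0.
have mg : measurable_fun Om (fun x : R => (x, x)) by exact: measurable_fun_pair_in.
have [gam gamE] := density_image_measure mu mOm mf f0' mg.
apply: ereal_inf_lbound; exists gam; split.
  move=> A mA; rewrite !gamE; split; congr (\int[mu]_(x in _) _)%E;
    by rewrite [RHS]setIC; congr (_ `&` _); apply/seteqP; split => z //= [].
rewrite (@ge0_integral_density_image _ _ _ _ _ mu Om f _ mOm mf f0' mg gam)//.
- by apply/esym/integral0_eq => x _; rewrite /= subrr expr0n mul0e.
- apply/measurable_EFinP; apply: measurable_funX.
  by apply: measurable_funB; [exact: measurable_fst|exact: measurable_snd].
- by move=> z; rewrite lee_fin sqr_ge0.
Qed.

End TransportCost.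

Section Transfer.
Context {R : realType}.
Local Notation mu := (@lebesgue_measure R).
Variables (a b : R) (T s h : R -> R).
Local Notation Om := (`]a, b[%classic : set R).
Hypothesis mT : measurable_fun Om T.
Hypothesis Tab : forall x : R, a < x < b -> a < T x < b.
Hypothesis ms : measurable_fun Om s.
Hypothesis s0 : forall x : R, a < x < b -> 0 <= s x.
Hypothesis mh : measurable_fun Om h.
Hypothesis h0 : forall x : R, a < x < b -> 0 <= h x.
Hypothesis push : forall B : set R, measurable B ->
  (\int[mu]_(x in Om `&` (T @^-1` B)) (s x)%:E = \int[mu]_(x in Om `&` B) (h x)%:E)%E.

Let mOm : measurable Om. Proof. exact: measurable_itv. Qed.
Let OmE (x : R) : Om x = (a < x < b). Proof. by rewrite /= in_itv. Qed.
Let s0' (x : R) : Om x -> 0 <= s x. Proof. by rewrite OmE; exact: s0. Qed.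
Let h0' (x : R) : Om x -> 0 <= h x. Proof. by rewrite OmE; exact: h0. Qed.

Lemma ge0_integral_push (phi : R -> \bar R) :
  measurable_fun setT phi -> (forall y, 0 <= phi y)%E ->
  (\int[mu]_(x in Om) (phi (T x) * (s x)%:E) = \int[mu]_(y in Om) (phi y * (h y)%:E))%E.
Proof.
move=> mphi phi0; have mid : measurable_fun Om (@id R) by exact: measurable_id.
have [nu nuE] := @density_image_measure _ _ _ R R mu Om h id mOm mh h0' mid.
rewrite -(@ge0_integral_density_image _ _ _ R R mu Om h id mOm mh h0' mid nu)//.
rewrite -(@ge0_integral_density_image _ _ _ R R mu Om s T mOm ms s0' mT nu)//.
by move=> A mA; rewrite nuE -push.
Qed.

Lemma push_mass : (\int[mu]_(x in Om) (s x)%:E = \int[mu]_(x in Om) (h x)%:E)%E.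
Proof. by have := @push setT measurableT; rewrite preimage_setT !setIT. Qed.

Variables (k : R -> R) (e p del t : R).
Local Notation I := (`[p, p + del[%classic : set R).
Hypothesis mk : measurable_fun Om k.
Hypothesis k01 : forall x : R, a < x < b -> 0 <= k x <= 1.
Hypothesis e0 : 0 <= e.
Hypothesis ap : a < p.
Hypothesis pb : p + del < b.
Hypothesis apt : a < p + t.
Hypothesis ptb : p + t + del < b.
Hypothesis es : forall x : R, I x -> e <= s x.

Definition moved : R -> R := (fun x => e * k (T x)) \_ I.
Definition transferred (x : R) : R := k (T x) * (s x - e * \1_I x) + moved (x - t).

Let mI : measurable I. Proof. exact: measurable_itv. Qed.
Let IOm : I `<=` Om.
Proof.
by move=> x /=; rewrite !in_itv /= => /andP[px /ltW xp]; rewrite (lt_le_trans ap px) (le_lt_trans xp pb).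
Qed.

Let mkT : measurable_fun Om (k \o T).
Proof.
apply: (measurable_comp mOm _ mk mT) => _ [x xI <-].
by rewrite OmE; apply: Tab; rewrite -OmE.
Qed.

Let kT01 (x : R) : Om x -> 0 <= k (T x) <= 1.
Proof. by rewrite OmE => /Tab/k01. Qed.

Let m_moved : measurable_fun setT moved.
Proof.
apply/(measurable_restrictT _ mI); apply: measurable_funM; first exact: measurable_cst.
exact: measurable_funS mkT.
Qed.

Let moved0 (x : R) : 0 <= moved x.
Proof.
rewrite /moved patchE; case: ifPn => // /set_mem/IOm/kT01/andP[k0 _].
exact: mulr_ge0.
Qed.

Let movedN (x : R) : ~ I x -> moved x = 0.
Proof. by move=> xI; rewrite /moved patchE memNset. Qed.

Let kept (x : R) := k (T x) * (s x - e * \1_I x).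

Let m_kept : measurable_fun Om kept.
Proof.
apply: measurable_funM => //; apply: measurable_funB => //.
by apply: measurable_funM => //; exact: measurable_indic.
Qed.

Let kept0 (x : R) : Om x -> 0 <= kept x.
Proof.
move=> xI; have /andP[k0 _] := kT01 xI; apply: mulr_ge0 => //.
rewrite subr_ge0 indicE; case: (boolP (x \in I)) => [/set_mem/es|_]; first by rewrite mulr1.
by rewrite mulr0 s0'.
Qed.

Lemma restrict_indicE (f : R -> R) (A : set R) (x : R) : (f \_ A) x = f x * \1_A x.
Proof. by rewrite patchE indicE; case: ifPn => _; rewrite ?mulr1 ?mulr0. Qed.

Let kept_moved (x : R) : kept x + moved x = k (T x) * s x.
Proof.
rewrite /kept /moved restrict_indicE; ring.
Qed.

Let m_shift : measurable_fun setT (fun x : R => x - t).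
Proof. by apply: measurable_funB. Qed.

Let m_moved_shift : measurable_fun setT (fun x : R => moved (x - t)).
Proof. exact: measurableT_comp m_moved m_shift. Qed.

Let moved_shiftN (x : R) : ~ Om x -> moved (x - t) = 0.
Proof.
move=> xO; apply: movedN => xI; apply: xO; move: xI apt ptb; rewrite OmE /= in_itv /=.
by move=> /andP[? ?] ? ?; apply/andP; split; lra.
Qed.

Lemma transferred_sum (k' : R -> R) (x : R) : a < x < b ->
  (forall y, a < y < b -> k' y = 1 - k y) ->
  transferred x + (k' (T x) * (s x - e * \1_I x) + ((fun x => e * k' (T x)) \_ I) (x - t)) =
  s x - e * \1_I x + e * \1_I (x - t).
Proof.
move=> xab kk'; rewrite /transferred /moved !restrict_indicE !indicE (kk' (T x)) ?Tab//.
case: (boolP (x - t \in I)) => [/set_mem/IOm|_]; last by rewrite /=; ring.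
by rewrite OmE => xt; rewrite kk' ?Tab//=; ring.
Qed.

Let plan : exists gam : {measure set (R * R)%type -> \bar R},
  coupling a b transferred (fun x => k x * h x) gam /\
  (\int[gam]_z ((z.1 - z.2) ^+ 2)%:E =
   \int[mu]_(x in Om) ((x - T x) ^+ 2 * kept x)%:E
   + \int[mu]_(x in Om) ((x + t - T x) ^+ 2 * moved x)%:E)%E.
Proof.
have mg1 : measurable_fun Om (fun x : R => (x, T x)) by exact: measurable_fun_pair_in.
have mg2 : measurable_fun Om (fun x : R => (x + t, T x)).
  by apply: measurable_fun_pair_in => //; exact: measurable_funD.
have mmv : measurable_fun Om moved by exact: measurable_funTS.
have mv0 x : Om x -> 0 <= moved x by move=> _; exact: moved0.
have [g1 g1E] := density_image_measure mu mOm m_kept kept0 mg1.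
have [g2 g2E] := density_image_measure mu mOm mmv mv0 mg2.
pose gam : {measure set (R * R)%type -> \bar R} := measure_add g1 g2.
have gamE B : gam B = (g1 B + g2 B)%E by exact: measure_addE.
exists gam; split; last first.
  have msq : measurable_fun setT (fun z : R * R => ((z.1 - z.2) ^+ 2)%:E).
    apply/measurable_EFinP; apply: measurable_funX.
    by apply: measurable_funB; [exact: measurable_fst|exact: measurable_snd].
  have sq0 (z : R * R) : (0 <= ((z.1 - z.2) ^+ 2)%:E)%E by rewrite lee_fin sqr_ge0.
  rewrite ge0_integral_measure_add//; congr (_ + _)%E.
    by rewrite (@ge0_integral_density_image _ _ _ _ _ mu Om _ _ mOm m_kept kept0 mg1 g1 _ (fun A _ => g1E A) msq sq0).
  by rewrite (@ge0_integral_density_image _ _ _ _ _ mu Om _ _ mOm mmv mv0 mg2 g2 _ (fun A _ => g2E A) msq sq0).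
have mE (A : set R) (f : R -> R) : measurable A -> measurable_fun Om f ->
    measurable_fun (Om `&` A) (EFin \o f).
  by move=> mA mf; apply/measurable_EFinP; apply: measurable_funS mf => //; exact: subIsetl.
move=> A mA; rewrite !gamE !g1E !g2E; split.
  have -> : (fun x : R => (x, T x)) @^-1` (A `*` setT) = A.
    by apply/seteqP; split => z //= [].
  have -> : (fun x : R => (x + t, T x)) @^-1` (A `*` setT) = (fun x : R => x + t) @^-1` A.
    by apply/seteqP; split => z //= [].
  have mAt : measurable ((fun x : R => x + t) @^-1` A).
    by rewrite -[X in measurable X]setTI; apply: (measurable_funD _ _ measurableT mA).
  have -> : (\int[mu]_(x in Om `&` (fun x => x + t)%R @^-1` A) (moved x)%:E =
      \int[mu]_(x in Om `&` A) (moved (x - t)%R)%:E)%E.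
    transitivity (\int[mu]_x ((\1_A (x + t)%R)%:E * (moved x)%:E))%E.
      rewrite integral_mkcond; apply: eq_integral => x _; rewrite patchE indicE.
      case: ifPn => [/set_mem[xO xA]|/negP xN]; first by rewrite mem_set// mul1e.
      case: (boolP (x + t \in A)) => [/set_mem xA|_]; last by rewrite mul0e.
      rewrite mul1e movedN// => /IOm xO; apply: xN; rewrite inE; split => //.
    rewrite -(@ge0_integral_shift R (- t)).
    - rewrite [RHS]integral_mkcond; apply: eq_integral => x _; rewrite patchE indicE subrK.
      case: ifPn => [/set_mem[xO xA]|/negP xN]; first by rewrite mem_set// mul1e.
      case: (boolP (x \in A)) => [/set_mem xA|_]; last by rewrite mul0e.
      by rewrite mul1e moved_shiftN// => xO; apply: xN; rewrite inE; split.
    - apply: emeasurable_funM; last exact/measurable_EFinP.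
      apply/measurable_EFinP; apply: measurableT_comp; first exact: measurable_indic.
      exact: measurable_funD.
    - by move=> x; rewrite mule_ge0 ?lee_fin.
  rewrite -ge0_integralD//.
  - by rewrite setIC.
  - exact: measurableI.
  - by move=> x [/kept0 ? _]; rewrite lee_fin.
  - exact: mE.
  - by move=> x _; rewrite lee_fin.
  - by apply: mE => //; exact: measurable_funTS.
have -> : (fun x : R => (x, T x)) @^-1` (setT `*` A) = T @^-1` A.
  by apply/seteqP; split => z //= [].
have -> : (fun x : R => (x + t, T x)) @^-1` (setT `*` A) = T @^-1` A.
  by apply/seteqP; split => z //= [].
have mTA : measurable (Om `&` T @^-1` A) by exact: mT.
rewrite -ge0_integralD//; last 4 first.
- by move=> x [/kept0 ? _]; rewrite lee_fin.
- by apply/measurable_EFinP; apply: measurable_funS m_kept => //; exact: subIsetl.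
- by move=> x _; rewrite lee_fin.
- by apply/measurable_EFinP; apply: measurable_funS mmv => //; exact: subIsetl.
pose phi (y : R) : \bar R := (((k \_ Om) y)%:E * (\1_A y)%:E)%E.
have := @ge0_integral_push phi.
have mphi : measurable_fun setT phi.
  apply: emeasurable_funM; apply/measurable_EFinP; last exact: measurable_indic.
  exact/(measurable_restrictT _ mOm).
have phi0 y : (0 <= phi y)%E.
  rewrite mule_ge0 ?lee_fin// patchE; case: ifPn => // /set_mem; rewrite OmE.
  by move=> /k01/andP[].
move=> /(_ mphi phi0) pushE.
transitivity (\int[mu]_(x in Om) (phi (T x) * (s x)%:E))%E.
  rewrite integral_mkcondr; apply: eq_integral => x /set_mem xO; rewrite patchE.
  have TO : Om (T x) by rewrite OmE Tab// -OmE.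
  rewrite /phi patchE (mem_set TO) indicE -EFinD kept_moved.
  rewrite (_ : (x \in T @^-1` A) = (T x \in A)); last first.
    by apply/idP/idP => /set_mem ?; exact/mem_set.
  by case: (T x \in A); rewrite ?mule1 ?mule0 ?mul0e -?EFinM.
rewrite pushE [RHS]integral_mkcondl; apply: eq_integral => x /set_mem xO.
rewrite patchE /phi patchE (mem_set xO) indicE.
by case: (x \in A); rewrite ?mule1 ?mule0 ?mul0e -?EFinM.
Qed.

Lemma W2sq_transferred_le : (W2sq a b transferred (fun x => k x * h x)%R <=
   \int[mu]_(x in Om) ((x - T x) ^+ 2 * (k (T x) * (s x - e * \1_I x)))%:E
   + \int[mu]_(x in Om) ((x + t - T x) ^+ 2 * moved x)%:E)%E.
Proof. by have [gam [cpl E]] := plan; apply: ereal_inf_lbound; exists gam. Qed.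

Lemma adm_transferred :
  adm_density a b (\int[mu]_(x in `]a, b[) (k x * h x)%:E)%E transferred.
Proof.
split; [|split].
- by apply: measurable_funD => //; exact: measurable_funTS.
- by move=> x xab; apply: addr_ge0 => //; apply: kept0; rewrite OmE.
- have [gam [cpl _]] := plan; have [+ +] := cpl setT measurableT.
  by rewrite !setTI => <- <-.
Qed.

End Transfer.

(** * First variation of the minimisation problem *)

Section IntegralPerturbation.
Context {R : realType}.
Local Notation mu := (@lebesgue_measure R).
Variables (a b : R).
Local Notation Om := (`]a, b[%classic).
Hypothesis ab : a < b.
Let mOm : measurable Om. Proof. exact: measurable_itv. Qed.
Let muOm : mu Om = (b - a)%:E.
Proof. by rewrite lebesgue_measure_itv /= lte_fin ab EFinB. Qed.

Lemma integrable_cst_itv (c : R) : mu.-integrable Om (EFin \o cst c).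
Proof.
apply/integrableP; split; first exact/measurable_EFinP.
have := @integral_cst _ _ _ mu Om mOm `|c|%:E; rewrite /cst /= => ->.
by rewrite muOm -EFinM ltry.
Qed.

Lemma integrable_bounded_below (f : R -> R) (m : R) : measurable_fun Om f ->
  (forall x, a < x < b -> m <= f x) -> (\int[mu]_(x in Om) (f x)%:E < +oo)%E ->
  mu.-integrable Om (EFin \o f).
Proof.
move=> mf fm flt; have mf' : measurable_fun Om (EFin \o f) by exact/measurable_EFinP.
have neg : (\int[mu]_(x in Om) ((EFin \o f)^\- x) < +oo)%E.
  apply: (@le_lt_trans _ _ (\int[mu]_(x in Om) (cst `|m|%:E x)))%E; last first.
    by rewrite integral_cst//= muOm -EFinM ltry.
  apply: ge0_le_integral => //; first exact: measurable_funeneg.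
  move=> x; rewrite /= in_itv /= => /fm fx; rewrite funenegE ge_max /= !lee_fin normr_ge0 andbT.
  by rewrite (le_trans (_ : - f x <= - m)) ?lerN2// -normrN ler_norm.
apply/integrableP; split => //.
rewrite -[X in (\int[_]_(x in _) X x)%E]/(abse \o (EFin \o f)) fune_abse.
rewrite ge0_integralD//; [|exact: measurable_funepos|exact: measurable_funeneg].
apply: lte_add_pinfty => //.
rewrite integralE in flt; rewrite ltey; apply/eqP => posE.
move: flt; rewrite posE.
have nfin : (\int[mu]_(x in Om) ((EFin \o f)^\- x))%E \is a fin_num.
  by rewrite ge0_fin_numE ?integral_ge0.
by move: nfin neg; case: (\int[mu]_(x in Om) _)%E.
Qed.

Lemma le_integral_perturb (F G : R -> R) (m p q del al be : R) :
  a < p -> p + del < b -> a < q -> q + del < b -> 0 <= del ->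
  mu.-integrable Om (EFin \o F) -> measurable_fun Om G ->
  (forall x, a < x < b -> m <= G x) ->
  (forall x, a < x < b ->
    G x <= F x + al * \1_(`[p, p + del[%classic) x + be * \1_(`[q, q + del[%classic) x) ->
  (\int[mu]_(x in Om) (G x)%:E <=
    \int[mu]_(x in Om) (F x)%:E + ((al + be) * del)%:E)%E.
Proof.
move=> ap pb aq qb del0 iF mG Gm GF.
have indI (c y : R) : a < y -> y + del < b ->
    mu.-integrable Om (fun x => (c * \1_(`[y, y + del[%classic) x)%:E) /\
    (\int[mu]_(x in Om) (c * \1_(`[y, y + del[%classic) x)%:E = (c * del)%:E)%E.
  move=> ay yb; have iI : mu.-integrable Om (EFin \o \1_(`[y, y + del[%classic)).
    apply: (integrableS measurableT) => //; exact: integrable_indic_itv.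
  split.
    by have := @integrableZl _ _ _ mu Om mOm c _ iI; apply: eq_integrable.
  under eq_integral do rewrite EFinM.
  rewrite integralZl// integral_indic// (_ : _ `&` _ = `[y, y + del[%classic); last first.
    apply/seteqP; split => [x []//|x /=]; rewrite !in_itv /= => /andP[yx xy].
    by rewrite yx xy (lt_le_trans ay yx) (lt_trans xy yb).
  rewrite /= lebesgue_measure_itv /= lte_fin ltrDl.
  case: ltP => [_|del0']; first by rewrite -EFinB addrC addKr.
  by have -> : del = 0 by [apply/eqP; rewrite eq_le del0 del0']; rewrite mulr0 mule0.
have [iI eI] := indI al p ap pb; have [iJ eJ] := indI be q aq qb.
have iD := @integrableD _ _ _ mu Om mOm; have ID := @integralD _ _ _ mu Om mOm.
have iFI := iD _ _ iF iI; have iR := iD _ _ iFI iJ.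
have iG : mu.-integrable Om (EFin \o G).
  pose bd (x : R) := `|F x + al * \1_(`[p, p + del[%classic) x + be * \1_(`[q, q + del[%classic) x| + `|m|.
  have ibd : mu.-integrable Om (EFin \o bd).
    have := iD _ _ (integrable_abse iR) (integrable_cst_itv `|m|).
    by apply: eq_integrable.
  apply: (@le_integrable _ _ _ mu Om mOm _ _ _ _ ibd); first exact/measurable_EFinP.
  move=> x; rewrite /= in_itv /= => xI; rewrite lee_fin.
  rewrite /bd [X in _ <= X]ger0_norm ?addr_ge0//; have := GF x xI; have := Gm x xI.
  set y := F x + _ + _ => mg gy; rewrite ler_norml.
  have := ler_norm y; have := ler_norm (- m); rewrite normrN.
  have := normr_ge0 y; have := normr_ge0 m => *; apply/andP; split; lra.
have <- : (\int[mu]_(x in Om) (F x + al * \1_(`[p, p + del[%classic) x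
    + be * \1_(`[q, q + del[%classic) x)%:E =
    \int[mu]_(x in Om) (F x)%:E + ((al + be) * del)%:E)%E.
  under eq_integral do rewrite !EFinD.
  by rewrite (ID _ _ iFI iJ) (ID _ _ iF iI) eI eJ -addeA -EFinD -mulrDl.
apply: (@le_integral _ _ _ mu Om mOm _ _ iG); first by apply: eq_integrable iR.
by move=> x /set_mem; rewrite /= in_itv /= lee_fin; exact: GF.
Qed.

End IntegralPerturbation.

Section Minimiser.
Context {R : realType}.
Local Notation mu := (@lebesgue_measure R).
Variables (a b tau M : R) (chi k h rho eta T : R -> R).
Local Notation Om := (`]a, b[%classic).
Hypothesis ab : a < b.
Hypothesis tau0 : 0 < tau.
Hypothesis chi_cont : {within `[0, +oo[, continuous chi}.
Hypothesis chi_C2 : forall x, 0 < x -> derivable chi x 1 /\ derivable (derive1 chi) x 1 /\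
  {for x, continuous (derive1n 2 chi)}.
Hypothesis chi_convex : forall x, 0 < x -> 0 < derive1n 2 chi x.
Hypothesis chi_lim0 : derive1 chi h @[h --> 0^'+] --> 0.
Hypothesis mk : measurable_fun Om k.
Hypothesis k01 : forall x : R, a < x < b -> 0 <= k x <= 1.
Hypothesis mh : measurable_fun Om h.
Hypothesis h0 : forall x : R, a < x < b -> 0 <= h x.
Hypothesis hM : forall x : R, a < x < b -> h x <= M.

Local Notation rhoh := (fun x => k x * h x).
Local Notation etah := (fun x => (1 - k x) * h x).
Local Notation m1 := (\int[mu]_(x in Om) (k x * h x)%:E)%E.
Local Notation m2 := (\int[mu]_(x in Om) ((1 - k x) * h x)%:E)%E.
Hypothesis adm_rho : adm_density a b m1 rho.
Hypothesis adm_eta : adm_density a b m2 eta.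
Hypothesis minimal : forall f g, adm_density a b m1 f -> adm_density a b m2 g ->
  (jko a b tau chi rhoh etah rho eta <= jko a b tau chi rhoh etah f g)%E.
Hypothesis Tnd : forall x y, a < x -> x <= y -> y < b -> T x <= T y.
Hypothesis Tab : forall x, a < x < b -> a < T x < b.
Local Notation s := (fun x => rho x + eta x).
Hypothesis push : forall B : set R, measurable B ->
  (\int[mu]_(x in Om `&` (T @^-1` B)) (s x)%:E = \int[mu]_(x in Om `&` B) (h x)%:E)%E.

Let mOm : measurable Om. Proof. exact: measurable_itv. Qed.
Let OmE (x : R) : Om x = (a < x < b). Proof. by rewrite /= in_itv. Qed.
Let muOm : mu Om = (b - a)%:E.
Proof. by rewrite lebesgue_measure_itv /= lte_fin ab EFinB. Qed.
Let mT : measurable_fun Om T. Proof. exact: nondecreasing_itv_measurable. Qed.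
Let mrho : measurable_fun Om rho. Proof. by case: adm_rho. Qed.
Let meta : measurable_fun Om eta. Proof. by case: adm_eta. Qed.
Let rho0 (x : R) : a < x < b -> 0 <= rho x. Proof. by case: adm_rho => _ [+ _]; apply. Qed.
Let eta0 (x : R) : a < x < b -> 0 <= eta x. Proof. by case: adm_eta => _ [+ _]; apply. Qed.
Let ms : measurable_fun Om s. Proof. exact: measurable_funD. Qed.
Let s0 (x : R) : a < x < b -> 0 <= s x. Proof. by move=> xI; rewrite addr_ge0 ?rho0 ?eta0. Qed.
Let mk' : measurable_fun Om (fun x => 1 - k x). Proof. exact: measurable_funB. Qed.
Let k01' (x : R) : a < x < b -> 0 <= 1 - k x <= 1.
Proof. by move=> /k01/andP[? ?]; apply/andP; split; lra. Qed.
Let mrhoh : measurable_fun Om rhoh. Proof. exact: measurable_funM. Qed.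
Let metah : measurable_fun Om etah. Proof. exact: measurable_funM. Qed.
Let rhoh0 (x : R) : a < x < b -> 0 <= rhoh x.
Proof. by move=> xI; have /andP[? _] := k01 xI; rewrite mulr_ge0 ?h0. Qed.
Let etah0 (x : R) : a < x < b -> 0 <= etah x.
Proof. by move=> xI; have /andP[? _] := k01' xI; rewrite mulr_ge0 ?h0. Qed.

Let E0 (f : R -> R) : (forall x : R, a < x < b -> 0 <= f x) ->
  forall x, Om x -> (0 <= (f x)%:E)%E.
Proof. by move=> f0 x; rewrite OmE lee_fin; exact: f0. Qed.

Let ID (f g : R -> R) : measurable_fun Om f -> (forall x : R, a < x < b -> 0 <= f x) ->
  measurable_fun Om g -> (forall x : R, a < x < b -> 0 <= g x) ->
  (\int[mu]_(x in Om) (f x)%:E + \int[mu]_(x in Om) (g x)%:E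
   = \int[mu]_(x in Om) (f x + g x)%:E)%E.
Proof.
move=> mf f0 mg g0; by rewrite -ge0_integralD//; (exact: E0 || exact/measurable_EFinP).
Qed.

Let h_fin : (\int[mu]_(x in Om) (h x)%:E < +oo)%E.
Proof.
apply: (@le_lt_trans _ _ (\int[mu]_(x in Om) (cst M%:E x)))%E.
  by apply: ge0_le_integral => //; exact/measurable_EFinP.
by rewrite integral_cst//= muOm -EFinM ltry.
Qed.

Let s_fin : (\int[mu]_(x in Om) (s x)%:E < +oo)%E.
Proof. by rewrite (push_mass push). Qed.

Let s_int : mu.-integrable Om (EFin \o s).
Proof. exact: (integrable_bounded_below ab ms s0 s_fin). Qed.

Let rho_fin : (\int[mu]_(x in Om) (rho x)%:E < +oo)%E.
Proof.
apply: le_lt_trans s_fin; apply: ge0_le_integral => //.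
- exact/measurable_EFinP.
- exact/measurable_EFinP.
- by move=> x; rewrite OmE lee_fin => xI; rewrite lerDl eta0.
Qed.

Let eta_fin : (\int[mu]_(x in Om) (eta x)%:E < +oo)%E.
Proof.
apply: le_lt_trans s_fin; apply: ge0_le_integral => //.
- exact/measurable_EFinP.
- exact/measurable_EFinP.
- by move=> x; rewrite OmE lee_fin => xI; rewrite lerDr rho0.
Qed.

Let cost (x : R) : R := (x - T x) ^+ 2 * s x.

Let msq (t : R) : measurable_fun Om (fun x : R => (x + t - T x) ^+ 2).
Proof.
by apply: measurable_funX; apply: measurable_funB => //; apply: measurable_funD.
Qed.

Let msq0 : measurable_fun Om (fun x : R => (x - T x) ^+ 2).
Proof. by apply: measurable_funX; apply: measurable_funB. Qed.

Let mcost : measurable_fun Om cost. Proof. exact: measurable_funM. Qed.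

Let cost0 (x : R) : a < x < b -> 0 <= cost x.
Proof. by move=> xI; rewrite mulr_ge0 ?sqr_ge0 ?s0. Qed.

Let cost_int : mu.-integrable Om (EFin \o cost).
Proof.
have iZ := @integrableZl _ _ _ mu Om mOm ((b - a) ^+ 2) _ s_int.
apply: (@le_integrable _ _ _ mu Om mOm _ _ _ _ iZ); first exact/measurable_EFinP.
move=> x; rewrite OmE => xI /=; rewrite lee_fin !ger0_norm ?cost0//; last first.
  by rewrite mulr_ge0 ?sqr_ge0// s0.
apply: ler_wpM2r; first exact: s0.
have /andP[? ?] := Tab xI; have /andP[? ?] := xI.
rewrite -real_normK ?num_real// ler_pXn2r ?nnegrE//; last lra.
by rewrite ler_norml; apply/andP; split; lra.
Qed.

Lemma cost_le_W2sq :
  (\int[mu]_(x in Om) (cost x)%:E <= W2sq a b rho rhoh + W2sq a b eta etah)%E.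
Proof.
have [Phi [Psi [K [[mPhi mPsi] P0 dual eqT K0]]]] := dual_potentials ab Tnd Tab.
have d1 := W2sq_ge_dual mrho rho0 mrhoh rhoh0 rho_fin mPhi mPsi P0 K0 dual.
have d2 := W2sq_ge_dual meta eta0 metah etah0 eta_fin mPhi mPsi P0 K0 dual.
have mP (f g : R -> R) : measurable_fun setT f -> measurable_fun Om g ->
    measurable_fun Om (fun x => f x * g x).
  by move=> mf mg; apply: measurable_funM => //; exact: measurable_funTS.
have PhiM (g : R -> R) : (forall x : R, a < x < b -> 0 <= g x) ->
    forall x : R, a < x < b -> 0 <= Phi x * g x.
  by move=> g0 x xI; rewrite mulr_ge0 ?g0 ?(P0 x).1.
have PsiM (g : R -> R) : (forall x : R, a < x < b -> 0 <= g x) ->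
    forall x : R, a < x < b -> 0 <= Psi x * g x.
  by move=> g0 x xI; rewrite mulr_ge0 ?g0 ?(P0 x).2.
have e1 : (\int[mu]_(x in Om) ((Phi x)%:E * (rho x)%:E) +
    \int[mu]_(x in Om) ((Phi x)%:E * (eta x)%:E) = \int[mu]_(x in Om) (Phi x * s x)%:E)%E.
  rewrite (ID (mP _ _ mPhi mrho) (PhiM _ rho0) (mP _ _ mPhi meta) (PhiM _ eta0)).
  by apply: eq_integral => x _; rewrite mulrDr.
have e2 : (\int[mu]_(x in Om) ((Psi x)%:E * (k x * h x)%:E) +
    \int[mu]_(x in Om) ((Psi x)%:E * ((1 - k x) * h x)%:E) =
    \int[mu]_(x in Om) (Psi (T x) * s x)%:E)%E.
  rewrite (ID (mP _ _ mPsi mrhoh) (PsiM _ rhoh0) (mP _ _ mPsi metah) (PsiM _ etah0)).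
  have -> : (\int[mu]_(x in Om) (Psi (T x) * s x)%:E =
      \int[mu]_(x in Om) ((EFin \o Psi) x * (h x)%:E))%E.
    rewrite -(ge0_integral_push mT ms s0 mh h0 push)//; first exact/measurable_EFinP.
    by move=> x; rewrite lee_fin (P0 x).2.
  by apply: eq_integral => x _; rewrite -EFinM; congr EFin; ring.
have mPsiT : measurable_fun Om (fun x => Psi (T x) * s x).
  by apply: measurable_funM => //; exact: measurableT_comp mPsi mT.
have PsiT0 (x : R) : a < x < b -> 0 <= Psi (T x) * s x.
  by move=> xI; rewrite mulr_ge0 ?s0 ?(P0 _).2.
have e3 : (\int[mu]_(x in Om) (Phi x * s x)%:E + \int[mu]_(x in Om) (Psi (T x) * s x)%:E =
    \int[mu]_(x in Om) (cost x)%:E + (2 * K)%:E * \int[mu]_(x in Om) (s x)%:E)%E.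
  rewrite (ID (mP _ _ mPhi ms) (PhiM _ s0) mPsiT PsiT0).
  rewrite -ge0_integralZl_EFin ?mulr_ge0//; last exact/measurable_EFinP.
  have mKs : measurable_fun Om (fun x => 2 * K * s x) by exact: measurable_funM.
  have Ks0 (x : R) : a < x < b -> 0 <= 2 * K * s x.
    by move=> xI; rewrite !mulr_ge0 ?s0.
  rewrite (ID mcost cost0 mKs Ks0); apply: eq_integral => x /set_mem; rewrite OmE => xI.
  by rewrite -mulrDl eqT// mulrDl.
have sE : (\int[mu]_(x in Om) (s x)%:E = \int[mu]_(x in Om) (rho x)%:E
    + \int[mu]_(x in Om) (eta x)%:E)%E by rewrite ID.
have sfin : ((2 * K)%:E * \int[mu]_(x in Om) (s x)%:E)%E \is a fin_num.
  by rewrite fin_numM// ge0_fin_numE ?integral_ge0//; exact: E0.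
rewrite -(leeD2rE _ _ sfin) -e3 -e1 -e2 sE ge0_muleDr; last 2 first.
- by apply: integral_ge0; exact: E0.
- by apply: integral_ge0; exact: E0.
by rewrite addeACA [leRHS]addeACA; exact: leeD.
Qed.

Let W2sq_ge0 (f g : R -> R) : (0 <= W2sq a b f g)%E.
Proof.
apply: le_ereal_inf_tmp => _ [gam [_ ->]]; apply: integral_ge0 => z _.
by rewrite lee_fin sqr_ge0.
Qed.

Let mchi (f : R -> R) : measurable_fun Om f -> (forall x : R, a < x < b -> 0 <= f x) ->
  measurable_fun Om (fun x => chi (f x)).
Proof.
by move=> mf f0; apply: chi_measurable => // x; rewrite OmE; exact: f0.
Qed.

Let chi0 := chi_ge chi_cont chi_C2 chi_convex chi_lim0.

Let energy_int : mu.-integrable Om (EFin \o (fun x => chi (s x))).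
Proof.
apply: (integrable_bounded_below ab (mchi ms s0) (m := chi 0)).
  by move=> x xI; apply: chi0; exact: s0.
have tau2 : 0 <= (2 * tau)^-1 by rewrite invr_ge0 mulr_ge0// ltW.
have adm1 : adm_density a b m1 rhoh by [].
have adm2 : adm_density a b m2 etah by [].
have := minimal adm1 adm2; rewrite /jko => jmin.
have lo : (energy a b chi rho eta <= jko a b tau chi rhoh etah rho eta)%E.
  by rewrite /jko leeDr// mule_ge0 ?lee_fin// adde_ge0.
apply: (le_lt_trans (le_trans lo jmin)).
have -> : (W2sq a b rhoh rhoh = 0)%E.
  by apply/eqP; rewrite eq_le W2sq_ge0 W2sq_diag_le0.
have -> : (W2sq a b etah etah = 0)%E.
  by apply/eqP; rewrite eq_le W2sq_ge0 W2sq_diag_le0.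
rewrite adde0 mul0e add0e.
have -> : energy a b chi rhoh etah = (\int[mu]_(x in Om) (chi (h x))%:E)%E.
  by apply: eq_integral => x _; congr (chi _)%:E; ring.
have M0 : 0 <= M.
  have mI : a < (a + b) / 2 < b by have ab' := ab; apply/andP; split; lra.
  exact: le_trans (h0 mI) (hM mI).
have ichi : mu.-integrable Om (EFin \o (fun x => chi (h x))).
  have ic := integrable_cst_itv ab (`|chi 0| + `|chi M|).
  apply: (@le_integrable _ _ _ mu Om mOm _ _ _ _ ic); first by apply/measurable_EFinP; exact: mchi.
  move=> x; rewrite OmE => xI /=; rewrite lee_fin [X in _ <= X]ger0_norm ?addr_ge0//.
  have c0 : chi 0 <= chi (h x) by apply: chi0; exact: h0.
  have cM : chi (h x) <= chi M.
    by apply: (chi_le chi_cont chi_C2 chi_convex chi_lim0); [exact: h0|exact: hM].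
  rewrite ler_norml; have := ler_norm (chi M); have := ler_norm (- chi 0); rewrite normrN.
  have := normr_ge0 (chi M); have := normr_ge0 (chi 0) => *; apply/andP; split; lra.
by have := @integrable_fin_num _ _ _ mu Om mOm _ ichi; rewrite fin_numE => /andP[_]; rewrite -ltey.
Qed.

Lemma transfer_inequality (e del p t s1 s2 B : R) :
  0 < e -> 0 < del -> a < p -> p + del < b -> a < p + t -> p + t + del < b -> del <= `|t| ->
  0 <= s1 -> (forall x, p <= x < p + del -> s1 + e <= s x) ->
  (forall x, p + t <= x < p + t + del -> s x + e <= s2) ->
  (forall x, p <= x < p + del -> (x + t - T x) ^+ 2 - (x - T x) ^+ 2 <= B) ->
  dchi chi s1 <= dchi chi s2 + B / (2 * tau).
Proof.
move=> e0 del0 ap pb apt ptb delt s10 sI sJ TB.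
have tau0' := tau0.
pose I := `[p, p + del[%classic : set R; pose J := `[p + t, p + t + del[%classic : set R.
have IOm (x : R) : p <= x < p + del -> a < x < b.
  by move=> /andP[px xp]; rewrite (lt_le_trans ap px) (lt_trans xp pb).
have es x : I x -> e <= s x.
  rewrite /I /= in_itv /= => /sI; lra.
have e0' := ltW e0.
pose f := transferred T s k e p del t.
pose g := transferred T s (fun x => 1 - k x) e p del t.
have admf := adm_transferred mT Tab ms s0 mh h0 push mk k01 e0' ap pb apt ptb es.
have admg := adm_transferred mT Tab ms s0 mh h0 push mk' k01' e0' ap pb apt ptb es.
have Wf := W2sq_transferred_le mT Tab ms s0 mh h0 push mk k01 e0' ap pb apt ptb es.
have Wg := W2sq_transferred_le mT Tab ms s0 mh h0 push mk' k01' e0' ap pb apt ptb es.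
have jmin : (jko a b tau chi rhoh etah rho eta <= jko a b tau chi rhoh etah f g)%E.
  exact: minimal.
have mI : measurable I by exact: measurable_itv.
have mJ : measurable J by exact: measurable_itv.
have mind : measurable_fun Om (\1_I : R -> R) by exact: measurable_indic.
have ind01 (x : R) : 0 <= (\1_I x : R) by rewrite indicE; case: (x \in I).
have meI : measurable_fun Om (fun x => e * \1_I x) by exact: measurable_funM.
have mseI : measurable_fun Om (fun x => s x - e * \1_I x) by exact: measurable_funB.
have seI0 (x : R) : a < x < b -> 0 <= s x - e * \1_I x.
  move=> xI; rewrite subr_ge0 indicE.
  by case: (boolP (x \in I)) => [/set_mem/es|_]; rewrite ?mulr1 ?mulr0 ?s0.
pose cost' (x : R) : R := (x - T x) ^+ 2 * (s x - e * \1_I x) + (x + t - T x) ^+ 2 * (e * \1_I x).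
have Wle : (W2sq a b f rhoh + W2sq a b g etah <= \int[mu]_(x in Om) (cost' x)%:E)%E.
  have mkT (u : R -> R) : measurable_fun Om u -> measurable_fun Om (u \o T).
    move=> mu'; apply: (measurable_comp mOm _ mu' mT) => _ [x xI <-].
    by move: xI; rewrite !OmE; exact: Tab.
  have part (u : R -> R) : measurable_fun Om u ->
      (forall x : R, a < x < b -> 0 <= u x <= 1) ->
      let A := fun x : R => (x - T x) ^+ 2 * (u (T x) * (s x - e * \1_I x)) in
      let A' := fun x : R => (x + t - T x) ^+ 2 * moved T u e p del x in
      [/\ measurable_fun Om (fun x => A x + A' x),
          forall x : R, a < x < b -> 0 <= A x + A' x &
          (\int[mu]_(x in Om) (A x)%:E + \int[mu]_(x in Om) (A' x)%:E =
           \int[mu]_(x in Om) (A x + A' x)%:E)%E].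
    move=> mu' u01 A A'.
    have mA : measurable_fun Om A.
      by apply: measurable_funM => //; apply: measurable_funM => //; exact: (mkT u mu').
    have mA' : measurable_fun Om A'.
      apply: measurable_funM => //; rewrite (_ : moved T u e p del = fun x => e * u (T x) * \1_I x).
        by apply: measurable_funM => //; apply: measurable_funM => //; exact: (mkT u mu').
      by apply/funext => x; rewrite /moved restrict_indicE.
    have A0 (x : R) : a < x < b -> 0 <= A x.
      by move=> xI; have /andP[? _] := u01 _ (Tab xI); apply: mulr_ge0; [exact: sqr_ge0|apply: mulr_ge0 => //; exact: seI0].
    have A'0 (x : R) : a < x < b -> 0 <= A' x.
      move=> xI; have /andP[? _] := u01 _ (Tab xI).
      rewrite /A' /moved restrict_indicE; apply: mulr_ge0; first exact: sqr_ge0.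
      by apply: mulr_ge0 => //; exact: mulr_ge0.
    split; first exact: measurable_funD.
      by move=> x xI; rewrite addr_ge0 ?A0 ?A'0.
    exact: ID.
  have [mA A0 AE] := part k mk k01; have [mA2 A20 A2E] := part _ mk' k01'.
  apply: le_trans (leeD Wf Wg) _; rewrite AE A2E (ID mA A0 mA2 A20).
  rewrite le_eqVlt; apply/orP; left; apply/eqP; apply: eq_integral => x _; congr EFin.
  by rewrite /cost' /moved !restrict_indicE; ring.
have mcost' : measurable_fun Om cost'.
  by apply: measurable_funD; apply: measurable_funM.
have costle : (\int[mu]_(x in Om) (cost' x)%:E <=
    \int[mu]_(x in Om) (cost x)%:E + ((e * B + 0) * del)%:E)%E.
  apply: (le_integral_perturb ab ap pb apt ptb (ltW del0) cost_int mcost' (m := 0)).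
    by move=> x xI; rewrite addr_ge0// mulr_ge0 ?sqr_ge0 ?seI0// mulr_ge0.
  move=> x xI; rewrite mul0r addr0 /cost' /cost -/I indicE.
  case: (boolP (x \in I)) => [/set_mem|_]; last by rewrite /= !mulr0 !addr0 subr0.
  rewrite /I /= in_itv /= => /TB Bx; rewrite !mulr1.
  have := ler_wpM2l e0' Bx; nra.
have ndchi := dchi_le chi_C2 chi_convex chi_lim0.
have grad := chi_subgradient chi_cont chi_C2 chi_convex chi_lim0.
pose s' (x : R) : R := s x - e * \1_I x + e * \1_J x.
have JE (x : R) : \1_I (x - t) = \1_J x :> R.
  rewrite !indicE; congr (_%:R); congr nat_of_bool.
  by apply/idP/idP; rewrite !inE /I /J /= !in_itv /= => /andP[? ?]; apply/andP; split; lra.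
have ms' : measurable_fun Om s'.
  have mJi : measurable_fun Om (\1_J : R -> R) by exact: measurable_indic.
  by apply: measurable_funD; [exact: mseI|exact: measurable_funM].
have s'0 (x : R) : a < x < b -> 0 <= s' x.
  move=> xI; have J0 : 0 <= (\1_J x : R) by rewrite indicE; case: (x \in J).
  by apply: addr_ge0; [exact: seI0|exact: mulr_ge0].
have enle : (\int[mu]_(x in Om) (chi (s' x))%:E <= \int[mu]_(x in Om) (chi (s x))%:E +
    ((- (e * dchi chi s1) + e * dchi chi s2) * del)%:E)%E.
  apply: (le_integral_perturb ab ap pb apt ptb (ltW del0) energy_int (mchi ms' s'0) (m := chi 0)).
    by move=> x xI; apply: chi0; exact: s'0.
  move=> x xI; rewrite /s' -/I -/J !indicE.
  case: (boolP (x \in I)) => [/set_mem|_].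
    rewrite /I /= in_itv /= => xI'; have se := sI x xI'.
    have -> : (x \in J) = false.
      apply/negP; rewrite inE /J /= in_itv /= => /andP[? ?]; case/andP: xI' => ? ?.
      by move: delt; rewrite ler_normr => /orP[]; lra.
    rewrite /= !mulr0 !addr0 !mulr1.
    have se0 : 0 <= s x - e by lra.
    have /andP[+ _] := grad (s x - e) (s x) se0 ltac:(lra).
    have : dchi chi s1 <= dchi chi (s x - e) by apply: ndchi; lra.
    rewrite -(ler_pM2r e0); rewrite opprB addrCA subrr addr0; lra.
  rewrite /= !mulr0 !addr0 subr0; case: (boolP (x \in J)) => [/set_mem|_]; last first.
    by rewrite /= !mulr0 !addr0.
  rewrite /J /= in_itv /= => xJ; have se := sJ x xJ; rewrite !mulr1.
  have sx0 := s0 xI; rewrite /= in sx0.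
  have /andP[_ gr] := grad (s x) (s x + e) sx0 ltac:(lra).
  have dd : dchi chi (s x + e) <= dchi chi s2 by apply: ndchi; lra.
  have ee : rho x + eta x + e - (rho x + eta x) = e by ring.
  rewrite /= ee in gr; have := ler_wpM2r e0' dd; lra.
have en_fg : energy a b chi f g = (\int[mu]_(x in Om) (chi (s' x))%:E)%E.
  apply: eq_integral => x /set_mem; rewrite OmE => xI; congr (chi _)%:E.
  rewrite /s' -JE; have := @transferred_sum R a b T s Tab k e p del t ap pb
    (fun x => 1 - k x) x xI (fun _ _ => erefl); exact.
have Cfin := @integrable_fin_num _ _ _ mu Om mOm _ cost_int.
have Efin := @integrable_fin_num _ _ _ mu Om mOm _ energy_int.
have tau2 : 0 <= (2 * tau)^-1 by rewrite invr_ge0 mulr_ge0// ltW.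
have lo : ((\int[mu]_(x in Om) (cost x)%:E) * ((2 * tau)^-1)%:E +
    \int[mu]_(x in Om) (chi (s x))%:E <= jko a b tau chi rhoh etah rho eta)%E.
  by rewrite /jko leeD2r// lee_wpmul2r ?lee_fin// cost_le_W2sq.
have hi : (jko a b tau chi rhoh etah f g <= (\int[mu]_(x in Om) (cost x)%:E +
    ((e * B + 0) * del)%:E) * ((2 * tau)^-1)%:E + (\int[mu]_(x in Om) (chi (s x))%:E +
    ((- (e * dchi chi s1) + e * dchi chi s2) * del)%:E))%E.
  rewrite /jko en_fg leeD// lee_wpmul2r ?lee_fin//; exact: le_trans Wle costle.
have := le_trans lo (le_trans jmin hi).
move: Cfin Efin => /=.
case: (\int[mu]_(x in Om) (cost x)%:E)%E => // C _.
case: (\int[mu]_(x in Om) (chi (s x))%:E)%E => // E _.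
rewrite -!EFinD -?EFinM -?EFinD lee_fin => fin.
have {}fin : 0 <= (e * del) * (dchi chi s2 + B * (2 * tau)^-1 - dchi chi s1) by lra.
move: fin; rewrite pmulr_rge0 ?mulr_gt0//; lra.
Qed.

End Minimiser.

Lemma last_crossing {R : realType} (f : R -> R) (L p q w : R) : p < q ->
  (forall x y, p <= x <= q -> p <= y <= q -> `|f x - f y| <= L * `|x - y|) ->
  f p <= w -> w < f q ->
  exists al, [/\ p <= al, al < q, f al <= w & forall z, al < z <= q -> w < f z].
Proof.
move=> pq lip fp fq.
pose S := [set z : R | p <= z <= q /\ f z <= w].
have Sp : S p by split => //; rewrite lexx ltW.
have Sub : has_ubound S by exists q => z [/andP[]].
have supS : has_sup S by split => //; exists p.
pose al := sup S.
have pal : p <= al by exact: ub_le_sup.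
have alq : al <= q by apply: ge_sup; [exists p|move=> z [/andP[]]].
have alI : p <= al <= q by rewrite pal alq.
have fal : f al <= w.
  apply/ler_addgt0Pr => e e0; pose d := e / (`|L| + 1).
  have L1 : 0 < `|L| + 1 by rewrite ltr_wpDl.
  have d0 : 0 < d by rewrite divr_gt0.
  have [z [zI fz] zal] := sup_adherent d0 supS.
  have zle : z <= al by exact: ub_le_sup.
  have := lip al z alI zI; rewrite [`|al - z|]ger0_norm ?subr_ge0// => lipz.
  have : L * (al - z) <= e.
    apply: (@le_trans _ _ ((`|L| + 1) * d)); last by rewrite /d mulrCA divff ?gt_eqF// mulr1.
    apply: (@le_trans _ _ ((`|L| + 1) * (al - z))).
      by rewrite ler_wpM2r ?subr_ge0// (le_trans (ler_norm L))// lerDl.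
    by rewrite ler_wpM2l ?ltW// ltrBlDr addrC -ltrBlDr.
  by have := ler_norm (f al - f z); lra.
exists al; split => //.
  by rewrite lt_neqAle alq andbT; apply: contraTneq fal => ->; rewrite -ltNge.
move=> z /andP[alz zq]; rewrite ltNge; apply/negP => fz.
have : z <= al.
  by apply: ub_le_sup => //; split => //; rewrite zq andbT (le_trans pal)// ltW.
by rewrite leNgt alz.
Qed.

Lemma first_crossing {R : realType} (f : R -> R) (L p q w : R) : p < q ->
  (forall x y, p <= x <= q -> p <= y <= q -> `|f x - f y| <= L * `|x - y|) ->
  w < f p -> f q <= w ->
  exists be, [/\ p < be, be <= q, f be <= w & forall z, p <= z < be -> w < f z].
Proof.
move=> pq lip fp fq; have [||||al [qal alp fal zal]] := @last_crossing R (f \o -%R) L (- q) (- p) w.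
- by rewrite ltrN2.
- move=> x y /andP[qx xp] /andP[qy yp] /=.
  have -> : `|x - y| = `|- x - - y| by rewrite opprK [- x + y]addrC distrC.
  apply: lip.
    by rewrite lerNr xp lerNl qx.
  by rewrite lerNr yp lerNl qy.
- by rewrite /= opprK.
- by rewrite /= opprK.
exists (- al); split => //.
- by rewrite ltrNr.
- by rewrite lerNl.
- move=> z /andP[pz zal']; rewrite -[z]opprK; apply: zal.
  by rewrite ltrNr zal' lerN2.
Qed.

Lemma at_right_dist {R : realType} (f : R -> R) (x e : R) : 0 < e ->
  f y @[y --> x^'+] --> f x ->
  exists2 del, 0 < del & forall z, x <= z < x + del -> `|f z - f x| < e.
Proof.
move=> e0 /cvgrPdist_lt/(_ e e0)/nbhs_ballP[del /= del0 H]; exists del => // z /andP[].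
rewrite le_eqVlt => /predU1P[<-|xz] zd; first by rewrite subrr normr0.
by rewrite distrC; apply: H => //; rewrite /ball /= distrC ger0_norm; lra.
Qed.

Section Comparison.
Context {R : realType}.
Variables (a b tau : R) (chi s T : R -> R).
Hypothesis ab : a < b.
Hypothesis tau0 : 0 < tau.
Hypothesis chi_C2 : forall x, 0 < x -> derivable chi x 1 /\ derivable (derive1 chi) x 1 /\
  {for x, continuous (derive1n 2 chi)}.
Hypothesis chi_convex : forall x, 0 < x -> 0 < derive1n 2 chi x.
Hypothesis chi_lim0 : derive1 chi h @[h --> 0^'+] --> 0.
Hypothesis s0 : forall x : R, a < x < b -> 0 <= s x.
Hypothesis s_rc : forall x : R, a < x < b -> s y @[y --> x^'+] --> s x.
Hypothesis Tnd : forall x y : R, a < x -> x <= y -> y < b -> T x <= T y.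
Hypothesis Tab : forall x : R, a < x < b -> a < T x < b.
Hypothesis transfer : forall e del p t s1 s2 B : R,
  0 < e -> 0 < del -> a < p -> p + del < b -> a < p + t -> p + t + del < b -> del <= `|t| ->
  0 <= s1 -> (forall x, p <= x < p + del -> s1 + e <= s x) ->
  (forall x, p + t <= x < p + t + del -> s x + e <= s2) ->
  (forall x, p <= x < p + del -> (x + t - T x) ^+ 2 - (x - T x) ^+ 2 <= B) ->
  dchi chi s1 <= dchi chi s2 + B / (2 * tau).

Let v (x : R) : R := dchi chi (s x).

Let local_bounds (x y e : R) : a < x < b -> a < y < b -> x != y -> 0 < s x -> 0 < e ->
  exists s1 s2 e' del : R, [/\ 0 <= s1, dchi chi (s x) - e < dchi chi s1,
    dchi chi s2 < dchi chi (s y) + e, 0 < e' & 0 < del] /\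
    [/\ x + del < b, y + del < b, del <= `|y - x|,
    forall z, x <= z < x + del -> s1 + e' <= s z &
    forall z, y <= z < y + del -> s z + e' <= s2].
Proof.
move=> xI yI xy sx e0.
have [s1 [s10 s1x ds1]] := dchi_approx_left chi_C2 sx e0.
have [s2 s2y ds2] := dchi_approx_right chi_C2 chi_lim0 (s0 yI) e0.
pose e' := Num.min ((s x - s1) / 2) ((s2 - s y) / 2).
have e'0 : 0 < e' by rewrite lt_min !divr_gt0// subr_gt0.
have e'1 : e' <= (s x - s1) / 2 by rewrite ge_min lexx.
have e'2 : e' <= (s2 - s y) / 2 by rewrite ge_min lexx orbT.
have [d1 d10 H1] := at_right_dist e'0 (s_rc xI).
have [d2 d20 H2] := at_right_dist e'0 (s_rc yI).
have /andP[ax xb] := xI; have /andP[ay yb] := yI.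
pose del := Num.min (Num.min d1 d2) (Num.min (`|y - x|) (Num.min ((b - x) / 2) ((b - y) / 2))).
have del0 : 0 < del.
  by rewrite !lt_min d10 d20 !divr_gt0 ?subr_gt0// normr_gt0 subr_eq0 eq_sym xy.
have : del <= del by []; rewrite {2}/del !le_min => /andP[/andP[dd1 dd2] /andP[dxy /andP[dx dy]]].
exists s1, s2, e', del; split; first by split => //; exact: ltW.
split => //; [lra|lra| |].
- move=> z /andP[xz zx]; have : `|s z - s x| < e' by apply: H1; rewrite xz (lt_le_trans zx)// lerD2l.
  by rewrite ltr_norml => /andP[? ?]; lra.
- move=> z /andP[yz zy]; have : `|s z - s y| < e' by apply: H2; rewrite yz (lt_le_trans zy)// lerD2l.
  by rewrite ltr_norml => /andP[? ?]; lra.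
Qed.

Let v_right (x y : R) : a < x -> x < y -> y < b -> 0 < s x ->
  v x <= v y + (y - x) * (y + x - 2 * T x) / (2 * tau).
Proof.
move=> ax xy yb sx; have tau0' := tau0.
have xI : a < x < b by rewrite ax (lt_trans xy).
have yI : a < y < b by rewrite yb (lt_trans ax).
apply/ler_addgt0Pr => e e0; have e3 : 0 < e / 3 by rewrite divr_gt0.
have [|s1 [s2 [e' [del [[s10 ds1 ds2 e'0 del0] [xd yd dxy sI sJ]]]]]] :=
  local_bounds xI yI _ sx e3; first by rewrite lt_eqF.
pose d := Num.min del (e / 3 * tau / (y - x)).
have yx : 0 < y - x by rewrite subr_gt0.
have d0 : 0 < d by rewrite lt_min del0 divr_gt0 ?mulr_gt0.
have : d <= d by []; rewrite {2}/d le_min => /andP[ddel de].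
have ee : (y - x) * d <= e / 3 * tau by rewrite mulrC -ler_pdivlMr.
have xyE : x + (y - x) = y by rewrite addrC subrK.
have tr : dchi chi s1 <= dchi chi s2 + (y - x) * (y + x + 2 * d - 2 * T x) / (2 * tau).
  apply: (@transfer e' d x (y - x)) => //; rewrite ?xyE//.
  - lra.
  - lra.
  - lra.
  - by rewrite (le_trans ddel).
  - by move=> z /andP[xz zd]; apply: sI; rewrite xz (lt_le_trans zd)// lerD2l.
  - by move=> z /andP[yz zd]; apply: sJ; rewrite yz (lt_le_trans zd)// lerD2l.
  - move=> z /andP[xz zd]; have Tz : T x <= T z by apply: Tnd => //; lra.
    rewrite (_ : _ - _ = (y - x) * (2 * z + (y - x) - 2 * T z)); last by ring.
    by rewrite ler_pM2l//; lra.
have : (y - x) * (y + x + 2 * d - 2 * T x) / (2 * tau) <=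
    (y - x) * (y + x - 2 * T x) / (2 * tau) + e / 3.
  rewrite -lerBlDl -mulrBl ler_pdivrMr ?mulr_gt0//; lra.
rewrite /v; lra.
Qed.

Let v_left' (y x' x : R) : a < y -> y < x' -> x' < x -> x < b -> 0 < s x' ->
  v x' <= v y + (x' - y) * (2 * T x - y - x') / (2 * tau).
Proof.
move=> ay yx' x'x xb sx; have tau0' := tau0.
have yI : a < y < b by rewrite ay (lt_trans yx')// (lt_trans x'x).
have x'I : a < x' < b by rewrite (lt_trans ay)// (lt_trans x'x).
apply/ler_addgt0Pr => e e0; have e3 : 0 < e / 3 by rewrite divr_gt0.
have [|s1 [s2 [e' [del [[s10 ds1 ds2 e'0 del0] [xd yd dxy sI sJ]]]]]] :=
  local_bounds x'I yI _ sx e3; first by rewrite gt_eqF.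
pose d := Num.min del (x - x').
have d0 : 0 < d by rewrite lt_min del0 subr_gt0.
have : d <= d by []; rewrite {2}/d le_min => /andP[ddel dx].
have xyE : x' + (y - x') = y by rewrite addrC subrK.
have tr : dchi chi s1 <= dchi chi s2 + (x' - y) * (2 * T x - y - x') / (2 * tau).
  apply: (@transfer e' d x' (y - x')) => //; rewrite ?xyE//.
  - lra.
  - lra.
  - lra.
  - by rewrite (le_trans ddel).
  - by move=> z /andP[xz zd]; apply: sI; rewrite xz (lt_le_trans zd)// lerD2l.
  - by move=> z /andP[yz zd]; apply: sJ; rewrite yz (lt_le_trans zd)// lerD2l.
  - move=> z /andP[xz zd]; have Tz : T z <= T x by apply: Tnd => //; lra.
    rewrite (_ : _ - _ = (x' - y) * (2 * T z - 2 * z + (x' - y))); last by ring.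
    by rewrite ler_pM2l ?subr_gt0//; lra.
rewrite /v; lra.
Qed.

Let L := (b - a) / tau.

Let v0 (x : R) : 0 <= v x.
Proof. exact: (dchi_ge0 chi_C2 chi_convex chi_lim0). Qed.

Let v_s0 (x : R) : a < x < b -> 0 < v x -> 0 < s x.
Proof.
move=> xI; rewrite /v /dchi; case: ifPn => // _; by rewrite ltxx.
Qed.

Let v_lip (x y : R) : a < x < b -> a < y < b -> `|v x - v y| <= L * `|x - y|.
Proof.
wlog xy : x y / x < y.
  move=> H xI yI; case: (ltgtP x y) => [xy|yx|->].
  - exact: H.
  - by rewrite distrC [`|x - y|]distrC; exact: H.
  - by rewrite !subrr !normr0 mulr0.
move=> xI yI; have /andP[ax xb] := xI; have /andP[ay yb] := yI; have tau0' := tau0.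
have xy0 : 0 < y - x by rewrite subr_gt0.
have key (c : R) : c <= 2 * (b - a) -> (y - x) * c / (2 * tau) <= L * (y - x).
  move=> cb; rewrite (_ : L * (y - x) = (y - x) * (2 * (b - a)) / (2 * tau)).
    by rewrite ler_pM2r ?invr_gt0 ?mulr_gt0// ler_pM2l.
  by rewrite /L; field; rewrite gt_eqF.
rewrite [`|x - y|]distrC [`|y - x|]gtr0_norm// ler_norml; apply/andP; split.
  have [sy|sy] := ltP 0 (s y); last first.
    have -> : v y = 0 by rewrite /v /dchi ltNge sy.
    have := v0 x; have : 0 <= L * (y - x).
      by rewrite mulr_ge0 ?divr_ge0 ?ltW// subr_gt0.
    lra.
  pose z := (y + b) / 2; have zI : a < z < b by rewrite /z; apply/andP; split; lra.
  have /andP[_ zb] := zI; have yz : y < z by rewrite /z; lra.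
  have := v_left' ax xy yz zb sy; have /andP[_ Tz] := Tab zI.
  have : (y - x) * (2 * T z - x - y) / (2 * tau) <= L * (y - x) by apply: key; lra.
  lra.
have [sx|sx] := ltP 0 (s x); last first.
  have -> : v x = 0 by rewrite /v /dchi ltNge sx.
  have := v0 y; have : 0 <= L * (y - x).
    by rewrite mulr_ge0 ?divr_ge0 ?ltW// subr_gt0.
  lra.
have := v_right ax xy yb sx; have /andP[Tx _] := Tab xI.
have : (y - x) * (y + x - 2 * T x) / (2 * tau) <= L * (y - x) by apply: key; lra.
lra.
Qed.

Let v_left (y x : R) : a < y -> y < x -> x < b -> 0 < v x ->
  v x <= v y + (x - y) * (2 * T x - y - x) / (2 * tau).
Proof.
move=> ay yx xb vx; have tau0' := tau0; have ab' := ab.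
have xI : a < x < b by rewrite xb (lt_trans ay).
have L0 : 0 < L by rewrite divr_gt0// subr_gt0.
apply/ler_addgt0Pr => e e0.
pose c := (L + (b - a) / tau) + 1.
have c0 : 0 < c by rewrite ltr_wpDl// addr_ge0 ?ltW// divr_gt0// subr_gt0.
pose d := Num.min ((x - y) / 2) (Num.min (e / c) (v x / L / 2)).
have d0 : 0 < d by rewrite !lt_min !divr_gt0// subr_gt0.
have : d <= d by []; rewrite {2}/d !le_min => /andP[dxy /andP[de dv]].
pose x' := x - d.
have yx' : y < x' by rewrite /x'; lra.
have x'x : x' < x by rewrite /x'; lra.
have x'I : a < x' < b by apply/andP; split; lra.
have := v_lip xI x'I; rewrite (_ : x - x' = d); last by rewrite /x'; ring.
rewrite (gtr0_norm d0) => lipd.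
have Ld : L * d < v x.
  apply: (@le_lt_trans _ _ (v x / 2)); last lra.
  by rewrite mulrC -ler_pdivlMr// mulrAC.
have vx' : 0 < v x' by have := ler_norm (v x - v x'); lra.
have := v_left' ay yx' x'x xb (v_s0 x'I vx').
have cd : c * d <= e by rewrite mulrC -ler_pdivlMr.
have /andP[Tx Tx'] := Tab xI.
have : (x' - y) * (2 * T x - y - x') / (2 * tau) <=
    (x - y) * (2 * T x - y - x) / (2 * tau) + (b - a) / tau * d.
  rewrite -lerBlDl -mulrBl ler_pdivrMr ?mulr_gt0//.
  rewrite (_ : (b - a) / tau * d * (2 * tau) = 2 * (b - a) * d); last by field; rewrite gt_eqF.
  rewrite /x'; nra.
have := ler_norm (v x - v x').
have : (b - a) / tau * d + L * d <= e by move: cd; rewrite /c; nra.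
lra.
Qed.

(* Euler-Lagrange condition: [v + x^2 / (2 tau)] has subgradient [T x / tau]
   wherever [v] is positive. *)
Lemma optimality : exists L : R, let v := fun x => dchi chi (s x) in
  [/\ forall x y : R, a < x < b -> a < y < b -> `|v x - v y| <= L * `|x - y|,
      forall x y : R, a < x -> x < y -> y < b -> 0 < v x ->
        v x <= v y + (y - x) * (y + x - 2 * T x) / (2 * tau) &
      forall y x : R, a < y -> y < x -> x < b -> 0 < v x ->
        v x <= v y + (x - y) * (2 * T x - y - x) / (2 * tau)].
Proof.
exists L; split => //.
move=> x y ax xy yb vx; apply: v_right => //; apply: v_s0 => //.
by rewrite ax (lt_trans xy).
Qed.

End Comparison.

(** * Extrema of the minimiser *)

Section Extrema.
Context {R : realType}.
Local Notation mu := (@lebesgue_measure R).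
Variables (a b tau L : R) (psi v s T h : R -> R).
Local Notation Om := (`]a, b[%classic).
Hypothesis ab : a < b.
Hypothesis tau0 : 0 < tau.
Hypothesis ms : measurable_fun Om s.
Hypothesis s0 : forall x : R, a < x < b -> 0 <= s x.
Hypothesis mh : measurable_fun Om h.
Hypothesis h0 : forall x : R, a < x < b -> 0 <= h x.
Hypothesis Tnd : forall x y : R, a < x -> x <= y -> y < b -> T x <= T y.
Hypothesis Tab : forall x : R, a < x < b -> a < T x < b.
Hypothesis push : forall B : set R, measurable B ->
  (\int[mu]_(x in Om `&` (T @^-1` B)) (s x)%:E = \int[mu]_(x in Om `&` B) (h x)%:E)%E.
Hypothesis v0 : forall x : R, a < x < b -> 0 <= v x.
Hypothesis psi_lt : forall x y : R, 0 <= x -> x < y -> psi x < psi y.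
Hypothesis vE : forall x : R, a < x < b -> v x = psi (s x).
Hypothesis v_lip : forall x y : R, a < x < b -> a < y < b -> `|v x - v y| <= L * `|x - y|.
Hypothesis v_right : forall x y : R, a < x -> x < y -> y < b -> 0 < v x ->
  v x <= v y + (y - x) * (y + x - 2 * T x) / (2 * tau).
Hypothesis v_left : forall y x : R, a < y -> y < x -> x < b -> 0 < v x ->
  v x <= v y + (x - y) * (2 * T x - y - x) / (2 * tau).

Let mOm : measurable Om. Proof. exact: measurable_itv. Qed.
Let OmE (x : R) : Om x = (a < x < b). Proof. by rewrite /= in_itv. Qed.

Let in_seg (p q z : R) : a < p -> q < b -> p <= z <= q -> a < z < b.
Proof. by move=> ap qb /andP[pz zq]; rewrite (lt_le_trans ap pz) (le_lt_trans zq qb). Qed.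

Lemma v_within_continuous (p q : R) : a < p -> q < b -> {within `[p, q], continuous v}.
Proof.
move=> ap qb; apply: continuous_in_subspaceT => x; rewrite inE /= in_itv /= => xpq.
have xI := in_seg ap qb xpq.
apply/cvgrPdist_lt => e e0.
have L1 : 0 < `|L| + 1 by rewrite ltr_wpDl.
near=> y.
have yI : a < y < b.
  by apply/andP; split; near: y; [apply: lt_nbhsr|apply: lt_nbhsl]; case/andP: xI.
apply: le_lt_trans (v_lip xI yI) _.
apply: (@le_lt_trans _ _ ((`|L| + 1) * `|x - y|)).
  by rewrite ler_wpM2r// (le_trans (ler_norm L))// lerDl.
rewrite mulrC -ltr_pdivlMr//; near: y.
apply/nbhs_ballP; exists (e / (`|L| + 1)); first by rewrite /= divr_gt0.
by move=> y.
Unshelve. all: by end_near. Qed.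

(* At a maximum point [x] of [v] minus a linear function of slope [c], the
   subgradient property forces [T x - x <= c tau]. *)
Lemma displacement_neg (al be : R) : a < al -> al < be -> be < b -> v be < v al ->
  exists x, [/\ al <= x, x < be & T x < x].
Proof.
move=> aal albe beb vlt; have tau0' := tau0.
pose c := (v be - v al) / (be - al).
have c0 : c < 0 by rewrite /c pmulr_llt0 ?subr_lt0// invr_gt0 subr_gt0.
have cE : c * (be - al) = v be - v al by rewrite /c divfK// gt_eqF ?subr_gt0.
have gc : {within `[al, be], continuous (fun x => v x - c * x)}.
  move=> x; apply: cvgB; first exact: v_within_continuous.
  exact: (continuous_subspaceT (@mulrl_continuous R c)).
have [x0 x0I x0max] := EVT_max (ltW albe) gc.
have [x [alx xbe xmax]] : exists x, [/\ al <= x, x < be &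
    forall z, al <= z <= be -> v z - c * z <= v x - c * x].
  move: x0I; rewrite in_itv /= => /andP[alx0]; rewrite le_eqVlt => /predU1P[x0be|x0be].
    exists al; split => // z zI; have := x0max z; rewrite in_itv /= zI x0be => /(_ isT); lra.
  by exists x0; split => // z zI; apply: x0max; rewrite in_itv.
exists x; split => //; rewrite ltNge; apply/negP => xT.
have vx : v be < v x.
  have := xmax al; rewrite lexx ltW// => /(_ isT); nra.
have beI : a < be < b by rewrite beb (lt_trans aal).
have vx0 : 0 < v x by exact: le_lt_trans (v0 beI) vx.
pose y := x + Num.min (be - x) (- c * tau).
have d0 : 0 < Num.min (be - x) (- c * tau) by rewrite lt_min subr_gt0 xbe mulr_gt0// oppr_gt0.
have : Num.min (be - x) (- c * tau) <= Num.min (be - x) (- c * tau) by [].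
rewrite le_min => /andP[dbe dc].
have xy : x < y by rewrite /y; lra.
have ybe : y <= be by rewrite /y; lra.
have := v_right (lt_le_trans aal alx) xy (le_lt_trans ybe beb) vx0.
have := xmax y; rewrite ybe (le_trans alx (ltW xy)) => /(_ isT) => vy vr.
have : (y - x) * (y + x - 2 * T x) / (2 * tau) <= (y - x) * (- c / 2).
  rewrite ler_pdivrMr ?mulr_gt0// -mulrA ler_pM2l ?subr_gt0//.
  by rewrite (_ : - c / 2 * (2 * tau) = - c * tau); [rewrite /y; lra|field].
have : 0 < (y - x) * - c by rewrite mulr_gt0 ?subr_gt0 ?oppr_gt0.
lra.
Qed.

Lemma displacement_pos (al be : R) : a < al -> al < be -> be < b -> v al < v be ->
  exists x, [/\ al < x, x <= be & x < T x].
Proof.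
move=> aal albe beb vlt; have tau0' := tau0.
pose c := (v be - v al) / (be - al).
have c0 : 0 < c by rewrite /c pmulr_lgt0 ?subr_gt0// invr_gt0 subr_gt0.
have cE : c * (be - al) = v be - v al by rewrite /c divfK// gt_eqF ?subr_gt0.
have gc : {within `[al, be], continuous (fun x => v x - c * x)}.
  move=> x; apply: cvgB; first exact: v_within_continuous.
  exact: (continuous_subspaceT (@mulrl_continuous R c)).
have [x0 x0I x0max] := EVT_max (ltW albe) gc.
have [x [alx xbe xmax]] : exists x, [/\ al < x, x <= be &
    forall z, al <= z <= be -> v z - c * z <= v x - c * x].
  move: x0I; rewrite in_itv /= => /andP[]; rewrite le_eqVlt => /predU1P[x0al|x0al] x0be.
    exists be; split => // z zI; have := x0max z; rewrite in_itv /= zI -x0al => /(_ isT); lra.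
  by exists x0; split => // z zI; apply: x0max; rewrite in_itv.
exists x; split => //; rewrite ltNge; apply/negP => xT.
have vx : v al < v x.
  have := xmax be; rewrite lexx ltW// => /(_ isT); nra.
have alI : a < al < b by rewrite aal (lt_trans albe).
have vx0 : 0 < v x by exact: le_lt_trans (v0 alI) vx.
pose y := x - Num.min (x - al) (c * tau).
have d0 : 0 < Num.min (x - al) (c * tau) by rewrite lt_min subr_gt0 alx mulr_gt0.
have : Num.min (x - al) (c * tau) <= Num.min (x - al) (c * tau) by [].
rewrite le_min => /andP[dal dc].
have yx : y < x by rewrite /y; lra.
have aly : al <= y by rewrite /y; lra.
have := v_left (lt_le_trans aal aly) yx (le_lt_trans xbe beb) vx0.
have := xmax y; rewrite aly (le_trans (ltW yx) xbe) => /(_ isT) => vy vl.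
have : (x - y) * (2 * T x - y - x) / (2 * tau) <= (x - y) * (c / 2).
  rewrite ler_pdivrMr ?mulr_gt0// -mulrA ler_pM2l ?subr_gt0//.
  by rewrite (_ : c / 2 * (2 * tau) = c * tau); [rewrite /y; lra|field].
have : 0 < (x - y) * c by rewrite mulr_gt0 ?subr_gt0.
lra.
Qed.

Definition Tb (x : R) : R := if x <= a then a else if b <= x then b else T x.

Lemma TbE (x : R) : a < x < b -> Tb x = T x.
Proof. by move=> /andP[ax xb]; rewrite /Tb !leNgt ax xb. Qed.

Lemma Tba : Tb a = a. Proof. by rewrite /Tb lexx. Qed.
Lemma Tbb : Tb b = b. Proof. by rewrite /Tb leNgt ab lexx. Qed.

Lemma Tb_ab (x : R) : a <= x <= b -> a <= Tb x <= b.
Proof.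
rewrite /Tb => /andP[ax xb]; case: (leP x a) => [_|ax']; first by rewrite lexx ltW.
case: (leP b x) => [_|xb']; first by rewrite lexx andbT ltW.
by have /andP[/ltW-> /ltW->] := Tab (introT andP (conj ax' xb')).
Qed.

Lemma Tb_nd (x y : R) : a <= x -> x <= y -> y <= b -> Tb x <= Tb y.
Proof.
move=> ax xy yb.
have yI : a <= y <= b by rewrite yb (le_trans ax).
have xI : a <= x <= b by rewrite ax (le_trans xy).
have /andP[ay' yb'] := Tb_ab yI; have /andP[ax' xb'] := Tb_ab xI.
have [xa|xa] := leP x a; first by rewrite /Tb xa -/(Tb y).
have [by_|by_] := leP b y.
  by have -> : y = b by [apply/eqP; rewrite eq_le yb by_]; rewrite Tbb.
rewrite !TbE ?Tnd// ?xa ?by_ ?andbT//; first exact: lt_le_trans xy.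
exact: le_lt_trans by_.
Qed.

Let lenE (b0 b1 : bool) (x y c : R) : x <= y ->
  (\int[mu]_(z in [set` Interval (BSide b0 x) (BSide b1 y)]) (cst c%:E z) = (c * (y - x))%:E)%E.
Proof.
move=> xy; rewrite integral_cst//= lebesgue_measure_itv /= lte_fin.
case: ltP => [_|yx]; first by rewrite -EFinB -EFinM.
by have -> : y = x by [apply/eqP; rewrite eq_le xy yx]; rewrite subrr mule0 mulr0.
Qed.

Let mE (f : R -> R) (A : set R) : measurable_fun Om f -> measurable A -> A `<=` Om ->
  measurable_fun A (EFin \o f).
Proof. by move=> mf mA AO; apply/measurable_EFinP; exact: measurable_funS mf. Qed.

Lemma mass_le (x x' c c' : R) : a <= x -> x <= x' -> x' <= b -> 0 <= c -> 0 <= c' ->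
  (forall z, x < z < x' -> c <= s z) ->
  (forall y, a < y < b -> Tb x <= y <= Tb x' -> h y <= c') ->
  c * (x' - x) <= c' * (Tb x' - Tb x).
Proof.
move=> ax xx' x'b c0 c'0 cs hc'.
have TT : Tb x <= Tb x' by exact: Tb_nd.
rewrite -lee_fin -(lenE false true c xx') -(lenE true false c' TT).
have sub : `]x, x'[%classic `<=` Om `&` T @^-1` `[Tb x, Tb x'].
  move=> z; rewrite /= !in_itv /= => /andP[xz zx'].
  have zI : a < z < b by rewrite (le_lt_trans ax) ?(lt_le_trans zx').
  split => //; rewrite -TbE//.
  by rewrite !Tb_nd ?(ltW xz) ?(ltW zx')//; case/andP: zI => /ltW ? /ltW.
have mTI : measurable (Om `&` T @^-1` `[Tb x, Tb x']).
  by apply: (nondecreasing_itv_measurable Tnd) => //; exact: measurable_itv.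
have mI : measurable (Om `&` `[Tb x, Tb x']) by apply: measurableI => //; exact: measurable_itv.
apply: (@le_trans _ _ (\int[mu]_(z in `]x, x'[) (s z)%:E)%E).
  by apply: ge0_le_integral => //; apply: mE => // z /sub[].
apply: (@le_trans _ _ (\int[mu]_(z in Om `&` T @^-1` `[Tb x, Tb x']) (s z)%:E)%E).
  apply: ge0_subset_integral => //.
  - by apply: mE => //; exact: subIsetl.
  - by move=> z []; rewrite OmE lee_fin => /s0.
rewrite push; last exact: measurable_itv.
apply: (@le_trans _ _ (\int[mu]_(z in Om `&` `[Tb x, Tb x']) (cst c'%:E z))%E).
  apply: ge0_le_integral => //.
  - by move=> z []; rewrite OmE lee_fin => /h0.
  - by apply: mE => //; exact: subIsetl.
  - by move=> z []; rewrite OmE /= in_itv /= lee_fin; exact: hc'.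
by apply: ge0_subset_integral.
Qed.

Lemma mass_ge (x x' c c' : R) : a <= x -> x <= x' -> x' <= b -> 0 <= c -> 0 <= c' ->
  (forall z, x < z < x' -> s z <= c) ->
  (forall y, a < y < b -> Tb x <= y <= Tb x' -> c' <= h y) ->
  c' * (Tb x' - Tb x) <= c * (x' - x).
Proof.
move=> ax xx' x'b c0 c'0 sc hc'.
have xI : a <= x <= b by rewrite ax (le_trans xx').
have x'I : a <= x' <= b by rewrite x'b (le_trans ax).
have /andP[aT _] := Tb_ab xI; have /andP[_ Tb'] := Tb_ab x'I.
have TT : Tb x <= Tb x' by exact: Tb_nd.
rewrite -lee_fin -(lenE false true c xx') -(lenE false true c' TT).
have sub : Om `&` T @^-1` `]Tb x, Tb x'[ `<=` `]x, x'[%classic.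
  move=> z []; rewrite OmE /= !in_itv /= => zI; rewrite -TbE// => /andP[xT Tx'].
  have /andP[/ltW az /ltW zb] := zI.
  have /andP[_ xb] := xI; have /andP[ax' _] := x'I.
  apply/andP; split; rewrite ltNge; apply/negP => le.
    by move: xT; rewrite ltNge Tb_nd.
  by move: Tx'; rewrite ltNge Tb_nd.
have xxO : `]x, x'[%classic `<=` Om.
  by move=> z; rewrite OmE /= in_itv /= => /andP[xz zx]; rewrite (le_lt_trans ax) ?(lt_le_trans zx).
have TTO : `]Tb x, Tb x'[%classic `<=` Om.
  by move=> z; rewrite OmE /= in_itv /= => /andP[xz zx]; rewrite (le_lt_trans aT) ?(lt_le_trans zx).
have mTI : measurable (Om `&` T @^-1` `]Tb x, Tb x'[).
  by apply: (nondecreasing_itv_measurable Tnd) => //; exact: measurable_itv.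
apply: (@le_trans _ _ (\int[mu]_(z in `]Tb x, Tb x'[) (h z)%:E)%E).
  apply: ge0_le_integral => //.
  - exact: mE.
  - move=> z zT; have := TTO z zT; rewrite OmE => zI.
    by move: zT; rewrite /= in_itv /= => /andP[/ltW ? /ltW ?]; rewrite lee_fin hc'//; apply/andP.
have -> : (\int[mu]_(z in `]Tb x, Tb x'[) (h z)%:E =
    \int[mu]_(z in Om `&` T @^-1` `]Tb x, Tb x'[) (s z)%:E)%E.
  by rewrite push; [rewrite (setIidr TTO)|exact: measurable_itv].
apply: (@le_trans _ _ (\int[mu]_(z in `]x, x'[) (s z)%:E)%E).
  by apply: ge0_subset_integral => //; (exact: mE || (move=> z /xxO; rewrite OmE lee_fin => /s0)).
by apply: ge0_le_integral => //; (exact: mE || (move=> z /xxO; rewrite OmE lee_fin => /s0)).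
Qed.

Let v_seg_lip (p q : R) : a < p -> q < b -> forall x y : R, p <= x <= q -> p <= y <= q ->
  `|v x - v y| <= L * `|x - y|.
Proof. by move=> ap qb x y xI yI; apply: v_lip; exact: in_seg ap qb _. Qed.

Lemma level_max_left (p x0 w : R) : a <= p -> p < x0 -> x0 < b ->
  (a < p -> v p < w) -> w < v x0 ->
  exists x : R, [/\ p <= x, x <= x0, x <= Tb x, forall z, x < z <= x0 -> w <= v z &
    x = x0 -> x0 < T x0].
Proof.
move=> ap px0 x0b vp vx0.
have core p' : a < p' -> p' < x0 -> v p' < w ->
    exists x : R, [/\ p' <= x, x <= x0, x <= Tb x, forall z, x < z <= x0 -> w <= v z &
      x = x0 -> x0 < T x0].
  move=> ap' p'x0 vp'.
  have [al [p'al alx0 val zal]] := last_crossing p'x0 (v_seg_lip ap' x0b) (ltW vp') vx0.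
  have aal := lt_le_trans ap' p'al.
  have [x [alx xx0 xT]] := displacement_pos aal alx0 x0b (le_lt_trans val vx0).
  have xI : a < x < b by rewrite (lt_trans aal alx) (le_lt_trans xx0).
  exists x; split => //.
  - exact: le_trans p'al (ltW alx).
  - by rewrite TbE// ltW.
  - by move=> z /andP[xz zx0]; apply/ltW/zal; rewrite zx0 (lt_trans alx).
  - by move=> <-.
move: ap; rewrite le_eqVlt => /predU1P[ap|ap]; last exact: core (vp ap).
have [[p' [ap' p'x0 vp']]|none] := pselect (exists p', [/\ a < p', p' < x0 & v p' < w]).
  have [x [p'x ? ? ? ?]] := core p' ap' p'x0 vp'; exists x; split => //.
  by rewrite -ap (le_trans (ltW ap')).
exists p; split => //; rewrite -?ap ?Tba//; first by rewrite ap ltW.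
  move=> z /andP[az]; rewrite le_eqVlt => /predU1P[->|zx0]; first exact: ltW.
  by rewrite leNgt; apply/negP => vz; apply: none; exists z.
by move=> ax0; move: px0; rewrite -ap ax0 ltxx.
Qed.

Lemma level_max_right (x0 q w : R) : a < x0 -> x0 < q -> q <= b ->
  (q < b -> v q < w) -> w < v x0 ->
  exists x : R, [/\ x0 <= x, x <= q, Tb x <= x, forall z, x0 <= z < x -> w <= v z &
    x = x0 -> T x0 < x0].
Proof.
move=> ax0 x0q qb vq vx0.
have core q' : x0 < q' -> q' < b -> v q' < w ->
    exists x : R, [/\ x0 <= x, x <= q', Tb x <= x, forall z, x0 <= z < x -> w <= v z &
      x = x0 -> T x0 < x0].
  move=> x0q' q'b vq'.
  have [be [x0be beq' vbe zbe]] := first_crossing x0q' (v_seg_lip ax0 q'b) vx0 (ltW vq').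
  have beb := le_lt_trans beq' q'b.
  have [x [x0x xbe xT]] := displacement_neg ax0 x0be beb (le_lt_trans vbe vx0).
  have xI : a < x < b by rewrite (lt_le_trans ax0 x0x) (lt_trans xbe).
  exists x; split => //.
  - exact: le_trans (ltW xbe) beq'.
  - by rewrite TbE// ltW.
  - by move=> z /andP[x0z zx]; apply/ltW/zbe; rewrite x0z (lt_trans zx).
  - by move=> <-.
move: qb; rewrite le_eqVlt => /predU1P[qb|qb]; last exact: core (vq qb).
have [[q' [x0q' q'b vq']]|none] := pselect (exists q', [/\ x0 < q', q' < b & v q' < w]).
  have [x [? xq' ? ? ?]] := core q' x0q' q'b vq'; exists x; split => //.
  by rewrite qb (le_trans xq' (ltW q'b)).
exists q; split => //; first exact: ltW.
- by rewrite qb Tbb.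
- move=> z /andP[]; rewrite le_eqVlt => /predU1P[<- _|x0z zq]; first exact: ltW.
  by rewrite leNgt; apply/negP => vz; apply: none; exists z; split => //; rewrite -qb.
- by move=> qx0; move: x0q; rewrite qx0 ltxx.
Qed.

Lemma level_min_left (p x0 w : R) : a <= p -> p < x0 -> x0 < b ->
  (a < p -> w < v p) -> v x0 < w ->
  exists x : R, [/\ p <= x, x < x0, Tb x <= x & forall z, x < z <= x0 -> v z <= w].
Proof.
move=> ap px0 x0b vp vx0.
have core p' : a < p' -> p' < x0 -> w < v p' ->
    exists x : R, [/\ p' <= x, x < x0, Tb x <= x & forall z, x < z <= x0 -> v z <= w].
  move=> ap' p'x0 vp'.
  have [|||al [p'al alx0 val zal]] := @last_crossing R (fun x => - v x) L p' x0 (- w) p'x0.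
  - move=> x y xI yI; rewrite -opprD normrN; exact: (v_seg_lip ap' x0b).
  - by rewrite lerN2 ltW.
  - by rewrite ltrN2.
  have aal := lt_le_trans ap' p'al; rewrite lerN2 in val.
  have [x [alx xx0 xT]] := displacement_neg aal alx0 x0b (lt_le_trans vx0 val).
  have xI : a < x < b by rewrite (lt_le_trans aal alx) (lt_trans xx0).
  exists x; split => //.
  - exact: le_trans p'al alx.
  - by rewrite TbE// ltW.
  - by move=> z /andP[xz zx0]; rewrite -lerN2; apply/ltW/zal; rewrite zx0 (le_lt_trans alx).
move: ap; rewrite le_eqVlt => /predU1P[ap|ap]; last exact: core (vp ap).
have [[p' [ap' p'x0 vp']]|none] := pselect (exists p', [/\ a < p', p' < x0 & w < v p']).
  have [x [p'x ? ? ?]] := core p' ap' p'x0 vp'; exists x; split => //.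
  by rewrite -ap (le_trans (ltW ap')).
exists p; split => //; first by rewrite -ap Tba.
move=> z /andP[pz]; rewrite le_eqVlt => /predU1P[->|zx0]; first exact: ltW.
by rewrite leNgt; apply/negP => vz; apply: none; exists z; split => //; rewrite ap.
Qed.

Lemma level_min_right (x0 q w : R) : a < x0 -> x0 < q -> q <= b ->
  (q < b -> w < v q) -> v x0 < w ->
  exists x : R, [/\ x0 < x, x <= q, x <= Tb x & forall z, x0 <= z < x -> v z <= w].
Proof.
move=> ax0 x0q qb vq vx0.
have core q' : x0 < q' -> q' < b -> w < v q' ->
    exists x : R, [/\ x0 < x, x <= q', x <= Tb x & forall z, x0 <= z < x -> v z <= w].
  move=> x0q' q'b vq'.
  have [|||be [x0be beq' vbe zbe]] := @first_crossing R (fun x => - v x) L x0 q' (- w) x0q'.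
  - move=> x y xI yI; rewrite -opprD normrN; exact: (v_seg_lip ax0 q'b).
  - by rewrite ltrN2.
  - by rewrite lerN2 ltW.
  have beb := le_lt_trans beq' q'b; rewrite lerN2 in vbe.
  have [x [x0x xbe xT]] := displacement_pos ax0 x0be beb (lt_le_trans vx0 vbe).
  have xI : a < x < b by rewrite (lt_trans ax0 x0x) (le_lt_trans xbe).
  exists x; split => //.
  - exact: le_trans xbe beq'.
  - by rewrite TbE// ltW.
  - by move=> z /andP[x0z zx]; rewrite -lerN2; apply/ltW/zbe; rewrite x0z (lt_le_trans zx).
move: qb; rewrite le_eqVlt => /predU1P[qb|qb]; last exact: core (vq qb).
have [[q' [x0q' q'b vq']]|none] := pselect (exists q', [/\ x0 < q', q' < b & w < v q']).
  have [x [? xq' ? ?]] := core q' x0q' q'b vq'; exists x; split => //.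
  by rewrite qb (le_trans xq' (ltW q'b)).
exists q; split => //; first by rewrite qb Tbb.
move=> z /andP[]; rewrite le_eqVlt => /predU1P[<- _|x0z zq]; first exact: ltW.
by rewrite leNgt; apply/negP => vz; apply: none; exists z; split => //; rewrite -qb.
Qed.

Let psi_le (x y : R) : 0 <= x -> psi x <= psi y -> 0 <= y -> x <= y.
Proof.
move=> x0 pxy y0; rewrite leNgt; apply/negP => yx.
by move: pxy; rewrite leNgt psi_lt.
Qed.

Lemma max_of_target (p x0 q c : R) : a <= p -> p < x0 -> x0 < q -> q <= b ->
  (a < p -> s p < s x0) -> (q < b -> s q < s x0) -> c < s x0 ->
  exists y : R, [/\ a < y < b, Tb p <= y <= Tb q & c < h y].
Proof.
move=> ap px0 x0q qb sp sq cs.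
have ax0 := le_lt_trans ap px0; have x0b := lt_le_trans x0q qb.
have x0I : a < x0 < b by rewrite ax0 x0b.
apply: contrapT => none.
have hc y : a < y < b -> Tb p <= y <= Tb q -> h y <= c.
  by move=> yI yT; rewrite leNgt; apply/negP => cy; apply: none; exists y.
have c0 : 0 <= c.
  apply: le_trans (h0 (Tab x0I)) (hc _ (Tab x0I) _).
  by rewrite -TbE// !Tb_nd// ltW.
have [s1 [s1x cs1 sps1 sqs1]] : exists s1 : R, [/\ s1 < s x0, c < s1,
    a < p -> s p < s1 & q < b -> s q < s1].
  pose m := Num.max c (Num.max (if a < p then s p else c) (if q < b then s q else c)).
  have mlt : m < s x0.
    by rewrite !gt_max cs /=; case: (ltP a p) => [/sp->|_]; case: (ltP q b) => [/sq->|_] //=;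
      rewrite ?cs.
  have : m <= m by []; rewrite {1}/m !ge_max => /andP[cm /andP[pm qm]].
  exists ((m + s x0) / 2); split; [lra|lra| |].
    by move=> ap'; move: pm; rewrite ap' => ?; lra.
  by move=> qb'; move: qm; rewrite qb' => ?; lra.
have s10 : 0 <= s1 by exact: le_trans c0 (ltW cs1).
have pI : a < p -> a < p < b by move=> ->; rewrite (lt_trans px0).
have qI : q < b -> a < q < b by move=> ->; rewrite (lt_trans ax0).
have [|| x [px xx0 xT zx xs]] := @level_max_left p x0 (psi s1) ap px0 x0b.
- by move=> ap'; rewrite vE ?pI// psi_lt ?s0 ?pI ?sps1.
- by rewrite vE// psi_lt.
have [|| x' [x0x' x'q x'T zx' x's]] := @level_max_right x0 q (psi s1) ax0 x0q qb.
- by move=> qb'; rewrite vE ?qI// psi_lt ?s0 ?qI ?sqs1.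
- by rewrite vE// psi_lt.
have xx' : x < x'.
  rewrite lt_neqAle (le_trans xx0 x0x') andbT; apply/eqP => xx'.
  have xE : x = x0 by apply/eqP; rewrite eq_le xx0 xx' x0x'.
  by have := lt_trans (xs xE) (x's (etrans (esym xx') xE)); rewrite ltxx.
have ax := le_trans ap px; have x'b := le_trans x'q qb.
have ax' := le_trans ax (ltW xx'); have xb := le_trans (ltW xx') x'b.
have := @mass_le x x' s1 c ax (ltW xx') x'b s10 c0.
have /[swap] /[apply] : forall z, x < z < x' -> s1 <= s z.
  move=> z /andP[xz zx'']; have zI : a < z < b by rewrite (le_lt_trans ax xz) (lt_le_trans zx'').
  apply: psi_le => //; last exact: s0.
  rewrite -vE//; case: (leP z x0) => [zx0|/ltW x0z]; first by apply: zx; rewrite xz.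
  by apply: zx'; rewrite x0z.
have /[swap] /[apply] : forall y, a < y < b -> Tb x <= y <= Tb x' -> h y <= c.
  move=> y yI /andP[xy yx']; apply: hc => //.
  by rewrite (le_trans (Tb_nd ap px xb) xy) (le_trans yx')// Tb_nd.
have : c * (Tb x' - Tb x) <= c * (x' - x) by rewrite ler_wpM2l//; lra.
have : c * (x' - x) < s1 * (x' - x) by rewrite ltr_pM2r// subr_gt0.
lra.
Qed.

Lemma min_of_target (p x0 q c : R) : a <= p -> p < x0 -> x0 < q -> q <= b ->
  (a < p -> s x0 < s p) -> (q < b -> s x0 < s q) -> s x0 < c ->
  exists y : R, [/\ a < y < b, Tb p <= y <= Tb q & h y < c].
Proof.
move=> ap px0 x0q qb sp sq cs.
have ax0 := le_lt_trans ap px0; have x0b := lt_le_trans x0q qb.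
have x0I : a < x0 < b by rewrite ax0 x0b.
apply: contrapT => none.
have hc y : a < y < b -> Tb p <= y <= Tb q -> c <= h y.
  by move=> yI yT; rewrite leNgt; apply/negP => cy; apply: none; exists y.
have c0 : 0 <= c by exact: le_trans (s0 x0I) (ltW cs).
have [s1 [s1x cs1 sps1 sqs1]] : exists s1 : R, [/\ s x0 < s1, s1 < c,
    a < p -> s1 < s p & q < b -> s1 < s q].
  pose m := Num.min c (Num.min (if a < p then s p else c) (if q < b then s q else c)).
  have mlt : s x0 < m.
    by rewrite !lt_min cs /=; case: (ltP a p) => [/sp->|_]; case: (ltP q b) => [/sq->|_] //=;
      rewrite ?cs.
  have : m <= m by []; rewrite {2}/m !le_min => /andP[cm /andP[pm qm]].
  exists ((m + s x0) / 2); split; [lra|lra| |].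
    by move=> ap'; move: pm; rewrite ap' => ?; lra.
  by move=> qb'; move: qm; rewrite qb' => ?; lra.
have s10 : 0 <= s1 by exact: le_trans (s0 x0I) (ltW s1x).
have pI : a < p -> a < p < b by move=> ->; rewrite (lt_trans px0).
have qI : q < b -> a < q < b by move=> ->; rewrite (lt_trans ax0).
have [|| x [px xx0 xT zx]] := @level_min_left p x0 (psi s1) ap px0 x0b.
- by move=> ap'; rewrite vE ?pI// psi_lt ?sps1.
- by rewrite vE// psi_lt ?s0.
have [|| x' [x0x' x'q x'T zx']] := @level_min_right x0 q (psi s1) ax0 x0q qb.
- by move=> qb'; rewrite vE ?qI// psi_lt ?sqs1.
- by rewrite vE// psi_lt ?s0.
have xx' : x < x' by exact: lt_trans xx0 x0x'.
have ax := le_trans ap px; have x'b := le_trans x'q qb.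
have xb := le_trans (ltW xx') x'b.
have := @mass_ge x x' s1 c ax (ltW xx') x'b s10 c0.
have /[swap] /[apply] : forall z, x < z < x' -> s z <= s1.
  move=> z /andP[xz zx'']; have zI : a < z < b by rewrite (le_lt_trans ax xz) (lt_le_trans zx'').
  apply: psi_le => //; first exact: s0.
  rewrite -vE//; case: (leP z x0) => [zx0|/ltW x0z]; first by apply: zx; rewrite xz.
  by apply: zx'; rewrite x0z.
have /[swap] /[apply] : forall y, a < y < b -> Tb x <= y <= Tb x' -> c <= h y.
  move=> y yI /andP[xy yx']; apply: hc => //.
  by rewrite (le_trans (Tb_nd ap px xb) xy) (le_trans yx')// Tb_nd// (le_trans ax)// ltW.
have xTx : x' - x <= Tb x' - Tb x by lra.
have : s1 * (x' - x) <= s1 * (Tb x' - Tb x) by rewrite ler_wpM2l.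
have : s1 * (Tb x' - Tb x) < c * (Tb x' - Tb x).
  by rewrite ltr_pM2r// (lt_le_trans _ xTx)// subr_gt0.
lra.
Qed.

Lemma target_bound (M : R) : (forall y, a < y < b -> h y <= M) ->
  forall x, a < x < b -> s x <= M.
Proof.
move=> hM x /andP[ax xb]; rewrite leNgt; apply/negP => Ms.
have [||y [yI _]] := @max_of_target a x b M (lexx a) ax xb (lexx b) _ _ Ms.
- by rewrite ltxx.
- by rewrite ltxx.
by rewrite ltNge hM.
Qed.

Let separator (x y : R) : a < x -> x < y -> y < b -> s x != s y ->
  exists c : R, [/\ x < c, c < y, s x < s y -> s x < s c < s y & s y < s x -> s y < s c < s x].
Proof.
move=> ax xy yb sxy.
have xI : a < x < b by rewrite ax (lt_trans xy).
have yI : a < y < b by rewrite yb (lt_trans ax).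
have s_of_v u w : a < u < b -> a < w < b -> v u < v w -> s u < s w.
  move=> uI wI; rewrite !vE// => uw; rewrite ltNge; apply/negP; rewrite le_eqVlt => /predU1P[wu|wu].
    by move: uw; rewrite wu ltxx.
  by move: uw; rewrite ltNge ltW// psi_lt// s0.
have v_of_s u w : a < u < b -> a < w < b -> s u < s w -> v u < v w.
  by move=> uI wI uw; rewrite !vE// psi_lt// s0.
have vxy : v x != v y.
  by move: sxy; rewrite !neq_lt => /orP[] /v_of_s ->; rewrite ?orbT.
have [||c cI vc] := @IVT R v x y ((v x + v y) / 2) (ltW xy).
- exact: v_within_continuous.
- by rewrite ge_min le_max; case: (leP (v x) (v y)) => ?; apply/andP; split; apply/orP;
    (left; lra) || (right; lra).
rewrite in_itv /= in cI; have /andP[xc cy] := cI.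
have cx : c != x by apply: contraNneq vxy => cx; rewrite cx in vc; apply/eqP; lra.
have cy' : c != y by apply: contraNneq vxy => cy'; rewrite cy' in vc; apply/eqP; lra.
have cI' := in_seg ax yb cI.
exists c; split.
- by rewrite lt_neqAle eq_sym cx.
- by rewrite lt_neqAle cy'.
- by move=> /v_of_s vxy'; rewrite !s_of_v//; have := vxy' xI yI; lra.
- by move=> /v_of_s vxy'; rewrite !s_of_v//; have := vxy' yI xI; lra.
Qed.

Let abel_sum (g d : nat -> R) (m : nat) :
  \sum_(i < m.+1) g i * (d i.+1 - d i) =
  - g 0%N * d 0%N + \sum_(i < m) (g i - g i.+1) * d i.+1 + g m * d m.+1.
Proof.
elim: m => [|m IH]; first by rewrite big_ord_recr !big_ord0 /=; ring.
by rewrite big_ord_recr /= IH [in RHS]big_ord_recr /=; ring.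
Qed.

(* With alternating signs [g], summation by parts turns the variation of [s]
   into a sum over its strict local extrema, each of which is dominated by a
   value of [h]. *)
Lemma target_variation (V : R) : var_le a b h V -> var_le a b s V.
Proof.
move=> hV n x xab xle.
have [[|m] [y [yab yd _ _ ->]]] := distinct_values_subseq s xab xle.
  by rewrite big_ord0; exact: var_le_ge0 hV.
have sepP (i : nat) : exists c : R, (i < m.+1)%N ->
    [/\ y i < c, c < y i.+1, s (y i) < s (y i.+1) -> s (y i) < s c < s (y i.+1) &
        s (y i.+1) < s (y i) -> s (y i.+1) < s c < s (y i)].
  case: (ltnP i m.+1) => [im|_]; last by exists 0.
  have [yi syi] := yd i im; have /andP[ayi _] := yab i (ltnW im); have /andP[_ yib] := yab i.+1 im.
  by have [c cP] := separator ayi yi yib syi; exists c.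
have [c cP] := choice sepP.
pose pl i := if i is j.+1 then c j else a.
pose pr i := if (i < m.+1)%N then c i else b.
have cab i : (i < m.+1)%N -> a < c i < b.
  move=> im; have [yc cy _ _] := cP i im; have /andP[ayi _] := yab i (ltnW im).
  by have /andP[_ yib] := yab i.+1 im; rewrite (lt_trans ayi yc) (lt_trans cy).
have plP i : (i <= m.+1)%N -> a <= pl i /\ pl i < y i.
  case: i => [|i] im /=; first by have /andP[? _] := yab 0%N isT.
  by have [_ ? _ _] := cP i im; have /andP[/ltW ? _] := cab i im.
have prP i : (i <= m.+1)%N -> pr i <= b /\ y i < pr i.
  move=> im; rewrite /pr; case: ifPn => [im'|_]; last by have /andP[] := yab i im.
  by have [? _ _ _] := cP i im'; have /andP[_ /ltW] := cab i im'.
apply/ler_addgt0Pr => e0 e00; pose e := e0 / (m.+1)%:R / 2.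
have e_gt0 : 0 < e by rewrite !divr_gt0// ltr0n.
pose is_max i := (forall j, i = j.+1 -> s (y j) < s (y i)) /\
  ((i < m.+1)%N -> s (y i.+1) < s (y i)).
pose is_min i := (forall j, i = j.+1 -> s (y i) < s (y j)) /\
  ((i < m.+1)%N -> s (y i) < s (y i.+1)).
have notboth i : (i <= m.+1)%N -> is_max i -> is_min i -> False.
  case: i => [|i] im [max1 max2] [min1 min2].
    by have := lt_trans (max2 isT) (min2 isT); rewrite ltxx.
  by have := lt_trans (max1 i erefl) (min1 i erefl); rewrite ltxx.
have zP (i : nat) : exists z : R, (i <= m.+1)%N ->
    [/\ a < z < b, Tb (pl i) <= z <= Tb (pr i), is_max i -> s (y i) - e < h z &
        is_min i -> h z < s (y i) + e].
  case: (leqP i m.+1) => [im|_]; last by exists 0.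
  have [apl ply] := plP i im; have [prb ypr] := prP i im.
  have [imax|nmax] := pselect (is_max i).
    have [|||z [zI zT hz]] := @max_of_target (pl i) (y i) (pr i) (s (y i) - e) apl ply ypr prb.
    - case: i im imax {apl ply prb ypr} => [|i] im [max1 _] /=; first by rewrite ltxx.
      by have [_ _ up _] := cP i im; have /andP[] := up (max1 i erefl).
    - case: imax => _ max2; rewrite /pr; case: ifPn => [im'|_]; last by rewrite ltxx.
      by have [_ _ _ dn] := cP i im'; have /andP[] := dn (max2 im').
    - by rewrite gtrBl.
    by exists z => _; split => // imin; have := notboth i im imax imin.
  have [imin|nmin] := pselect (is_min i).
    have [|||z [zI zT hz]] := @min_of_target (pl i) (y i) (pr i) (s (y i) + e) apl ply ypr prb.
    - case: i im imin {apl ply prb ypr nmax} => [|i] im [min1 _] /=; first by rewrite ltxx.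
      by have [_ _ _ dn] := cP i im; have /andP[] := dn (min1 i erefl).
    - case: imin => _ min2; rewrite /pr; case: ifPn => [im'|_]; last by rewrite ltxx.
      by have [_ _ up _] := cP i im'; have /andP[] := up (min2 im').
    - by rewrite ltrDl.
    by exists z.
  have yI := yab i im; have /andP[ayi yib] := yI.
  exists (T (y i)) => _; split => //; first exact: Tab.
  by rewrite -TbE// !Tb_nd// ltW.
have [z zP'] := choice zP.
pose g i : R := if s (y i) < s (y i.+1) then 1 else -1.
have ndn i : (i < m.+1)%N -> (s (y i) < s (y i.+1)) = false -> s (y i.+1) < s (y i).
  by move=> im /negbT; rewrite -leNgt lt_neqAle => ->; have [_] := yd i im; rewrite eq_sym andbT.
pose d i := s (y i) - h (z i).
have zle i : (i < m.+1)%N -> z i <= z i.+1.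
  move=> im; have [_ /andP[_ zi] _ _] := zP' i (ltnW im).
  have [_ /andP[zi' _] _ _] := zP' i.+1 im.
  by apply: le_trans zi _; rewrite /pr im.
have hsum := hV m.+1 z (fun i im => let: And4 zI _ _ _ := zP' i im in zI) zle.
have sumE : \sum_(i < m.+1) `|s (y i.+1) - s (y i)| <=
    \sum_(i < m.+1) `|h (z i.+1) - h (z i)| + \sum_(i < m.+1) g i * (d i.+1 - d i).
  rewrite -big_split /=; apply: ler_sum => i _.
  have -> : `|s (y i.+1) - s (y i)| = g i * (s (y i.+1) - s (y i)).
    rewrite /g; case: ifPn => [up|/negbTE/(ndn i (ltn_ord i)) dn].
      by rewrite mul1r gtr0_norm// subr_gt0.
    by rewrite mulN1r ltr0_norm// subr_lt0.
  have : g i * (h (z i.+1) - h (z i)) <= `|h (z i.+1) - h (z i)|.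
    rewrite /g; case: ifPn => _; first by rewrite mul1r ler_norm.
    by rewrite mulN1r -normrN ler_norm.
  rewrite /d; lra.
apply: le_trans sumE _; apply: lerD hsum _; rewrite abel_sum.
have t0 : - g 0%N * d 0%N <= e.
  have [_ _ mx mn] := zP' 0%N isT; rewrite /d /g; case: ifPn => [up|/negbTE/(ndn 0%N isT) dn].
    have : is_min 0%N by [].
    by move=> /mn; lra.
  have : is_max 0%N by [].
  by move=> /mx; lra.
have t1 (i : 'I_m) : (g i - g i.+1) * d i.+1 <= 2 * e.
  have im : (i < m.+1)%N by rewrite ltnS ltnW.
  have im' : (i.+1 < m.+1)%N by rewrite ltnS.
  have [_ _ mx mn] := zP' i.+1 im; rewrite /d /g.
  case: ifPn => [up|/negbTE/(ndn i im) dn]; case: ifPn => [up'|/negbTE/(ndn i.+1 im') dn'].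
  - by rewrite subrr mul0r mulr_ge0// ltW.
  - have : is_max i.+1 by split => // j [<-].
    by move=> /mx; lra.
  - have : is_min i.+1 by split => // j [<-].
    by move=> /mn; lra.
  - by rewrite subrr mul0r mulr_ge0// ltW.
have t2 : g m * d m.+1 <= e.
  have [_ _ mx mn] := zP' m.+1 (leqnn _).
  rewrite /d /g; case: ifPn => [up|/negbTE/(ndn m (ltnSn m)) dn].
    have : is_max m.+1 by split => [j [<-]//|]; rewrite ltnn.
    by move=> /mx; lra.
  have : is_min m.+1 by split => [j [<-]//|]; rewrite ltnn.
  by move=> /mn; lra.
have t1s : \sum_(i < m) (g i - g i.+1) * d i.+1 <= m%:R * (2 * e).
  apply: le_trans (ler_sum _ (fun i _ => t1 i)) _.
  by rewrite sumr_const card_ord -[X in X <= _]mulr_natl.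
have e0E : e0 = (m%:R + 1) * (2 * e).
  by rewrite /e natr1 [2 * _]mulrC divfK ?pnatr_eq0// mulrC divfK// pnatr_eq0.
lra.
Qed.

End Extrema.

(** * The splitting scheme *)

Lemma diffusion_step {R : realType} (a b tau M V : R) (chi k h rho eta T : R -> R) :
  let mu := @lebesgue_measure R in
  let rhoh := fun x => k x * h x in let etah := fun x => (1 - k x) * h x in
  let m1 := (\int[mu]_(x in `]a, b[) (rhoh x)%:E)%E in
  let m2 := (\int[mu]_(x in `]a, b[) (etah x)%:E)%E in
  a < b -> 0 < tau ->
  {within `[0, +oo[, continuous chi} ->
  (forall x, 0 < x -> derivable chi x 1 /\ derivable (derive1 chi) x 1 /\
                      {for x, continuous (derive1n 2 chi)}) ->
  (forall x, 0 < x -> 0 < derive1n 2 chi x) ->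
  (derive1 chi h @[h --> 0^'+] --> 0) ->
  measurable_fun `]a, b[ k -> (forall x : R, a < x < b -> 0 <= k x <= 1) ->
  (forall x : R, a < x < b -> 0 <= h x <= M) -> var_le a b h V ->
  adm_density a b m1 rho -> adm_density a b m2 eta ->
  (forall f g, adm_density a b m1 f -> adm_density a b m2 g ->
     (jko a b tau chi rhoh etah rho eta <= jko a b tau chi rhoh etah f g)%E) ->
  right_continuous_on a b rho -> right_continuous_on a b eta ->
  (forall x y : R, a < x -> x <= y -> y < b -> T x <= T y) ->
  (forall x : R, a < x < b -> a < T x < b) ->
  (forall B : set R, measurable B ->
     (\int[mu]_(x in `]a, b[ `&` (T @^-1` B)) (rho x + eta x)%:E =
      \int[mu]_(x in `]a, b[ `&` B) (h x)%:E)%E) ->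
  (forall x : R, a < x < b -> 0 <= rho x + eta x <= M) /\
  var_le a b (fun x => rho x + eta x) V.
Proof.
move=> mu rhoh etah m1 m2 ab tau0 chi_cont chi_C2 chi_convex chi_lim0 mk k01 hM hV.
move=> adm1 adm2 minimal rc1 rc2 Tnd Tab push.
have mh := var_le_measurable hV.
have h0 (x : R) : a < x < b -> 0 <= h x by move=> /hM/andP[].
have hM' (x : R) : a < x < b -> h x <= M by move=> /hM/andP[].
have transfer := transfer_inequality ab tau0 chi_cont chi_C2 chi_convex chi_lim0 mk k01 mh h0 hM'
  adm1 adm2 minimal Tnd Tab push.
pose s x := rho x + eta x.
have ms : measurable_fun `]a, b[ s by apply: measurable_funD; [case: adm1|case: adm2].
have s0 (x : R) : a < x < b -> 0 <= s x.
  by move=> xI; apply: addr_ge0; [case: adm1 => _ [+ _]|case: adm2 => _ [+ _]]; exact.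
have s_rc (x : R) : a < x < b -> s y @[y --> x^'+] --> s x.
  by move=> xI; apply: cvgD; [exact: rc1|exact: rc2].
have [L [v_lip v_right v_left]] := optimality ab tau0 chi_C2 chi_convex chi_lim0 s0 s_rc
  Tnd Tab transfer.
have psi_lt := dchi_lt chi_C2 chi_convex chi_lim0.
pose v x := dchi chi (s x).
have v0 (x : R) : a < x < b -> 0 <= v x.
  by move=> _; exact: (dchi_ge0 chi_C2 chi_convex chi_lim0).
split.
  move=> x xI; rewrite -/(s x) s0//=.
  by apply: (target_bound ab tau0 ms s0 mh h0 Tnd Tab push v0 psi_lt _ v_lip v_right v_left).
by apply: (target_variation ab tau0 ms s0 mh h0 Tnd Tab push v0 psi_lt _ v_lip v_right v_left).
Qed.

Section Iteration.
Context {R : realType}.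
Variables (F1 F2 G1 G2 : R -> R -> R) (M S0 V Tf K : R).
Hypothesis FM : forall x y : R, 0 <= x -> 0 <= y ->
  [/\ `|F1 x y| <= M, `|F2 x y| <= M, `|G1 x y| <= M & `|G2 x y| <= M].
Hypothesis M0 : 0 <= M.
Hypothesis S00 : 0 <= S0.
Hypothesis K0 : 0 <= K.

Definition Smax := S0 * expR (2 * M * (Tf + 1)).
Definition rate := 2 * K * expR (4 * K).
Definition Sbound (t : R) := S0 * expR (2 * M * t).
Definition Vbound (t : R) := V * expR (2 * rate * t).

Hypothesis lipS : box_lip Smax K (SigmaF F1 F2 G1 G2).
Hypothesis lipR : box_lip Smax K (RF F1 F2 G1 G2).
Hypothesis V0 : 0 <= V.

Lemma rate_ge0 : 0 <= rate.
Proof. by rewrite !mulr_ge0 ?expR_ge0. Qed.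

Lemma reaction_bounds (a b tau t : R) (sig r sh rh : R -> R) :
  a < b -> 0 < tau < 1 -> 0 <= t <= Tf ->
  (forall x : R, a < x < b -> reaction_step (SigmaF F1 F2 G1 G2) (RF F1 F2 G1 G2) tau
     (sig x) (r x) (sh x) (rh x)) ->
  (forall x : R, a < x < b -> 0 <= sig x <= Sbound t) ->
  var_le a b sig (Vbound t) -> var_le a b r (Vbound t) ->
  [/\ forall x : R, a < x < b -> 0 <= rh x <= 1,
      forall x : R, a < x < b -> 0 <= sh x <= Sbound (t + tau),
      var_le a b sh (Vbound (t + tau)) & var_le a b rh (Vbound (t + tau))].
Proof.
move=> ab tau01 /andP[t0 tT] step sigS sigV rV; have /andP[tau0 tau1] := tau01.
have M0' := M0; have rate0 := rate_ge0; have V0' := V0.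
have bound x : a < x < b ->
    [/\ 0 <= sh x, 0 <= rh x <= 1 & sh x <= expR (2 * M * tau) * sig x].
  by move=> /step; apply: reaction_step_bound => //; exact: ltW.
have inS x u s1 r1 : a < x < b -> 0 <= u <= tau ->
    reaction_step (SigmaF F1 F2 G1 G2) (RF F1 F2 G1 G2) u (sig x) (r x) s1 r1 -> s1 <= Smax.
  move=> xI /andP[u0 ut] st; have [_ _ sle] := reaction_step_bound FM u0 st.
  apply: le_trans sle _; have /andP[sx0 sx] := sigS x xI.
  apply: le_trans (ler_wpM2l (expR_ge0 _) sx) _.
  rewrite /Sbound /Smax mulrCA -expRD ler_wpM2l// ler_expR.
  have : 0 <= M * (Tf + 1 - (u + t)) by rewrite mulr_ge0//; lra.
  lra.
have lip x y : a < x < b -> a < y < b ->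
    `|sh y - sh x| <= (1 + rate * tau) * `|sig y - sig x| + rate * tau * `|r y - r x| /\
    `|rh y - rh x| <= (1 + rate * tau) * `|r y - r x| + rate * tau * `|sig y - sig x|.
  move=> xI yI.
  have [] := reaction_step_lip K0 lipS lipR tau01 _ _ (step y yI) (step x xI).
  - by move=> u s1 r1 uI; exact: inS.
  - by move=> u s1 r1 uI; exact: inS.
  by rewrite -/rate => h1 h2; split; lra.
have grow : (1 + rate * tau) * Vbound t + rate * tau * Vbound t <= Vbound (t + tau).
  rewrite -mulrDl /Vbound mulrCA mulrDr expRD ler_wpM2l//.
  rewrite mulrC ler_wpM2l ?expR_ge0//.
  by apply: le_trans (expR_ge1Dx _); lra.
have rt0 : 0 <= rate * tau by rewrite mulr_ge0// ltW.
have rt1 : 0 <= 1 + rate * tau by rewrite addr_ge0.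
split.
- by move=> x /bound[].
- move=> x xI; have [-> _ sle] := bound x xI; have /andP[sx0 sx] := sigS x xI.
  apply: le_trans sle _; apply: le_trans (ler_wpM2l (expR_ge0 _) sx) _.
  by rewrite /Sbound mulrCA -expRD -mulrDr [tau + t]addrC.
- apply: var_leW grow _; apply: (var_le_incr rt1 rt0 sigV rV) => x y xI yI.
  by have [] := lip x y xI yI.
- apply: var_leW grow _; apply: (var_le_incr rt1 rt0 rV sigV) => x y xI yI.
  by have [] := lip x y xI yI.
Qed.

End Iteration.

Theorem mainTheorem9 (R : realType) (a b Tf : R) (chi : R -> R)
    (F1 F2 G1 G2 : R -> R -> R) (rho0 eta0 r0 : R -> R) :
  a < b -> 0 < Tf ->
  (* internal energy density chi *)
  {within `[0, +oo[, continuous chi} ->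
  (forall x, 0 < x -> derivable chi x 1 /\ derivable (derive1 chi) x 1 /\
                      {for x, continuous (derive1n 2 chi)}) ->
  (forall x, 0 < x -> 0 < derive1n 2 chi x) ->
  (derive1 chi h @[h --> 0^'+] --> 0) ->
  (forall s, 0 < s ->
     (@lebesgue_measure R).-integrable `]0, s] (fun x => (kappa chi x)%:E)) ->
  (* reaction terms *)
  bounded_nonneg2 F1 -> bounded_nonneg2 F2 -> bounded_nonneg2 G1 -> bounded_nonneg2 G2 ->
  lipschitz_nonneg2 F1 -> lipschitz_nonneg2 F2 ->
  lipschitz_nonneg2 G1 -> lipschitz_nonneg2 G2 ->
  (forall y, 0 <= y -> 0 <= G1 0 y) ->
  (forall x, 0 <= x -> 0 <= G2 x 0) ->
  (* initial data *)
  (forall x, a < x < b -> 0 <= rho0 x /\ 0 <= eta0 x) ->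
  (exists M : R, forall x, a < x < b -> `|rho0 x| <= M /\ `|eta0 x| <= M) ->
  (tv a b rho0 < +oo)%E -> (tv a b eta0 < +oo)%E -> (tv a b r0 < +oo)%E ->
  (forall x, a < x < b -> 0 <= r0 x <= 1) ->
  (forall x, a < x < b -> 0 < rho0 x + eta0 x ->
     r0 x = rho0 x / (rho0 x + eta0 x)) ->
  exists C : R,
    forall (tau : R) (N : nat) (r sig rh sh rhoD etaD Tm : nat -> R -> R),
      0 < tau < 1 -> N%:R * tau = Tf ->
      scheme_run a b chi F1 F2 G1 G2 r0 (fun x => rho0 x + eta0 x) tau N
        r sig rh sh rhoD etaD Tm ->
      forall n, (n <= N)%N ->
        (forall x, a < x < b ->
           `|r n x| <= C /\ `|sig n x| <= C /\
           `|r n x * sig n x| <= C /\ `|(1 - r n x) * sig n x| <= C) /\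
        (tv a b (r n) <= C%:E)%E /\ (tv a b (sig n) <= C%:E)%E /\
        (tv a b (fun x => (r n x * sig n x)%R) <= C%:E)%E /\
        (tv a b (fun x => ((1 - r n x) * sig n x)%R) <= C%:E)%E.
Proof.
move=> ab Tf0 chi_cont chi_C2 chi_convex chi_lim0 _ bF1 bF2 bG1 bG2 lF1 lF2 lG1 lG2 _ _.
move=> init0 [Mi initM] /tv_fin_var_le[V1 rhoV] /tv_fin_var_le[V2 etaV] /tv_fin_var_le[V3 rV] r01 _.
have [M [M0 FM]] : exists M : R, 0 <= M /\ forall x y : R, 0 <= x -> 0 <= y ->
    [/\ `|F1 x y| <= M, `|F2 x y| <= M, `|G1 x y| <= M & `|G2 x y| <= M].
  case: bF1 bF2 bG1 bG2 => [N1 B1] [N2 B2] [N3 B3] [N4 B4].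
  have nn (F : R -> R -> R) N : (forall x y, 0 <= x -> 0 <= y -> `|F x y| <= N) -> 0 <= N.
    by move=> /(_ 0 0 (lexx _) (lexx _)); apply: le_trans.
  have n1 := nn _ _ B1; have n2 := nn _ _ B2; have n3 := nn _ _ B3; have n4 := nn _ _ B4.
  exists (N1 + N2 + N3 + N4); split; first by rewrite !addr_ge0.
  move=> x y x0 y0; have := B1 x y x0 y0; have := B2 x y x0 y0; have := B3 x y x0 y0.
  by have := B4 x y x0 y0 => *; split; lra.
have mid : a < (a + b) / 2 < b by apply/andP; split; lra.
have Mi0 : 0 <= Mi by have [h _] := initM _ mid; exact: le_trans h.
pose S0 := Mi + Mi; have S00 : 0 <= S0 by rewrite addr_ge0.
pose Sm := Smax M S0 Tf.
have Sm0 : 0 <= Sm by rewrite mulr_ge0 ?expR_ge0.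
have [K K0 [lipS lipR]] := box_lip_reaction Sm0 bF1 bF2 bG1 bG2 lF1 lF2 lG1 lG2.
have v1 := var_le_ge0 ab rhoV; have v2 := var_le_ge0 ab etaV; have v3 := var_le_ge0 ab rV.
pose V := V1 + V2 + V3; have V0 : 0 <= V by rewrite !addr_ge0.
pose VT := Vbound V K Tf.
have VT0 : 0 <= VT by rewrite mulr_ge0 ?expR_ge0.
have rate0 := rate_ge0 K0.
exists (1 + Sm + VT + (Sm * VT + VT)) => tau N r sig rh sh rhoD etaD Tm tau01 NT.
move=> [r_init [sig_init steps]]; have /andP[tau0 tau1] := tau01.
have timeT n : (n <= N)%N -> 0 <= n%:R * tau <= Tf.
  by move=> nN; rewrite mulr_ge0 ?(ltW tau0)//= -NT ler_wpM2r ?(ltW tau0)// ler_nat.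
have inv n : (n <= N)%N ->
    [/\ forall x : R, a < x < b -> 0 <= r n x <= 1,
        forall x : R, a < x < b -> 0 <= sig n x <= Sbound M S0 (n%:R * tau),
        var_le a b (sig n) (Vbound V K (n%:R * tau)) & var_le a b (r n) (Vbound V K (n%:R * tau))].
  elim: n => [|n IH] nN.
    rewrite mul0r /Sbound /Vbound !mulr0 expR0 !mulr1; split.
    - by move=> x xI; rewrite r_init r01.
    - move=> x xI; rewrite sig_init; have [? ?] := init0 x xI.
      have [+ +] := initM x xI; rewrite !ger0_norm// => ? ?.
      by rewrite addr_ge0//= lerD.
    - apply: (eq_var_le (fun x _ => esym (sig_init x))).
      by apply: var_leW (var_leD rhoV etaV); rewrite lerDl.
    - apply: (eq_var_le (fun x _ => esym (r_init x))).
      by apply: var_leW rV; rewrite lerDr addr_ge0.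
  have [_ sigS sigV rnV] := IH (ltnW nN).
  have [react [diff [sigE [Tnd [Tab [push rE]]]]]] := steps n nN.
  have [rh01 shS shV rhV] := reaction_bounds FM M0 S00 K0 lipS lipR V0 ab tau01
    (timeT n (ltnW nN)) react sigS sigV rnV.
  rewrite -natr1 mulrDl mul1r.
  move: diff => /= [adm1 [adm2 [minimal [rc1 rc2]]]].
  have push' (B : set R) : measurable B ->
      (\int[@lebesgue_measure R]_(x in `]a, b[ `&` (Tm n @^-1` B)) (rhoD n x + etaD n x)%:E =
       \int[@lebesgue_measure R]_(x in `]a, b[ `&` B) (sh n x)%:E)%E.
    by move=> mB; rewrite -push//; apply: eq_integral => x _; rewrite sigE.
  have [sS sV] := diffusion_step ab tau0 chi_cont chi_C2 chi_convex chi_lim0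
    (var_le_measurable rhV) rh01 shS shV adm1 adm2 minimal rc1 rc2 Tnd Tab push'.
  split.
  - by move=> x xI; rewrite rE//; apply: rh01; exact: Tab.
  - by move=> x xI; rewrite sigE; exact: sS.
  - exact: (eq_var_le (fun x _ => esym (sigE x))).
  - apply: (eq_var_le (fun x xI => esym (rE x xI))).
    exact: var_le_comp_homo.
move=> n nN; have [rn01 sigS sigV rV'] := inv n nN; have /andP[t0 tT] := timeT n nN.
have sigSm (x : R) : a < x < b -> 0 <= sig n x <= Sm.
  move=> /sigS/andP[-> /=]; move=> /le_trans; apply.
  rewrite ler_wpM2l// ler_expR; have : 0 <= M * (Tf + 1 - n%:R * tau) by rewrite mulr_ge0//; lra.
  lra.
have VnT : Vbound V K (n%:R * tau) <= VT.
  by rewrite ler_wpM2l// ler_expR ler_wpM2l// mulr_ge0.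
have {}sigV := var_leW VnT sigV; have {}rV' := var_leW VnT rV'.
have SV0 : 0 <= Sm * VT by rewrite mulr_ge0.
have VCle : VT <= 1 + Sm + VT + (Sm * VT + VT) by lra.
have rV'' := var_le_subl 1 rV'.
have prodV (f : R -> R) : var_le a b f VT -> (forall x : R, a < x < b -> 0 <= f x <= 1) ->
    (tv a b (fun x => f x * sig n x)%R <= (1 + Sm + VT + (Sm * VT + VT))%:E)%E.
  move=> fV f01; apply/tv_leP; apply: (@var_leW _ _ _ _ (Sm * VT + 1 * VT)); first lra.
  apply: (var_leM ler01 Sm0 fV sigV) => x xI.
    by have /andP[? ?] := f01 x xI; rewrite ger0_norm.
  by have /andP[? ?] := sigSm x xI; rewrite ger0_norm.
split.
  move=> x xI; have /andP[r0' r1'] := rn01 x xI; have /andP[s0' s1'] := sigSm x xI.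
  have p1 : 0 <= r n x * sig n x <= Sm.
    rewrite mulr_ge0//= (le_trans _ s1')// ler_piMl//.
  have p2 : 0 <= (1 - r n x) * sig n x <= Sm.
    by rewrite mulr_ge0 ?subr_ge0//= (le_trans _ s1')// ler_piMl//; lra.
  case/andP: p1 => ? ?; case/andP: p2 => ? ?.
  by rewrite !ger0_norm//; split; [|split; [|split]]; lra.
split; first by apply/tv_leP; exact: var_leW rV'.
split; first by apply/tv_leP; exact: var_leW sigV.
split; first exact: prodV.
apply: prodV => // x xI; have /andP[? ?] := rn01 x xI; apply/andP; split; lra.
Qed.
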